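(* Let $0<r<1$, let $A_r=\{\xi\in\mathbb{C}: r<|\xi|<1\}$, let $p\in(-1,-\sqrt{r})$, and let $D=A_r\setminus\{p\}$. Then for every $z\in(r,1)$, $$i_{D}^{c}(z)\neq\tanh\left[c_{A_r}(z,p)\right]\quad\text{and}\quad H_{D}^{c}(z)\neq\tanh\left[c_{A_r}(z,p)\right].$$
   Context: Let $\mathbb{D}=\{\xi\in\mathbb{C}:|\xi|<1\}$. The Carathéodory pseudodistance on a domain $G\subseteq\mathbb{C}$ is $$c_G(\xi_1,\xi_2)=\sup\{\tanh^{-1}|\alpha| : f:G\to\mathbb{D}\text{ holomorphic},\ f(\xi_1)=0,\ f(\xi_2)=\alpha\}.$$ $G$ is $c$-hyperbolic if $c_G$ is a distance (as is the case for bounded domains). For $z\in G$ and $s>0$ put $B_G^c(z,s)=\{\xi\in G: c_G(z,\xi)<s\}$. For a $c$-hyperbolic domain $G\subseteq\mathbb{C}$ and $z\in G$: the (modified) Fridman invariant with respect to the Carathéodory metric is $$H_G^c(z)=\sup\{\tanh s : s>0,\ B_G^c(z,s)\subseteq f(\mathbb{D})\text{ for some injective holomorphic } f:\mathbb{D}\to G\};$$ the injectivity radius function with respect to the Carathéodory metric is $$i_G^c(z)=\sup\{\tanh s : s>0,\ B_G^c(z,s)\text{ is simply connected}\}$$ (simply connected includes connected). *)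

(* Defs.v *)
From Stdlib Require Import Reals Lra.
From Coquelicot Require Import Coquelicot.
Open Scope R_scope.

Definition artanh (x : R) : R := / 2 * ln ((1 + x) / (1 - x)).

Lemma tanh_artanh (x : R) : -1 < x < 1 -> tanh (artanh x) = x.
Proof.
intros Hx.
set (q := (1 + x) / (1 - x)).
assert (Hq : 0 < q) by (apply Rdiv_lt_0_compat; lra).
set (a := exp (artanh x)).
assert (Ha : 0 < a) by apply exp_pos.
assert (Haa : a * a = q).
{ unfold a, artanh; fold q; rewrite <- exp_plus.
  replace (/ 2 * ln q + / 2 * ln q) with (ln q) by lra.
  now apply exp_ln. }
assert (Hsum : a * a * (1 - x) = 1 + x).
{ rewrite Haa; unfold q; field; lra. }
unfold tanh, sinh, cosh; rewrite exp_Ropp; fold a.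
replace ((a - / a) / 2 / ((a + / a) / 2)) with ((a * a - 1) / (a * a + 1))
  by (field; nra).
apply (Rmult_eq_reg_r (a * a + 1)); [|nra].
field_simplify; nra.
Qed.

Definition unit_disc : C -> Prop := fun x => Cmod x < 1.

Definition annulus (r : R) : C -> Prop := fun x => r < Cmod x < 1.

(* Functions on a subset of C are total functions on C whose values off the
   subset are irrelevant. Since complex differentiability is required at each
   point of [G], the notion is meant for open [G]. *)
Definition holomorphic_on (G : C -> Prop) (f : C -> C) : Prop :=
  forall x : C, G x -> ex_derive f x.

Definition maps_to (G H : C -> Prop) (f : C -> C) : Prop :=
  forall x : C, G x -> H (f x).

Definition injective_on (G : C -> Prop) (f : C -> C) : Prop :=
  forall x y : C, G x -> G y -> f x = f y -> x = y.

(* The supremum is taken in [Rbar], but is finite when [G] is a domain. *)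
Definition carath (G : C -> Prop) (x y : C) : Rbar :=
  Lub_Rbar (fun t : R => exists f : C -> C,
    holomorphic_on G f /\ maps_to G unit_disc f /\
    f x = 0%C /\ t = artanh (Cmod (f y))).

Definition carath_ball (G : C -> Prop) (z : C) (s : R) : C -> Prop :=
  fun x => G x /\ Rbar_lt (carath G z x) s.

Definition unit_interval : R -> Prop := fun t => 0 <= t <= 1.

Definition unit_square : R * R -> Prop :=
  fun u => unit_interval (fst u) /\ unit_interval (snd u).

Definition is_path_in (U : C -> Prop) (g : R -> C) : Prop :=
  continuous_on unit_interval g /\ forall t : R, unit_interval t -> U (g t).

Definition path_connected (U : C -> Prop) : Prop :=
  (exists x : C, U x) /\
  forall x y : C, U x -> U y ->
    exists g : R -> C, is_path_in U g /\ g 0 = x /\ g 1 = y.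

(* In [h (t, u)] the loop parameter is [t] and the deformation parameter
   is [u]; the base point stays fixed. *)
Definition null_homotopic_in (U : C -> Prop) (g : R -> C) : Prop :=
  exists h : R * R -> C,
    continuous_on unit_square h /\
    (forall u : R * R, unit_square u -> U (h u)) /\
    (forall t : R, unit_interval t -> h (t, 0) = g t) /\
    (forall t : R, unit_interval t -> h (t, 1) = g 0) /\
    (forall u : R, unit_interval u -> h (0, u) = g 0 /\ h (1, u) = g 0).

(* Used only for open subsets of the plane, where connectedness and
   path-connectedness agree. *)
Definition simply_connected (U : C -> Prop) : Prop :=
  path_connected U /\
  forall g : R -> C, is_path_in U g -> g 0 = g 1 -> null_homotopic_in U g.

(* In the next two definitions the set whose supremum is taken is bounded by 1;
   it is nonempty when [G] is a c-hyperbolic domain and [z] belongs to [G], so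
   that [real] then returns the actual supremum. *)
Definition fridman_invariant (G : C -> Prop) (z : C) : R :=
  real (Lub_Rbar (fun t : R => exists s : R,
    0 < s /\ t = tanh s /\
    exists f : C -> C,
      holomorphic_on unit_disc f /\ maps_to unit_disc G f /\
      injective_on unit_disc f /\
      forall x : C, carath_ball G z s x ->
        exists w : C, unit_disc w /\ f w = x)).

Definition injectivity_radius (G : C -> Prop) (z : C) : R :=
  real (Lub_Rbar (fun t : R => exists s : R,
    0 < s /\ t = tanh s /\ simply_connected (carath_ball G z s))).

(* Main.v *)
(* Write [r = s^2]. The quotient of the annulus by [u -> r / u] is a disc, and the quotient map [f0]
   has its critical points at [s] and [- s]. For real [z] in the annulus the point of the circle
   [|u| = s] farthest from [z] is [- s], at distance [artanh (f0 z)], while any [p] with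
   [-1 < p < - s] has [f0 p < 0] and is therefore strictly farther from [z] than this.
   Hence for every radius beyond some value below [c(z, p)] the ball around [z] contains the circle
   [|u| = s], which winds around the hole, so it is neither simply connected nor contained in a
   univalent image of the disc, and both invariants are smaller than [tanh c(z, p)].

   The upper bound on the circle is a duality argument. If [f] vanishes at [w], [|w| = s], divide it
   by a function [h] of modulus 1 on the boundary with zeros [w] and [- s]. The value of [f / h] at
   [z] is an average of its boundary values against a positive measure, given by a kernel with a pole
   at [z] whose zero at [- s] absorbs the second zero of [h]; hence [|f z| <= |h z| <= f0 z]. A
   puncture, where [f] is bounded, does not affect the contour integrals. *)

Require Import Defs.
From Stdlib Require Import Reals Lra Lia List ClassicalEpsilon.
From Coquelicot Require Import Coquelicot.
Open Scope R_scope.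

(** The bound |h z| <= f0 z uses the duality a second time. Each factor of h is a rotated copy of
    one function with a single zero, at - s. The quotient of a rotated copy by the unrotated one is
    nearly unimodular on the boundary, and its only pole in the annulus, at - s, meets the zero of
    the kernel; so on each circle the unrotated function is largest on the positive ray, opposite to
    its zero.

    Strictness has to be uniform in f. Moving f0 z to 0 by a Moebius map shows that, up to
    truncation, tanh c(z, p) is at least (a + b) / (1 + a b) with a = f0 z and b = - f0 p, which
    exceeds a by an amount controlled by b. As infinite products are truncated, b needs a lower
    bound independent of the number N of factors, and only then is N chosen. Finiteness of c(z, p)
    must be proved too, since [real] sends an infinite value to 0; a chain of discs from z to p
    gives it.

    All the analysis comes from one form of Cauchy's theorem: integrals over concentric circles
    agree. It has to tolerate the centres of difference quotients, where only continuity is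
    established, and the puncture. *)

Lemma lt_min_l x a b : x < Rmin a b -> x < a.
Proof. intros H; eapply Rlt_le_trans; [exact H|apply Rmin_l]. Qed.

Lemma lt_min_r x a b : x < Rmin a b -> x < b.
Proof. intros H; eapply Rlt_le_trans; [exact H|apply Rmin_r]. Qed.

Ltac min_le := solve [apply Rmin_l | apply Rmin_r
  | eapply Rle_trans; [apply Rmin_l|min_le] | eapply Rle_trans; [apply Rmin_r|min_le]].

Lemma inv_gt1 x : 0 < x < 1 -> 1 < / x.
Proof. intros H; rewrite <- Rinv_1 at 1; apply Rinv_lt_contravar; lra. Qed.

(** * Continuity and complex differentiability at a point *)

Definition cont_at (f : C -> C) (x : C) : Prop :=
  forall eps, 0 < eps -> exists d, 0 < d /\
    forall y, Cmod (y - x) < d -> Cmod (f y - f x) < eps.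

(** Caratheodory's form of differentiability: the increment factors through a function continuous at
    [x]. The product, quotient and chain rules become algebraic identities between such factors. *)
Definition cdiff (f : C -> C) (x : C) : Prop :=
  exists phi : C -> C, cont_at phi x /\
    exists d, 0 < d /\ forall y, Cmod (y - x) < d -> (f y - f x = phi y * (y - x))%C.

Lemma Cmod_sub_sym x y : Cmod (x - y) = Cmod (y - x).
Proof. rewrite <- Cmod_opp; f_equal; ring. Qed.

Lemma Cmod_sub_self x : Cmod (x - x) = 0.
Proof. replace (x - x)%C with (RtoC 0) by ring; apply Cmod_0. Qed.

Lemma Cmod_sub_ge x y : Cmod x - Cmod y <= Cmod (x - y).
Proof.
generalize (Cmod_triangle (x - y) y); replace (x - y + y)%C with x by ring; lra.
Qed.

Lemma Cmod_sub_le x y : Cmod (x - y) <= Cmod x + Cmod y.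
Proof.
unfold Cminus; rewrite <- (Cmod_opp y); apply Cmod_triangle.
Qed.

Lemma is_derive_iff_eps (f : C -> C) (x l : C) :
  is_derive f x l <->
  (forall eps, 0 < eps -> exists d, 0 < d /\
    forall y, Cmod (y - x) < d -> Cmod (f y - f x - (y - x) * l) <= eps * Cmod (y - x)).
Proof.
split.
- intros [_ H] eps He.
  destruct (H x (fun P HP => HP) (mkposreal eps He)) as [d Hd].
  exists d; split; [apply cond_pos|]; intros y Hy; apply Hd, Hy.
- intros H; split; [apply is_linear_scal_l|].
  intros x0 Hx0 eps.
  apply (is_filter_lim_locally_unique (K := C_AbsRing) (V := AbsRing_NormedModule C_AbsRing)) in Hx0.
  subst x0.
  destruct (H eps (cond_pos eps)) as [d [Hd Hy]].
  exists (mkposreal d Hd); intros y; apply Hy.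
Qed.

Lemma ex_derive_cdiff (f : C -> C) (x : C) : ex_derive f x <-> cdiff f x.
Proof.
split.
- intros [l Hl]; rewrite is_derive_iff_eps in Hl.
  exists (fun y => if excluded_middle_informative (y = x) then l else (f y - f x) / (y - x))%C.
  split.
  + intros eps He; destruct (Hl (eps / 2)) as [d [Hd H]]; [lra|].
    exists d; split; [exact Hd|]; intros y Hy; cbv beta.
    destruct (excluded_middle_informative (x = x)) as [_|E]; [|now elim E].
    destruct (excluded_middle_informative (y = x)) as [E|E].
    { rewrite Cmod_sub_self; lra. }
    assert (Hn : (y - x)%C <> 0%C).
    { intros E'; apply E; replace y with (y - x + x)%C by ring; rewrite E'; ring. }
    replace ((f y - f x) / (y - x) - l)%C with ((f y - f x - (y - x) * l) / (y - x))%C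
      by (field; exact Hn).
    assert (Hp := proj1 (Cmod_gt_0 _) Hn).
    rewrite Cmod_div by exact Hn.
    apply Rle_lt_trans with (eps / 2); [|lra].
    apply Rmult_le_reg_r with (Cmod (y - x)); [exact Hp|].
    unfold Rdiv at 1; rewrite Rmult_assoc, Rinv_l, Rmult_1_r by lra.
    now apply H.
  + exists 1; split; [lra|]; intros y _.
    destruct (excluded_middle_informative (y = x)) as [E|E].
    { rewrite E; ring. }
    field; intros E'; apply E; replace y with (y - x + x)%C by ring; rewrite E'; ring.
- intros [phi [Hc [d [Hd H]]]]; exists (phi x); apply is_derive_iff_eps.
  intros eps He; destruct (Hc eps He) as [d' [Hd' H']].
  exists (Rmin d d'); split; [now apply Rmin_glb_lt|]; intros y Hy.
  rewrite H by (eapply Rlt_le_trans; [exact Hy|apply Rmin_l]).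
  replace (phi y * (y - x) - (y - x) * phi x)%C with ((phi y - phi x) * (y - x))%C by ring.
  rewrite Cmod_mult; apply Rmult_le_compat_r; [apply Cmod_ge_0|].
  left; apply H'; eapply Rlt_le_trans; [exact Hy|apply Rmin_r].
Qed.

Lemma cont_const c x : cont_at (fun _ => c) x.
Proof.
intros eps He; exists 1; split; [lra|]; intros y _; rewrite Cmod_sub_self; lra.
Qed.

Lemma cont_id x : cont_at (fun y => y) x.
Proof. intros eps He; exists eps; tauto. Qed.

Lemma near_and (x : C) (P Q : C -> Prop) :
  (exists d, 0 < d /\ forall y, Cmod (y - x) < d -> P y) ->
  (exists d, 0 < d /\ forall y, Cmod (y - x) < d -> Q y) ->
  exists d, 0 < d /\ forall y, Cmod (y - x) < d -> P y /\ Q y.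
Proof.
intros [d [Hd H]] [d' [Hd' H']]; exists (Rmin d d'); split; [now apply Rmin_glb_lt|].
intros y Hy; split; [apply H, (lt_min_l _ _ _ Hy)|apply H', (lt_min_r _ _ _ Hy)].
Qed.

Lemma cont_plus f g x : cont_at f x -> cont_at g x -> cont_at (fun y => f y + g y)%C x.
Proof.
intros Hf Hg eps He.
destruct (near_and _ _ _ (Hf (eps / 2) ltac:(lra)) (Hg (eps / 2) ltac:(lra))) as [d [Hd H]].
exists d; split; [exact Hd|]; intros y Hy; destruct (H y Hy) as [H1 H2].
replace (f y + g y - (f x + g x))%C with ((f y - f x) + (g y - g x))%C by ring.
eapply Rle_lt_trans; [apply Cmod_triangle|]; lra.
Qed.

Lemma cont_bound f x : cont_at f x -> exists d B, 0 < d /\ 0 < B /\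
  forall y, Cmod (y - x) < d -> Cmod (f y) <= B.
Proof.
intros Hf; destruct (Hf 1 Rlt_0_1) as [d [Hd H]].
exists d, (Cmod (f x) + 1); split; [exact Hd|]; split.
{ generalize (Cmod_ge_0 (f x)); lra. }
intros y Hy; specialize (H y Hy); generalize (Cmod_sub_ge (f y) (f x)); lra.
Qed.

Lemma cont_mult f g x : cont_at f x -> cont_at g x -> cont_at (fun y => f y * g y)%C x.
Proof.
intros Hf Hg eps He.
destruct (cont_bound f x Hf) as [d0 [B [Hd0 [HB Hb]]]].
assert (Hgx := Cmod_ge_0 (g x)).
destruct (Hf (eps / 2 / (Cmod (g x) + 1))) as [d [Hd H]].
{ apply Rdiv_lt_0_compat; lra. }
destruct (Hg (eps / 2 / B)) as [d' [Hd' H']].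
{ apply Rdiv_lt_0_compat; lra. }
exists (Rmin d0 (Rmin d d')); split; [repeat apply Rmin_glb_lt; assumption|]; intros y Hy.
assert (Hy0 := lt_min_l _ _ _ Hy).
assert (Hy1 := lt_min_r _ _ _ Hy).
assert (Hy2 := lt_min_l _ _ _ Hy1).
assert (Hy3 := lt_min_r _ _ _ Hy1).
specialize (H y Hy2); specialize (H' y Hy3); specialize (Hb y Hy0).
replace (f y * g y - f x * g x)%C with (f y * (g y - g x) + (f y - f x) * g x)%C by ring.
eapply Rle_lt_trans; [apply Cmod_triangle|]; rewrite 2!Cmod_mult.
assert (Cmod (f y) * Cmod (g y - g x) <= B * Cmod (g y - g x)).
{ apply Rmult_le_compat_r; [apply Cmod_ge_0|exact Hb]. }
assert (B * Cmod (g y - g x) < eps / 2).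
{ apply Rmult_lt_reg_r with (/ B); [now apply Rinv_0_lt_compat|].
  replace (B * Cmod (g y - g x) * / B) with (Cmod (g y - g x)) by (field; lra); exact H'. }
assert (Cmod (f y - f x) * Cmod (g x) <= eps / 2).
{ apply Rle_trans with (Cmod (f y - f x) * (Cmod (g x) + 1)).
  - apply Rmult_le_compat_l; [apply Cmod_ge_0|lra].
  - apply Rmult_le_reg_r with (/ (Cmod (g x) + 1)); [apply Rinv_0_lt_compat; lra|].
    rewrite Rmult_assoc, Rinv_r, Rmult_1_r by lra; left; exact H. }
lra.
Qed.

Lemma cont_inv f x : cont_at f x -> f x <> 0%C -> cont_at (fun y => / f y)%C x.
Proof.
intros Hf Hx eps He.
assert (Hm := proj1 (Cmod_gt_0 _) Hx); set (m := Cmod (f x)) in *.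
destruct (Hf (Rmin (m / 2) (eps * (m * m / 2)))) as [d [Hd H]].
{ apply Rmin_glb_lt; [lra|]; apply Rmult_lt_0_compat; nra. }
exists d; split; [exact Hd|]; intros y Hy; specialize (H y Hy).
assert (H1 := lt_min_l _ _ _ H).
assert (H2 := lt_min_r _ _ _ H).
assert (Hy2 : m / 2 < Cmod (f y)).
{ generalize (Cmod_sub_ge (f x) (f y)); rewrite Cmod_sub_sym; fold m; lra. }
assert (Hfy : f y <> 0%C) by (apply Cmod_gt_0; lra).
replace (/ f y - / f x)%C with (- (f y - f x) / (f y * f x))%C by (field; tauto).
rewrite Cmod_div by (apply Cmult_neq_0; assumption).
rewrite Cmod_opp, Cmod_mult; fold m.
apply Rmult_lt_reg_r with (Cmod (f y) * m); [apply Rmult_lt_0_compat; lra|].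
unfold Rdiv; rewrite Rmult_assoc, Rinv_l, Rmult_1_r by (apply Rgt_not_eq, Rmult_lt_0_compat; lra).
eapply Rlt_trans; [exact H2|]; apply Rmult_lt_compat_l; [exact He|]; nra.
Qed.

Lemma cont_comp f g x : cont_at g x -> cont_at f (g x) -> cont_at (fun y => f (g y)) x.
Proof.
intros Hg Hf eps He; destruct (Hf eps He) as [d [Hd H]].
destruct (Hg d Hd) as [d' [Hd' H']]; exists d'; split; [exact Hd'|]; intros y Hy.
now apply H, H'.
Qed.

Lemma cont_ext_loc f g x d : 0 < d -> (forall y, Cmod (y - x) < d -> f y = g y) ->
  cont_at f x -> cont_at g x.
Proof.
intros Hd E Hf eps He; destruct (Hf eps He) as [d' [Hd' H]].
exists (Rmin d d'); split; [now apply Rmin_glb_lt|]; intros y Hy.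
rewrite <- 2!E.
- apply H; eapply Rlt_le_trans; [exact Hy|apply Rmin_r].
- rewrite Cmod_sub_self; exact Hd.
- eapply Rlt_le_trans; [exact Hy|apply Rmin_l].
Qed.

Lemma cdiff_cont f x : cdiff f x -> cont_at f x.
Proof.
intros [phi [Hc [d [Hd H]]]].
apply cont_ext_loc with (fun y => phi y * (y - x) + f x)%C d; [exact Hd| |].
{ intros y Hy; rewrite <- H by exact Hy; ring. }
apply cont_plus; [apply cont_mult; [exact Hc|]|apply cont_const].
apply (cont_plus (fun y => y) (fun _ => - x)%C); [apply cont_id|apply cont_const].
Qed.

Lemma cdiff_ext_loc f g x d : 0 < d -> (forall y, Cmod (y - x) < d -> f y = g y) ->
  cdiff f x -> cdiff g x.
Proof.
intros Hd E [phi [Hc [d' [Hd' H]]]]; exists phi; split; [exact Hc|].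
exists (Rmin d d'); split; [now apply Rmin_glb_lt|]; intros y Hy.
rewrite <- 2!E.
- apply H; eapply Rlt_le_trans; [exact Hy|apply Rmin_r].
- rewrite Cmod_sub_self; exact Hd.
- eapply Rlt_le_trans; [exact Hy|apply Rmin_l].
Qed.

Lemma cdiff_const c x : cdiff (fun _ => c) x.
Proof.
exists (fun _ => 0%C); split; [apply cont_const|].
exists 1; split; [lra|]; intros; ring.
Qed.

Lemma cdiff_id x : cdiff (fun y => y) x.
Proof.
exists (fun _ => 1%C); split; [apply cont_const|].
exists 1; split; [lra|]; intros; ring.
Qed.

Lemma cdiff_plus f g x : cdiff f x -> cdiff g x -> cdiff (fun y => f y + g y)%C x.
Proof.
intros [u [Hu Hf]] [v [Hv Hg]]; exists (fun y => u y + v y)%C; split; [now apply cont_plus|].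
destruct (near_and _ _ _ Hf Hg) as [d [Hd H]].
exists d; split; [exact Hd|]; intros y Hy; destruct (H y Hy) as [H1 H2].
replace (f y + g y - (f x + g x))%C with ((f y - f x) + (g y - g x))%C by ring.
rewrite H1, H2; ring.
Qed.

Lemma cdiff_mult f g x : cdiff f x -> cdiff g x -> cdiff (fun y => f y * g y)%C x.
Proof.
intros Df [v [Hv Hg]]; assert (Cf := cdiff_cont _ _ Df); destruct Df as [u [Hu Hf]].
exists (fun y => f y * v y + u y * g x)%C; split.
{ apply cont_plus; apply cont_mult; try assumption; apply cont_const. }
destruct (near_and _ _ _ Hf Hg) as [d [Hd H]].
exists d; split; [exact Hd|]; intros y Hy; destruct (H y Hy) as [H1 H2].
replace (f y * g y - f x * g x)%C with (f y * (g y - g x) + (f y - f x) * g x)%C by ring.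
rewrite H1, H2; ring.
Qed.

Lemma cdiff_opp f x : cdiff f x -> cdiff (fun y => - f y)%C x.
Proof.
intros H; apply cdiff_ext_loc with (fun y => (-(1)) * f y)%C 1; [lra|intros; ring|].
apply cdiff_mult; [apply cdiff_const|exact H].
Qed.

Lemma cdiff_minus f g x : cdiff f x -> cdiff g x -> cdiff (fun y => f y - g y)%C x.
Proof. intros Hf Hg; apply cdiff_plus; [exact Hf|now apply cdiff_opp]. Qed.

Lemma cdiff_inv f x : cdiff f x -> f x <> 0%C -> cdiff (fun y => / f y)%C x.
Proof.
intros Df Hx; assert (Cf := cdiff_cont _ _ Df); destruct Df as [u [Hu Hf]].
exists (fun y => - u y * (/ f y * / f x))%C; split.
{ apply cont_mult.
  - apply cont_ext_loc with (fun y => (-(1)) * u y)%C 1; [lra|intros; ring|].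
    apply cont_mult; [apply cont_const|exact Hu].
  - apply cont_mult; [now apply cont_inv|apply cont_const]. }
assert (Hm := proj1 (Cmod_gt_0 _) Hx).
destruct (near_and _ _ _ Hf (Cf _ Hm)) as [d [Hd Hn]].
exists d; split; [exact Hd|]; intros y Hy; destruct (Hn y Hy) as [H H'].
assert (f y <> 0%C).
{ intros E; rewrite E in H'; replace (0 - f x)%C with (- f x)%C in H' by ring.
  rewrite Cmod_opp in H'; lra. }
transitivity (- (f y - f x) * (/ f y * / f x))%C; [field; tauto|rewrite H; ring].
Qed.

Lemma cdiff_div f g x : cdiff f x -> cdiff g x -> g x <> 0%C -> cdiff (fun y => f y / g y)%C x.
Proof. intros Hf Hg H; apply cdiff_mult; [exact Hf|now apply cdiff_inv]. Qed.

Lemma cdiff_comp f g x : cdiff g x -> cdiff f (g x) -> cdiff (fun y => f (g y)) x.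
Proof.
intros Hg Hf; assert (Cg := cdiff_cont _ _ Hg); revert Hg Hf.
intros [v [Hv [d' [Hd' H']]]] [u [Hu [d [Hd H]]]].
exists (fun y => u (g y) * v y)%C; split.
{ apply cont_mult; [now apply cont_comp|exact Hv]. }
destruct (near_and _ _ _ (Cg d Hd) (ex_intro _ d' (conj Hd' H'))) as [e [He Hn]].
exists e; split; [exact He|]; intros y Hy; destruct (Hn y Hy) as [Hg Hv'].
rewrite H by exact Hg; rewrite Hv'; ring.
Qed.

(** The value filled in at [a] makes the quotient continuous there. Only continuity is established
    at [a] itself, which is why the circle integrals below carry a list of exceptional points. *)
Definition slope (f : C -> C) (a : C) : C -> C := fun y =>
  if excluded_middle_informative (y = a) then C_derive f a else ((f y - f a) / (y - a))%C.

Lemma Cminus_neq0 (x y : C) : x <> y -> (x - y)%C <> 0%C.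
Proof. intros H E; apply H; replace x with (x - y + y)%C by ring; rewrite E; ring. Qed.

Lemma slope_spec f a y : (f y - f a = slope f a y * (y - a))%C.
Proof.
unfold slope; destruct (excluded_middle_informative (y = a)) as [E|E].
- rewrite E; ring.
- field; now apply Cminus_neq0.
Qed.

Lemma slope_cont_self f a : cdiff f a -> cont_at (slope f a) a.
Proof.
intros Hf; apply ex_derive_cdiff in Hf; apply (C_derive_correct f a a) in Hf.
rewrite is_derive_iff_eps in Hf.
intros eps He; destruct (Hf (eps / 2)) as [d [Hd H]]; [lra|].
exists d; split; [exact Hd|]; intros y Hy; unfold slope.
destruct (excluded_middle_informative (a = a)) as [_|E]; [|now elim E].
destruct (excluded_middle_informative (y = a)) as [E|E].
{ rewrite Cmod_sub_self; lra. }
assert (Hn := Cminus_neq0 _ _ E).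
set (l := C_derive f a) in *.
replace ((f y - f a) / (y - a) - l)%C with ((f y - f a - (y - a) * l) / (y - a))%C
  by (field; exact Hn).
assert (Hp := proj1 (Cmod_gt_0 _) Hn).
rewrite Cmod_div by exact Hn.
apply Rle_lt_trans with (eps / 2); [|lra].
apply Rmult_le_reg_r with (Cmod (y - a)); [exact Hp|].
unfold Rdiv at 1; rewrite Rmult_assoc, Rinv_l, Rmult_1_r by lra.
now apply H.
Qed.

Lemma slope_ext_loc f a x : x <> a ->
  exists d, 0 < d /\ forall y, Cmod (y - x) < d -> ((f y - f a) / (y - a) = slope f a y)%C.
Proof.
intros H; exists (Cmod (x - a)); split; [apply Cmod_gt_0; now apply Cminus_neq0|].
intros y Hy; unfold slope; destruct (excluded_middle_informative (y = a)) as [E|E]; [|easy].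
rewrite E, Cmod_sub_sym in Hy; lra.
Qed.

Lemma slope_cdiff f a x : x <> a -> cdiff f x -> cdiff (slope f a) x.
Proof.
intros H Hf; destruct (slope_ext_loc f a x H) as [d [Hd E]].
eapply cdiff_ext_loc; [exact Hd|exact E|].
apply cdiff_div.
- apply cdiff_minus; [exact Hf|apply cdiff_const].
- apply cdiff_minus; [apply cdiff_id|apply cdiff_const].
- now apply Cminus_neq0.
Qed.

Lemma slope_cont f a x : x <> a -> cont_at f x -> cont_at (slope f a) x.
Proof.
intros H Hf; destruct (slope_ext_loc f a x H) as [d [Hd E]].
eapply cont_ext_loc; [exact Hd|exact E|].
apply cont_mult.
- apply (cont_plus f (fun _ => - f a)%C); [exact Hf|apply cont_const].
- apply cont_inv; [|now apply Cminus_neq0].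
  apply (cont_plus (fun y => y) (fun _ => - a)%C); [apply cont_id|apply cont_const].
Qed.

(** * Complex integrals and Goursat's theorem *)

Definition rcont (f : R -> C) (t : R) : Prop :=
  forall eps, 0 < eps -> exists d, 0 < d /\
    forall s, Rabs (s - t) < d -> Cmod (f s - f t) < eps.

Definition CInt (f : R -> C) (a b : R) : C :=
  (RInt (fun t => fst (f t)) a b, RInt (fun t => snd (f t)) a b).

Lemma Rabs_fst_le (z : C) : Rabs (fst z) <= Cmod z.
Proof. eapply Rle_trans; [apply Rmax_l|apply Rmax_Cmod]. Qed.

Lemma Rabs_snd_le (z : C) : Rabs (snd z) <= Cmod z.
Proof. eapply Rle_trans; [apply Rmax_r|apply Rmax_Cmod]. Qed.

Lemma Cmod_le_sum (z : C) : Cmod z <= Rabs (fst z) + Rabs (snd z).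
Proof.
destruct z as [x y]; replace (x, y) with (RtoC x + Ci * RtoC y)%C.
2:{ unfold RtoC, Ci, Cplus, Cmult; simpl; f_equal; ring. }
eapply Rle_trans; [apply Cmod_triangle|].
rewrite Cmod_mult, 2!Cmod_R; replace (Cmod Ci) with 1.
2:{ unfold Cmod; simpl; symmetry; replace (0 * (0 * 1) + 1 * (1 * 1)) with 1 by ring; apply sqrt_1. }
simpl; apply Req_le; f_equal; [f_equal; ring|].
rewrite Rmult_1_l; f_equal; ring.
Qed.

Lemma continuous_eps (f : R -> R) (t : R) :
  (forall eps, 0 < eps -> exists d, 0 < d /\ forall s, Rabs (s - t) < d -> Rabs (f s - f t) < eps) <->
  continuous f t.
Proof.
split; intros H.
- apply (filterlim_locally f); intros eps; destruct (H eps (cond_pos eps)) as [d [Hd H']].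
  exists (mkposreal d Hd); intros y Hy; apply H', Hy.
- intros eps He; assert (H' := proj1 (filterlim_locally f _) H (mkposreal eps He)).
  destruct H' as [d Hd]; exists d; split; [apply cond_pos|]; intros s Hs; apply Hd, Hs.
Qed.

Lemma rcont_fst f t : rcont f t -> continuous (fun s => fst (f s)) t.
Proof.
intros H; apply continuous_eps; intros eps He; destruct (H eps He) as [d [Hd H']].
exists d; split; [exact Hd|]; intros s Hs; eapply Rle_lt_trans; [|apply H', Hs].
apply (Rabs_fst_le (f s - f t)).
Qed.

Lemma rcont_snd f t : rcont f t -> continuous (fun s => snd (f s)) t.
Proof.
intros H; apply continuous_eps; intros eps He; destruct (H eps He) as [d [Hd H']].
exists d; split; [exact Hd|]; intros s Hs; eapply Rle_lt_trans; [|apply H', Hs].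
apply (Rabs_snd_le (f s - f t)).
Qed.

Lemma rcont_comp (f : C -> C) (g : R -> C) t :
  rcont g t -> cont_at f (g t) -> rcont (fun s => f (g s)) t.
Proof.
intros Hg Hf eps He; destruct (Hf eps He) as [d [Hd H]].
destruct (Hg d Hd) as [d' [Hd' H']]; exists d'; split; [exact Hd'|]; intros s Hs.
now apply H, H'.
Qed.

Lemma rcont_Cmod (f : R -> C) t : rcont f t -> continuous (fun s => Cmod (f s)) t.
Proof.
intros H; apply continuous_eps; intros eps He; destruct (H eps He) as [d [Hd H']].
exists d; split; [exact Hd|]; intros s Hs; specialize (H' s Hs).
apply Rabs_def1.
- generalize (Cmod_sub_ge (f s) (f t)); lra.
- generalize (Cmod_sub_ge (f t) (f s)); rewrite Cmod_sub_sym; lra.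
Qed.

Lemma rcont_pair (f g : R -> R) t :
  continuous f t -> continuous g t -> rcont (fun s => (f s, g s)) t.
Proof.
intros Hf Hg eps He; rewrite <- continuous_eps in Hf; rewrite <- continuous_eps in Hg.
destruct (Hf (eps / 2)) as [d [Hd H]]; [lra|].
destruct (Hg (eps / 2)) as [d' [Hd' H']]; [lra|].
exists (Rmin d d'); split; [now apply Rmin_glb_lt|]; intros s Hs.
eapply Rle_lt_trans; [apply Cmod_le_sum|]; simpl.
specialize (H s (lt_min_l _ _ _ Hs)).
specialize (H' s (lt_min_r _ _ _ Hs)); unfold Rminus in *; lra.
Qed.

(** Composing with the real part turns a path into a function on [C], so the rules for [cont_at]
    carry over to paths without new estimates. *)
Lemma rcont_iff f t : rcont f t <-> cont_at (fun y => f (fst y)) (RtoC t).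
Proof.
split; intros H eps He; destruct (H eps He) as [d [Hd H']]; exists d; (split; [exact Hd|]).
- intros y Hy; apply H'; eapply Rle_lt_trans; [apply (Rabs_fst_le (y - RtoC t))|exact Hy].
- intros s Hs; apply (H' (RtoC s)); rewrite <- RtoC_minus, Cmod_R; exact Hs.
Qed.

Lemma rcont_plus f g t : rcont f t -> rcont g t -> rcont (fun s => f s + g s)%C t.
Proof. rewrite !rcont_iff; apply cont_plus. Qed.

Lemma rcont_mult f g t : rcont f t -> rcont g t -> rcont (fun s => f s * g s)%C t.
Proof. rewrite !rcont_iff; apply cont_mult. Qed.

Lemma rcont_const c t : rcont (fun _ => c) t.
Proof. rewrite rcont_iff; apply cont_const. Qed.

Lemma rcont_scal k f t : rcont f t -> rcont (fun s => k * f s)%C t.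
Proof. intros H; apply rcont_mult; [apply rcont_const|exact H]. Qed.

Lemma rcont_minus f g t : rcont f t -> rcont g t -> rcont (fun s => f s - g s)%C t.
Proof.
intros Hf Hg; apply rcont_plus; [exact Hf|].
intros eps He; destruct (Hg eps He) as [d [Hd H]]; exists d; split; [exact Hd|]; intros s Hs.
replace (- g s - - g t)%C with (- (g s - g t))%C by ring; rewrite Cmod_opp; now apply H.
Qed.

Lemma rcont_inv f t : rcont f t -> f t <> 0%C -> rcont (fun s => / f s)%C t.
Proof. rewrite !rcont_iff; apply cont_inv. Qed.

Definition rcont_on f a b := forall t, a <= t <= b -> rcont f t.

Lemma ex_RInt_fst f a b : a <= b -> rcont_on f a b -> ex_RInt (fun t => fst (f t)) a b.
Proof.
intros Hab H; apply (ex_RInt_continuous (V := R_CompleteNormedModule)).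
intros t; rewrite Rmin_left, Rmax_right by exact Hab; intros Ht; now apply rcont_fst, H.
Qed.

Lemma ex_RInt_snd f a b : a <= b -> rcont_on f a b -> ex_RInt (fun t => snd (f t)) a b.
Proof.
intros Hab H; apply (ex_RInt_continuous (V := R_CompleteNormedModule)).
intros t; rewrite Rmin_left, Rmax_right by exact Hab; intros Ht; now apply rcont_snd, H.
Qed.

Lemma CInt_ext f g a b : a <= b -> (forall t, a <= t <= b -> f t = g t) ->
  CInt f a b = CInt g a b.
Proof.
intros Hab H; unfold CInt; f_equal; apply RInt_ext;
  rewrite Rmin_left, Rmax_right by exact Hab; intros t Ht; rewrite H by lra; reflexivity.
Qed.

Lemma CInt_plus f g a b : a <= b -> rcont_on f a b -> rcont_on g a b ->
  (CInt (fun t => f t + g t) a b = CInt f a b + CInt g a b)%C.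
Proof.
intros Hab Hf Hg; unfold CInt, Cplus; simpl; f_equal.
- apply (RInt_plus (V := R_CompleteNormedModule)); now apply ex_RInt_fst.
- apply (RInt_plus (V := R_CompleteNormedModule)); now apply ex_RInt_snd.
Qed.

Lemma CInt_scal k f a b : a <= b -> rcont_on f a b ->
  (CInt (fun t => k * f t) a b = k * CInt f a b)%C.
Proof.
intros Hab Hf; unfold CInt, Cmult; simpl.
assert (H1 := ex_RInt_fst f a b Hab Hf); assert (H2 := ex_RInt_snd f a b Hab Hf).
f_equal.
- apply is_RInt_unique.
  apply (is_RInt_minus (V := R_NormedModule) (fun t => fst k * fst (f t)) (fun t => snd k * snd (f t)));
    apply (is_RInt_scal (V := R_NormedModule)); apply (RInt_correct (V := R_CompleteNormedModule)); assumption.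
- apply is_RInt_unique.
  apply (is_RInt_plus (V := R_NormedModule) (fun t => fst k * snd (f t)) (fun t => snd k * fst (f t)));
    apply (is_RInt_scal (V := R_NormedModule)); apply (RInt_correct (V := R_CompleteNormedModule)); assumption.
Qed.

Lemma CInt_minus f g a b : a <= b -> rcont_on f a b -> rcont_on g a b ->
  (CInt (fun t => f t - g t) a b = CInt f a b - CInt g a b)%C.
Proof.
intros Hab Hf Hg; transitivity (CInt (fun t => f t + -(1) * g t)%C a b).
{ apply CInt_ext; [exact Hab|]; intros; ring. }
rewrite CInt_plus, CInt_scal; try assumption; [ring|].
intros t Ht; now apply rcont_scal, Hg.
Qed.

Lemma CInt_Chasles f a b c : a <= b -> b <= c -> rcont_on f a c ->
  (CInt f a b + CInt f b c = CInt f a c)%C.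
Proof.
intros Hab Hbc H.
assert (Ha : rcont_on f a b) by (intros t Ht; apply H; lra).
assert (Hc : rcont_on f b c) by (intros t Ht; apply H; lra).
unfold CInt, Cplus; apply injective_projections; cbn [fst snd].
- exact (RInt_Chasles (V := R_CompleteNormedModule) (fun t => fst (f t)) a b c
    (ex_RInt_fst f a b Hab Ha) (ex_RInt_fst f b c Hbc Hc)).
- exact (RInt_Chasles (V := R_CompleteNormedModule) (fun t => snd (f t)) a b c
    (ex_RInt_snd f a b Hab Ha) (ex_RInt_snd f b c Hbc Hc)).
Qed.

Lemma CInt_const k a b : (CInt (fun _ => k) a b = RtoC (b - a) * k)%C.
Proof.
unfold CInt; rewrite 2!RInt_const; unfold scal, Cmult; simpl; unfold mult; simpl.
destruct k; simpl; f_equal; ring.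
Qed.

(* Rotating the integral onto the positive axis makes the bound sharp. *)
Lemma CInt_le f g a b : a <= b -> rcont_on f a b -> ex_RInt g a b ->
  (forall t, a <= t <= b -> Cmod (f t) <= g t) -> Cmod (CInt f a b) <= RInt g a b.
Proof.
intros Hab Hf Hg H.
destruct (excluded_middle_informative (CInt f a b = 0%C)) as [E|E].
{ rewrite E, Cmod_0; apply RInt_ge_0; try assumption.
  intros t Ht; eapply Rle_trans; [apply Cmod_ge_0|apply H; lra]. }
set (I := CInt f a b) in *; assert (HI := proj1 (Cmod_gt_0 _) E).
set (k := (Cconj I / RtoC (Cmod I))%C).
assert (Hm : RtoC (Cmod I) <> 0%C) by (intros F; apply RtoC_inj in F; lra).
assert (Hk : Cmod k = 1).
{ unfold k; rewrite Cmod_div by exact Hm; rewrite Cmod_R, Rabs_pos_eq by lra.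
  rewrite Cmod_conj; field; lra. }
assert (HkI : (k * I = RtoC (Cmod I))%C).
{ transitivity (RtoC (Cmod I ^ 2) / RtoC (Cmod I))%C.
  - rewrite Cmod2_conj; unfold k; field; exact Hm.
  - replace (Cmod I ^ 2) with (Cmod I * Cmod I) by ring; rewrite RtoC_mult; field; exact Hm. }
replace (Cmod I) with (fst (k * I)%C) by (rewrite HkI; reflexivity).
unfold I; rewrite <- CInt_scal by assumption.
assert (Hkf : rcont_on (fun t => k * f t)%C a b) by (intros t Ht; now apply rcont_scal, Hf).
apply RInt_le; [exact Hab|apply (ex_RInt_fst _ a b Hab Hkf)|exact Hg|].
intros t Ht; eapply Rle_trans; [apply Rle_abs|]; eapply Rle_trans; [apply Rabs_fst_le|].
rewrite Cmod_mult, Hk, Rmult_1_l; apply H; lra.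
Qed.

Lemma CInt_bound f M a b : a <= b -> rcont_on f a b ->
  (forall t, a <= t <= b -> Cmod (f t) <= M) -> Cmod (CInt f a b) <= M * (b - a).
Proof.
intros Hab Hf H.
replace (M * (b - a)) with (RInt (V := R_CompleteNormedModule) (fun _ => M) a b).
- apply CInt_le; try assumption; apply ex_RInt_const.
- rewrite RInt_const; unfold scal; simpl; unfold mult; simpl; ring.
Qed.

Lemma CInt_id a b : CInt RtoC a b = RtoC ((b * b - a * a) / 2).
Proof.
unfold CInt, RtoC; f_equal.
- apply is_RInt_unique.
  replace ((b * b - a * a) / 2) with (minus (b * b / 2) (a * a / 2)) by
    (unfold minus, plus, opp; simpl; field).
  apply (is_RInt_derive (V := R_CompleteNormedModule) (fun t => t * t / 2) (fun t => t)).
  + intros t _; auto_derive; [easy|field].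
  + intros t _; apply continuous_id.
- simpl; rewrite RInt_const; unfold scal; simpl; unfold mult; simpl; ring.
Qed.

Definition rect_int (F : C -> C) (a b c d : R) : C :=
  (CInt (fun x => F (x, c)) a b + Ci * CInt (fun y => F (b, y)) c d
   - CInt (fun x => F (x, d)) a b - Ci * CInt (fun y => F (a, y)) c d)%C.

Lemma rcont_horiz c t : rcont (fun x => (x, c)) t.
Proof. apply rcont_pair; [apply continuous_id|apply continuous_const]. Qed.

Lemma rcont_vert a t : rcont (fun y => (a, y)) t.
Proof. apply rcont_pair; [apply continuous_const|apply continuous_id]. Qed.

Definition cont_rect (F : C -> C) (a b c d : R) : Prop :=
  forall x y, a <= x <= b -> c <= y <= d -> cont_at F (x, y).

Lemma cont_rect_h F a b c d y : cont_rect F a b c d -> c <= y <= d ->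
  rcont_on (fun x => F (x, y)) a b.
Proof.
intros H Hy t Ht; apply (rcont_comp F (fun x => (x, y))); [apply rcont_horiz|now apply H].
Qed.

Lemma cont_rect_v F a b c d x : cont_rect F a b c d -> a <= x <= b ->
  rcont_on (fun y => F (x, y)) c d.
Proof.
intros H Hy t Ht; apply (rcont_comp F (fun y => (x, y))); [apply rcont_vert|now apply H].
Qed.

Lemma rect_int_split F a m b c n d : a <= m <= b -> c <= n <= d -> cont_rect F a b c d ->
  (rect_int F a b c d = rect_int F a m c n + rect_int F m b c n
     + rect_int F a m n d + rect_int F m b n d)%C.
Proof.
intros Hm Hn H; unfold rect_int.
rewrite <- (CInt_Chasles (fun x => F (x, c)) a m b),
        <- (CInt_Chasles (fun x => F (x, d)) a m b),
        <- (CInt_Chasles (fun y => F (a, y)) c n d),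
        <- (CInt_Chasles (fun y => F (b, y)) c n d); try lra.
1: ring.
all: (eapply cont_rect_h; [exact H|lra]) || (eapply cont_rect_v; [exact H|lra]).
Qed.

(** The first-order Taylor polynomial at the limit point of the Goursat bisection contributes
    nothing, so only the remainder has to be estimated there. *)
Lemma rect_int_affine k l a b c d : a <= b -> c <= d ->
  rect_int (fun u => k + l * u)%C a b c d = 0%C.
Proof.
intros Hab Hcd; unfold rect_int.
assert (Hc : forall t, rcont RtoC t) by (intros t; apply (rcont_horiz 0)).
assert (Hs : forall m a b, rcont_on (fun t => m * RtoC t)%C a b).
{ intros m u v t _; apply rcont_scal, Hc. }
assert (Hk : forall (m : C) a b, rcont_on (fun _ => m) a b).
{ intros m u v t _; apply rcont_const. }
assert (Hh : forall y, CInt (fun x => k + l * (x, y))%C a b =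
  (RtoC (b - a) * (k + l * (Ci * RtoC y)) + l * RtoC ((b * b - a * a) / 2))%C).
{ intros y; rewrite <- CInt_id, <- CInt_const, <- CInt_scal, <- CInt_plus; auto.
  2:{ intros t _; apply Hc. }
  apply CInt_ext; [exact Hab|]; intros t _.
  replace (t, y) with (RtoC t + Ci * RtoC y)%C; [ring|].
  unfold RtoC, Ci, Cplus, Cmult; simpl; f_equal; ring. }
assert (Hv : forall x, CInt (fun y => k + l * (x, y))%C c d =
  (RtoC (d - c) * (k + l * RtoC x) + l * Ci * RtoC ((d * d - c * c) / 2))%C).
{ intros x; rewrite <- CInt_id, <- CInt_const, <- CInt_scal, <- CInt_plus; auto.
  2:{ intros t _; apply Hc. }
  apply CInt_ext; [exact Hcd|]; intros t _.
  replace (x, t) with (RtoC x + Ci * RtoC t)%C; [ring|].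
  unfold RtoC, Ci, Cplus, Cmult; simpl; f_equal; ring. }
rewrite 2!Hh, 2!Hv; unfold RtoC, Ci, Cplus, Cmult, Cminus, Copp; destruct k, l.
apply injective_projections; simpl; field.
Qed.

Lemma rect_int_bound F M a b c d : a <= b -> c <= d -> cont_rect F a b c d ->
  (forall x y, a <= x <= b -> c <= y <= d -> Cmod (F (x, y)) <= M) ->
  Cmod (rect_int F a b c d) <= M * (2 * ((b - a) + (d - c))).
Proof.
intros Hab Hcd H HM; unfold rect_int.
assert (Hh : forall y, c <= y <= d -> Cmod (CInt (fun x => F (x, y)) a b) <= M * (b - a)).
{ intros y Hy; apply CInt_bound; [exact Hab|eapply cont_rect_h; eassumption|]; intros; now apply HM. }
assert (Hv : forall x, a <= x <= b -> Cmod (Ci * CInt (fun y => F (x, y)) c d) <= M * (d - c)).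
{ intros x Hx; rewrite Cmod_mult; replace (Cmod Ci) with 1.
  2:{ unfold Cmod; simpl; symmetry; replace (0 * (0 * 1) + 1 * (1 * 1)) with 1 by ring; apply sqrt_1. }
  rewrite Rmult_1_l.
  apply CInt_bound; [exact Hcd|eapply cont_rect_v; eassumption|]; intros; now apply HM. }
assert (H1 := Hh c); assert (H2 := Hh d); assert (H3 := Hv a); assert (H4 := Hv b).
eapply Rle_trans; [apply Cmod_sub_le|].
eapply Rle_trans; [apply Rplus_le_compat_r, Cmod_sub_le|].
eapply Rle_trans; [apply Rplus_le_compat_r, Rplus_le_compat_r, Cmod_triangle|].
lra.
Qed.

Lemma rect_int_plus F G a b c d : a <= b -> c <= d -> cont_rect F a b c d -> cont_rect G a b c d ->
  (rect_int (fun u => F u + G u) a b c d = rect_int F a b c d + rect_int G a b c d)%C.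
Proof.
intros Hab Hcd HF HG; unfold rect_int.
assert (H : forall y, c <= y <= d -> CInt (fun x => F (x, y) + G (x, y))%C a b =
  (CInt (fun x => F (x, y)) a b + CInt (fun x => G (x, y)) a b)%C).
{ intros y Hy; apply CInt_plus; [exact Hab|eapply cont_rect_h; eassumption..]. }
assert (H' : forall x, a <= x <= b -> CInt (fun y => F (x, y) + G (x, y))%C c d =
  (CInt (fun y => F (x, y)) c d + CInt (fun y => G (x, y)) c d)%C).
{ intros y Hy; apply CInt_plus; [exact Hcd|eapply cont_rect_v; eassumption..]. }
rewrite 2!H, 2!H' by lra; ring.
Qed.

Lemma rect_int_ext F G a b c d : a <= b -> c <= d -> (forall u, F u = G u) ->
  rect_int F a b c d = rect_int G a b c d.
Proof.
intros Hab Hcd H; unfold rect_int.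
rewrite (CInt_ext (fun x => F (x, c)) (fun x => G (x, c))), (CInt_ext (fun y => F (b, y)) (fun y => G (b, y))),
  (CInt_ext (fun x => F (x, d)) (fun x => G (x, d))), (CInt_ext (fun y => F (a, y)) (fun y => G (a, y)));
  auto.
Qed.

Section Goursat.
Variables (F : C -> C) (a c w h : R).
Hypothesis Hw : 0 < w.
Hypothesis Hh : 0 < h.
Hypothesis HF : forall x y, a <= x <= a + w -> c <= y <= c + h -> cdiff F (x, y).

(** Every bisection halves both sides, so a rectangle of generation [n] is determined by its lower
    left corner [p]. *)
Let R_ (n : nat) (p : R * R) :=
  rect_int F (fst p) (fst p + w / 2 ^ n) (snd p) (snd p + h / 2 ^ n).

Let Inv (eta : R) (n : nat) (p : R * R) :=
  a <= fst p /\ fst p + w / 2 ^ n <= a + w /\ c <= snd p /\ snd p + h / 2 ^ n <= c + h /\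
  eta / 4 ^ n <= Cmod (R_ n p).

Let Step (n : nat) (p p' : R * R) :=
  fst p <= fst p' /\ fst p' + w / 2 ^ S n <= fst p + w / 2 ^ n /\
  snd p <= snd p' /\ snd p' + h / 2 ^ S n <= snd p + h / 2 ^ n.

Lemma pow_half (u : R) (n : nat) : u / 2 ^ n = u / 2 ^ S n + u / 2 ^ S n.
Proof. simpl; field; apply pow_nonzero; lra. Qed.

Lemma div_pow_pos (u k : R) (n : nat) : 0 < u -> 0 < k -> 0 < u / k ^ n.
Proof. intros; apply Rdiv_lt_0_compat; [assumption|now apply pow_lt]. Qed.

(** If all four quarters had integrals below a quarter of the bound, the triangle inequality would
    contradict the invariant. [T] tests one quarter: it is either the next rectangle or too
    small. *)
Lemma goursat_step eta n p : Inv eta n p -> exists p', Inv eta (S n) p' /\ Step n p p'.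
Proof.
destruct p as [x y]; intros [H1 [H2 [H3 [H4 H5]]]]; unfold R_ in H5; simpl fst in *; simpl snd in *.
assert (Ew := pow_half w n); assert (Eh := pow_half h n).
assert (Pw := div_pow_pos w 2 (S n) Hw Rlt_0_2); assert (Ph := div_pow_pos h 2 (S n) Hh Rlt_0_2).
set (w' := w / 2 ^ S n) in *; set (h' := h / 2 ^ S n) in *.
rewrite (rect_int_split F x (x + w') (x + w / 2 ^ n) y (y + h') (y + h / 2 ^ n)) in H5; try lra.
2:{ intros u v Hu Hv; apply cdiff_cont, HF; lra. }
rewrite Ew, Eh, <- 2!Rplus_assoc in H5.
assert (T : forall p, a <= fst p -> fst p + w' <= a + w -> c <= snd p -> snd p + h' <= c + h ->
  Step n (x, y) p -> (exists p', Inv eta (S n) p' /\ Step n (x, y) p') \/ Cmod (R_ (S n) p) < eta / 4 ^ S n).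
{ intros p A B C' D St; destruct (Rlt_le_dec (Cmod (R_ (S n) p)) (eta / 4 ^ S n)) as [L|L]; [now right|].
  left; exists p; split; [|exact St]; unfold Inv; fold w' h'; tauto. }
unfold Step in T; fold w' h' in T; cbn [fst snd] in T.
destruct (T (x, y)) as [?|L1]; cbn [fst snd]; try lra; [assumption|].
destruct (T (x + w', y)) as [?|L2]; cbn [fst snd]; try lra; [assumption|].
destruct (T (x, y + h')) as [?|L3]; cbn [fst snd]; try lra; [assumption|].
destruct (T (x + w', y + h')) as [?|L4]; cbn [fst snd]; try lra; [assumption|].
exfalso; unfold R_ in L1, L2, L3, L4; fold w' h' in L1, L2, L3, L4; cbn [fst snd] in L1, L2, L3, L4.
assert (E4 : eta / 4 ^ n = 4 * (eta / 4 ^ S n)).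
{ simpl; field; apply pow_nonzero; lra. }
revert H5; apply Rlt_not_le; rewrite E4.
eapply Rle_lt_trans; [apply Cmod_triangle|].
eapply Rle_lt_trans; [apply Rplus_le_compat_r, Cmod_triangle|].
eapply Rle_lt_trans; [apply Rplus_le_compat_r, Rplus_le_compat_r, Cmod_triangle|].
lra.
Qed.

Lemma nested_limit (x : nat -> R) (u : R) :
  (forall n, x n <= x (S n)) -> (forall n, x (S n) + u / 2 ^ S n <= x n + u / 2 ^ n) ->
  0 < u -> exists X, forall n, x n <= X <= x n + u / 2 ^ n.
Proof.
intros H1 H2 Hu.
assert (I1 : forall n k, x n <= x (n + k)%nat).
{ intros n k; induction k as [|k IH]; [rewrite Nat.add_0_r; lra|].
  rewrite Nat.add_succ_r; eapply Rle_trans; [exact IH|apply H1]. }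
assert (I2 : forall n k, x (n + k)%nat + u / 2 ^ (n + k) <= x n + u / 2 ^ n).
{ intros n k; induction k as [|k IH]; [rewrite Nat.add_0_r; lra|].
  rewrite Nat.add_succ_r; eapply Rle_trans; [apply H2|exact IH]. }
assert (I3 : forall n m, x m <= x n + u / 2 ^ n).
{ intros n m; destruct (Nat.le_ge_cases n m) as [L|L].
  - replace m with (n + (m - n))%nat by lia; generalize (I2 n (m - n)%nat).
    generalize (div_pow_pos u 2 (n + (m - n)) Hu Rlt_0_2); lra.
  - replace n with (m + (n - m))%nat by lia; generalize (I1 m (n - m)%nat).
    generalize (div_pow_pos u 2 (m + (n - m)) Hu Rlt_0_2); lra. }
destruct (completeness (fun t => exists n, t = x n)) as [X [U L]].
- exists (x O + u / 2 ^ O); intros t [n ->]; apply I3.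
- exists (x O); now exists O.
- exists X; intros n; split; [apply U; now exists n|].
  apply L; intros t [m ->]; apply I3.
Qed.

Lemma goursat : rect_int F a (a + w) c (c + h) = 0%C.
Proof.
destruct (excluded_middle_informative (rect_int F a (a + w) c (c + h) = 0%C)) as [E|E]; [exact E|exfalso].
set (eta := Cmod (rect_int F a (a + w) c (c + h))).
assert (Heta : 0 < eta) by now apply Cmod_gt_0.
assert (I0 : Inv eta O (a, c)).
{ unfold Inv, R_; cbn [fst snd pow]; rewrite !Rdiv_1_r; fold eta; lra. }
(* The next corner is only known to exist under the invariant, so the choice is iterated on corners
   paired with a proof of it. *)
pose (next := fun n (s : {p | Inv eta n p}) =>
  constructive_indefinite_description _ (goursat_step eta n (proj1_sig s) (proj2_sig s))).
pose (sq := fix sq n : {p | Inv eta n p} := match n with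
  | O => exist _ (a, c) I0
  | S m => exist _ (proj1_sig (next m (sq m))) (proj1 (proj2_sig (next m (sq m)))) end).
pose (p := fun n => proj1_sig (sq n)).
assert (HI : forall n, Inv eta n (p n)) by (intros n; exact (proj2_sig (sq n))).
assert (HS : forall n, Step n (p n) (p (S n))).
{ intros n; exact (proj2 (proj2_sig (next n (sq n)))). }
destruct (nested_limit (fun n => fst (p n)) w) as [X HX]; [intros n; apply HS..|exact Hw|].
destruct (nested_limit (fun n => snd (p n)) h) as [Y HY]; [intros n; apply HS..|exact Hh|].
assert (HXY : cdiff F (X, Y)).
{ apply HF; [generalize (HX O) (HI O)|generalize (HY O) (HI O)]; unfold Inv; cbn [pow]; lra. }
apply ex_derive_cdiff in HXY; destruct HXY as [l Hl]; rewrite is_derive_iff_eps in Hl.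
(* On a rectangle of generation n the remainder integral is at most 2 eps (w + h)^2 / 4^n. This
   choice of eps makes it half of the lower bound eta / 4^n. *)
destruct (Hl (eta / (4 * ((w + h) * (w + h))))) as [d [Hd H]].
{ apply Rdiv_lt_0_compat; nra. }
set (eps := eta / (4 * ((w + h) * (w + h)))) in *.
assert (Hn : exists n, (w + h) / 2 ^ n < d).
{ destruct (pow_lt_1_zero (/ 2) ltac:(rewrite Rabs_pos_eq; lra) (d / (w + h))) as [n Hn].
  { apply Rdiv_lt_0_compat; lra. }
  exists n; specialize (Hn n (Nat.le_refl n)); rewrite Rabs_pos_eq, pow_inv in Hn.
  2:{ apply pow_le; lra. }
  apply Rmult_lt_reg_r with (/ (w + h)); [apply Rinv_0_lt_compat; lra|].
  replace ((w + h) / 2 ^ n * / (w + h)) with (/ 2 ^ n); [exact Hn|].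
  field; split; [lra|apply pow_nonzero; lra]. }
destruct Hn as [n Hn].
specialize (HI n); specialize (HX n); specialize (HY n); destruct (p n) as [x y]; unfold Inv, R_ in HI.
cbn [fst snd] in *; destruct HI as [J1 [J2 [J3 [J4 J5]]]].
assert (Ewh : (w + h) / 2 ^ n = w / 2 ^ n + h / 2 ^ n) by (field; apply pow_nonzero; lra).
set (w' := w / 2 ^ n) in *; set (h' := h / 2 ^ n) in *.
set (P := ((X, Y) : C)) in *.
assert (Hc : cont_rect F x (x + w') y (y + h')).
{ intros u v Hu Hv; apply cdiff_cont, HF; lra. }
pose (A := fun u => ((F P - l * P) + l * u)%C).
assert (HA : forall k u, cont_at (fun u => k * A u)%C u).
{ intros k u; apply cont_mult; [apply cont_const|]; apply cont_plus; [apply cont_const|].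
  apply cont_mult; [apply cont_const|apply cont_id]. }
pose (e := fun u => (F u + (-(1)) * A u)%C).
assert (He : rect_int F x (x + w') y (y + h') = rect_int e x (x + w') y (y + h')).
{ unfold e; rewrite rect_int_plus; try lra; [|exact Hc|intros u v _ _; apply HA].
  pose (B := fun u => (-(1) * (F P - l * P) + (-(1) * l) * u)%C).
  assert (EB : rect_int (fun u => (-(1)) * A u)%C x (x + w') y (y + h') = rect_int B x (x + w') y (y + h')).
  { apply rect_int_ext; [lra..|]; intros u; unfold A, B; ring. }
  rewrite EB; unfold B; rewrite rect_int_affine by lra; ring. }
rewrite He in J5.
assert (HB : Cmod (rect_int e x (x + w') y (y + h')) <=
  (eps * ((w + h) / 2 ^ n)) * (2 * ((x + w' - x) + (y + h' - y)))).
{ apply rect_int_bound; try lra.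
  - intros u v Hu Hv; apply cont_plus; [now apply Hc|apply HA].
  - intros u v Hu Hv.
    assert (Hm : Cmod ((u, v) - P) <= (w + h) / 2 ^ n).
    { eapply Rle_trans; [apply Cmod_le_sum|]; simpl; rewrite Ewh.
      apply Rplus_le_compat; apply Rabs_le; lra. }
    replace (e (u, v)) with (F (u, v) - F P - ((u, v) - P) * l)%C by (unfold e, A; ring).
    eapply Rle_trans; [apply H; lra|].
    apply Rmult_le_compat_l; [|exact Hm].
    unfold eps; apply Rlt_le, Rdiv_lt_0_compat; nra. }
assert (HC : eta / 4 ^ n <= eta / 2 / 4 ^ n).
{ eapply Rle_trans; [exact J5|]; eapply Rle_trans; [exact HB|].
  apply Req_le; replace (x + w' - x + (y + h' - y)) with ((w + h) / 2 ^ n) by lra.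
  replace (4 ^ n) with (2 ^ n * 2 ^ n) by (rewrite <- Rpow_mult_distr; f_equal; ring); unfold eps.
  field; split; [apply pow_nonzero; lra|lra]. }
generalize (div_pow_pos eta 4 n Heta ltac:(lra)).
replace (eta / 2 / 4 ^ n) with (eta / 4 ^ n / 2) in HC by (field; apply pow_nonzero; lra); lra.
Qed.
End Goursat.

(** * Circle means *)

Definition cis (t : R) : C := (cos t, sin t).

Definition cexp (u : C) : C := (RtoC (exp (fst u)) * cis (snd u))%C.

Lemma Cmod_cis t : Cmod (cis t) = 1.
Proof.
unfold Cmod, cis; simpl; rewrite 2!Rmult_1_r; generalize (sin2_cos2 t); unfold Rsqr; intros E.
rewrite Rplus_comm, E; apply sqrt_1.
Qed.

Lemma Cmod_polar x t : 0 <= x -> Cmod (RtoC x * cis t) = x.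
Proof. intros H; rewrite Cmod_mult, Cmod_cis, Cmod_R, Rabs_pos_eq by exact H; ring. Qed.

Lemma cis_plus s t : (cis (s + t) = cis s * cis t)%C.
Proof. unfold cis, Cmult; simpl; rewrite cos_plus, sin_plus; f_equal; ring. Qed.

Lemma cexp_plus u v : (cexp (u + v) = cexp u * cexp v)%C.
Proof.
unfold cexp; destruct u as [a b], v as [c d]; simpl.
rewrite exp_plus, cis_plus, RtoC_mult; ring.
Qed.

Lemma is_derive_eps_R (f : R -> R) (x l : R) : is_derive f x l ->
  forall eps, 0 < eps -> exists d, 0 < d /\
    forall y, Rabs (y - x) < d -> Rabs (f y - f x - (y - x) * l) <= eps * Rabs (y - x).
Proof.
intros [_ H] eps He.
destruct (H x (fun P HP => HP) (mkposreal eps He)) as [d Hd].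
exists d; split; [apply cond_pos|]; intros y Hy; apply Hd, Hy.
Qed.

(** The addition formula carries this expansion at 0 to every point, where it gives the derivative
    [cexp u]. *)
Lemma cexp_deriv_0 : forall eps, 0 < eps -> exists d, 0 < d /\
  forall y, Cmod y < d -> Cmod (cexp y - 1 - y) <= eps * Cmod y.
Proof.
intros eps He.
(* The estimates [K1] and [K2] below total at most 8 e m, where m = Cmod y < e. *)
assert (He8 : 0 < Rmin 1 (eps / 8)) by (apply Rmin_glb_lt; lra).
set (e := Rmin 1 (eps / 8)) in *.
assert (e <= 1) by apply Rmin_l; assert (e <= eps / 8) by apply Rmin_r.
destruct (is_derive_eps_R exp 0 1) with e as [d1 [Hd1 H1]]; [|exact He8|].
{ rewrite <- exp_0; apply is_derive_exp. }
destruct (is_derive_eps_R cos 0 0) with e as [d2 [Hd2 H2]]; [|exact He8|].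
{ replace 0 with (- sin 0) at 2 by (rewrite sin_0; ring); apply is_derive_cos. }
destruct (is_derive_eps_R sin 0 1) with e as [d3 [Hd3 H3]]; [|exact He8|].
{ rewrite <- cos_0; apply is_derive_sin. }
exists (Rmin e (Rmin d1 (Rmin d2 d3))); split; [repeat (apply Rmin_glb_lt; try assumption)|].
intros [a b] Hy.
assert (Ha := Rabs_fst_le (a, b)); assert (Hb := Rabs_snd_le (a, b)); cbn [fst snd] in Ha, Hb.
set (m := Cmod (a, b)) in *.
assert (M1 : m < e) by (eapply Rlt_le_trans; [exact Hy|min_le]).
assert (M2 : m < d1) by (eapply Rlt_le_trans; [exact Hy|min_le]).
assert (M3 : m < d2) by (eapply Rlt_le_trans; [exact Hy|min_le]).
assert (M4 : m < d3) by (eapply Rlt_le_trans; [exact Hy|min_le]).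
specialize (H1 a); specialize (H2 b); specialize (H3 b).
rewrite exp_0, Rminus_0_r, Rmult_1_r in H1; rewrite cos_0, Rminus_0_r, Rmult_0_r, Rminus_0_r in H2.
rewrite sin_0, !Rminus_0_r, Rmult_1_r in H3.
specialize (H1 ltac:(lra)); specialize (H2 ltac:(lra)); specialize (H3 ltac:(lra)).
assert (Hm : 0 <= m) by apply Cmod_ge_0.
assert (Bc := COS_bound b).
apply Rle_trans with (Rabs (exp a * cos b - 1 - a) + Rabs (exp a * sin b - b)).
{ eapply Rle_trans; [apply Cmod_le_sum|]; apply Req_le; unfold cexp, cis; simpl; f_equal; f_equal; ring. }
assert (E3 : Rabs (sin b - b) <= e * m) by nra.
assert (K1 : Rabs (exp a * cos b - 1 - a) <= e * m + 2 * (e * m)).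
{ replace (exp a * cos b - 1 - a) with ((exp a - 1 - a) * cos b + (1 + a) * (cos b - 1)) by ring.
  eapply Rle_trans; [apply Rabs_triang|]; rewrite 2!Rabs_mult.
  assert (Rabs (cos b) <= 1) by (apply Rabs_le; lra).
  assert (Rabs (1 + a) <= 2) by (eapply Rle_trans; [apply Rabs_triang|]; rewrite Rabs_R1; lra).
  assert (0 <= Rabs (exp a - 1 - a)) by apply Rabs_pos.
  assert (0 <= Rabs (cos b - 1)) by apply Rabs_pos.
  apply Rplus_le_compat; nra. }
assert (K2 : Rabs (exp a * sin b - b) <= 2 * m * (2 * m) + e * m).
{ replace (exp a * sin b - b) with ((exp a - 1) * sin b + (sin b - b)) by ring.
  eapply Rle_trans; [apply Rabs_triang|]; rewrite Rabs_mult.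
  assert (L1 : Rabs (exp a - 1) <= 2 * m).
  { replace (exp a - 1) with ((exp a - 1 - a) + a) by ring.
    eapply Rle_trans; [apply Rabs_triang|]; nra. }
  assert (L2 : Rabs (sin b) <= 2 * m).
  { replace (sin b) with ((sin b - b) + b) by ring.
    eapply Rle_trans; [apply Rabs_triang|]; nra. }
  apply Rplus_le_compat; [|exact E3].
  apply Rmult_le_compat; try apply Rabs_pos; assumption. }
nra.
Qed.

Lemma cexp_cdiff u : cdiff cexp u.
Proof.
apply ex_derive_cdiff; exists (cexp u); apply is_derive_iff_eps; intros eps He.
assert (Hc := Cmod_ge_0 (cexp u)).
destruct (cexp_deriv_0 (eps / (Cmod (cexp u) + 1))) as [d [Hd H]].
{ apply Rdiv_lt_0_compat; lra. }
exists d; split; [exact Hd|]; intros y Hy; specialize (H _ Hy).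
replace y with (u + (y - u))%C at 1 by ring; rewrite cexp_plus.
replace (cexp u * cexp (y - u) - cexp u - (y - u) * cexp u)%C
  with (cexp u * (cexp (y - u) - 1 - (y - u)))%C by ring.
rewrite Cmod_mult.
apply Rle_trans with (Cmod (cexp u) * (eps / (Cmod (cexp u) + 1) * Cmod (y - u))).
{ now apply Rmult_le_compat_l. }
replace (Cmod (cexp u) * (eps / (Cmod (cexp u) + 1) * Cmod (y - u)))
  with (eps * Cmod (y - u) * (Cmod (cexp u) / (Cmod (cexp u) + 1))) by (field; lra).
rewrite <- (Rmult_1_r (eps * Cmod (y - u))) at 2; apply Rmult_le_compat_l.
{ apply Rmult_le_pos; [lra|apply Cmod_ge_0]. }
apply Rmult_le_reg_r with (Cmod (cexp u) + 1); [lra|].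
unfold Rdiv; rewrite Rmult_assoc, Rinv_l; lra.
Qed.

Lemma exp_mono x y : x <= y -> exp x <= exp y.
Proof. intros [H| ->]; [left; now apply exp_increasing|apply Rle_refl]. Qed.

(** The contour integral of G(u) du / (i u) over |u| = x, without division by 2 pi. *)
Definition cmean (G : C -> C) (x : R) : C := CInt (fun t => G (RtoC x * cis t)%C) 0 (2 * PI).

Lemma two_PI_pos : 0 < 2 * PI.
Proof. generalize PI_RGT_0; lra. Qed.

(** Under u = exp v the annulus becomes a rectangle of height 2 pi. Its horizontal sides cancel by
    periodicity and the vertical sides are the two circle integrals. *)
Lemma cmean_annulus G x1 x2 : 0 < x1 -> x1 < x2 ->
  (forall u, x1 <= Cmod u <= x2 -> cdiff G u) -> cmean G x1 = cmean G x2.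
Proof.
intros H1 H12 HG.
assert (P := two_PI_pos).
assert (L : ln x1 < ln x2) by (now apply ln_increasing).
assert (HF : forall x y, ln x1 <= x <= ln x1 + (ln x2 - ln x1) -> 0 <= y <= 0 + 2 * PI ->
  cdiff (fun u => G (cexp u)) (x, y)).
{ intros x y Hx _; apply cdiff_comp; [apply cexp_cdiff|]; apply HG.
  unfold cexp; rewrite Cmod_polar by (left; apply exp_pos); cbn [fst].
  rewrite <- (exp_ln x1), <- (exp_ln x2) by lra.
  split; apply exp_mono; lra. }
assert (E := goursat _ (ln x1) 0 (ln x2 - ln x1) (2 * PI) ltac:(lra) P HF).
replace (ln x1 + (ln x2 - ln x1)) with (ln x2) in E by ring; rewrite Rplus_0_l in E.
unfold rect_int in E.
rewrite (CInt_ext (fun x => G (cexp (x, 2 * PI))) (fun x => G (cexp (x, 0)))) in E; [|lra|].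
2:{ intros t _; unfold cexp, cis; cbn [fst snd]; rewrite cos_2PI, sin_2PI, cos_0, sin_0; reflexivity. }
assert (E1 : forall x, 0 < x -> CInt (fun y => G (cexp (ln x, y))) 0 (2 * PI) = cmean G x).
{ intros x Hx; unfold cexp, cmean; cbn [fst snd]; now rewrite exp_ln. }
rewrite 2!E1 in E by lra.
set (m1 := cmean G x1) in *; set (m2 := cmean G x2) in *.
assert (E2 : (Ci * (m2 - m1) = 0)%C) by (rewrite <- E; ring).
replace m1 with (m2 + Ci * (Ci * (m2 - m1)))%C; [rewrite E2; ring|].
replace (Ci * (Ci * (m2 - m1)))%C with (Ci * Ci * (m2 - m1))%C by ring.
replace (Ci * Ci)%C with (-(1))%C by (unfold Ci, Cmult, Copp, RtoC; simpl; f_equal; ring); ring.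
Qed.

Lemma cis_lip s t : Cmod (cis s - cis t) <= 2 * Rabs (s - t).
Proof.
eapply Rle_trans; [apply Cmod_le_sum|]; simpl.
assert (H1 : Rabs (cos s - cos t) <= 1 * Rabs (s - t)).
{ apply bounded_variation with (fun t => - sin t); intros u _; split; [apply is_derive_cos|].
  apply Rabs_le; generalize (SIN_bound u); lra. }
assert (H2 : Rabs (sin s - sin t) <= 1 * Rabs (s - t)).
{ apply bounded_variation with cos; intros u _; split; [apply is_derive_sin|].
  apply Rabs_le; generalize (COS_bound u); lra. }
unfold Rminus in *; lra.
Qed.

Lemma polar_lip x s y t : Cmod (RtoC x * cis s - RtoC y * cis t) <= Rabs (x - y) + 2 * (Rabs y * Rabs (s - t)).
Proof.
replace (RtoC x * cis s - RtoC y * cis t)%C with (RtoC (x - y) * cis s + RtoC y * (cis s - cis t))%C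
  by (rewrite RtoC_minus; ring).
eapply Rle_trans; [apply Cmod_triangle|].
rewrite 2!Cmod_mult, Cmod_cis, 2!Cmod_R, Rmult_1_r.
apply Rplus_le_compat_l; rewrite <- Rmult_assoc, (Rmult_comm 2), Rmult_assoc.
apply Rmult_le_compat_l; [apply Rabs_pos|apply cis_lip].
Qed.

Lemma rcont_circle x t : rcont (fun s => RtoC x * cis s)%C t.
Proof.
intros eps He; exists (eps / (2 * (Rabs x + 1))).
assert (Hx := Rabs_pos x).
split; [apply Rdiv_lt_0_compat; lra|]; intros s Hs.
eapply Rle_lt_trans; [apply polar_lip|]; rewrite Rminus_diag, Rabs_R0, Rplus_0_l.
apply Rle_lt_trans with (2 * (Rabs x + 1) * Rabs (s - t)).
{ generalize (Rabs_pos (s - t)); nra. }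
apply Rmult_lt_reg_r with (/ (2 * (Rabs x + 1))); [apply Rinv_0_lt_compat; lra|].
replace (2 * (Rabs x + 1) * Rabs (s - t) * / (2 * (Rabs x + 1))) with (Rabs (s - t)) by (field; lra).
exact Hs.
Qed.

Lemma rcont_loop x t : rcont (fun s => RtoC x * cis (2 * PI * s))%C t.
Proof.
intros e He; destruct (rcont_circle x (2 * PI * t) e He) as [d [D Hd]].
assert (P := two_PI_pos); exists (d / (2 * PI)); split; [apply Rdiv_lt_0_compat; lra|]; intros s Hs.
apply Hd; replace (2 * PI * s - 2 * PI * t) with (2 * PI * (s - t)) by ring.
rewrite Rabs_mult, (Rabs_pos_eq (2 * PI)) by lra.
apply Rlt_le_trans with (2 * PI * (d / (2 * PI))); [apply Rmult_lt_compat_l; lra|right; field; lra].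
Qed.

Lemma rcont_on_circle G x a b : (forall t, a <= t <= b -> cont_at G (RtoC x * cis t)%C) ->
  rcont_on (fun t => G (RtoC x * cis t)%C) a b.
Proof.
intros H t Ht; apply (rcont_comp G (fun s => RtoC x * cis s)%C); [apply rcont_circle|now apply H].
Qed.

Lemma polar_unif_cont G u v a b :
  (forall x t, u <= x <= v -> a <= t <= b -> cont_at G (RtoC x * cis t)%C) ->
  forall eps, 0 < eps -> exists d, 0 < d /\
    forall x y s t, u <= x <= v -> u <= y <= v -> a <= s <= b -> a <= t <= b ->
      Rabs (x - y) < d -> Rabs (s - t) < d ->
      Cmod (G (RtoC x * cis s)%C - G (RtoC y * cis t)%C) < eps.
Proof.
intros H eps He.
assert (HC : forall x t, u <= x <= v -> a <= t <= b -> forall e, 0 < e -> exists d, 0 < d /\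
  forall y s, Rabs (y - x) < d -> Rabs (s - t) < d ->
    Cmod (G (RtoC y * cis s) - G (RtoC x * cis t))%C < e).
{ intros x t Hx Ht e He'; destruct (H x t Hx Ht e He') as [d [Hd H']].
  assert (Px := Rabs_pos x).
  exists (d / (1 + 2 * (Rabs x + 1))); split; [apply Rdiv_lt_0_compat; lra|]; intros y s Hy Hs.
  apply H'; eapply Rle_lt_trans; [apply polar_lip|].
  apply Rle_lt_trans with (Rabs (y - x) + 2 * (Rabs x + 1) * Rabs (s - t)).
  { generalize (Rabs_pos (s - t)); nra. }
  apply Rlt_le_trans with ((1 + 2 * (Rabs x + 1)) * (d / (1 + 2 * (Rabs x + 1)))).
  - rewrite Rmult_plus_distr_r; apply Rplus_lt_compat; [lra|].
    apply Rmult_lt_compat_l; lra.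
  - apply Req_le; field; lra. }
assert (HU : forall pr : C -> R, (forall z w : C, Rabs (pr z - pr w) <= Cmod (z - w)) ->
  exists d, 0 < d /\ forall x y s t, u <= x <= v -> u <= y <= v -> a <= s <= b -> a <= t <= b ->
      Rabs (x - y) < d -> Rabs (s - t) < d ->
      Rabs (pr (G (RtoC x * cis s)%C) - pr (G (RtoC y * cis t)%C)) < eps / 2).
{ intros pr Hpr.
  destruct (uniform_continuity_2d (fun x t => pr (G (RtoC x * cis t)%C)) u v a b) with
    (mkposreal (eps / 2) ltac:(lra)) as [d Hd].
  - intros x t Hx Ht e; destruct (HC x t Hx Ht e (cond_pos e)) as [d [Hd H']].
    exists (mkposreal d Hd); intros y s Hy Hs; eapply Rle_lt_trans; [apply Hpr|now apply H'].
  - exists d; split; [apply cond_pos|]; intros; now apply Hd. }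
destruct (HU fst) as [d [Hd H1]]; [intros z w; apply (Rabs_fst_le (z - w))|].
destruct (HU snd) as [d' [Hd' H2]]; [intros z w; apply (Rabs_snd_le (z - w))|].
exists (Rmin d d'); split; [now apply Rmin_glb_lt|]; intros x y s t Hx Hy Hs Ht D1 D2.
eapply Rle_lt_trans; [apply Cmod_le_sum|].
assert (A1 := lt_min_l _ _ _ D1); assert (A2 := lt_min_r _ _ _ D1).
assert (A3 := lt_min_l _ _ _ D2); assert (A4 := lt_min_r _ _ _ D2).
specialize (H1 x y s t Hx Hy Hs Ht A1 A3); specialize (H2 x y s t Hx Hy Hs Ht A2 A4).
cbn [Cminus Cplus Copp fst snd]; unfold Rminus in *; lra.
Qed.

Lemma cos_eq_m1 t : 0 <= t <= 2 * PI -> cos t = -1 -> t = PI.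
Proof.
intros Ht E; assert (P := PI_RGT_0); destruct (Rtotal_order t PI) as [L|[L|L]]; [exfalso|exact L|exfalso].
- assert (H := cos_decreasing_1 t PI); rewrite cos_PI in H; lra.
- assert (H := cos_increasing_1 PI t); rewrite cos_PI in H; lra.
Qed.

Lemma list_gap (S : list C) (t : R) : exists d, 0 < d /\
  forall s, In s S -> Cmod s <> t -> d <= Rabs (Cmod s - t).
Proof.
induction S as [|s S [d [Hd H]]].
- exists 1; split; [lra|]; intros s [].
- destruct (Req_dec (Cmod s) t) as [E|E].
  + exists d; split; [exact Hd|]; intros s' [<-|Hs'] Hn; [now elim Hn|now apply H].
  + exists (Rmin d (Rabs (Cmod s - t))); split.
    { apply Rmin_glb_lt; [exact Hd|]; apply Rabs_pos_lt; lra. }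
    intros s' [<-|Hs'] Hn; [apply Rmin_r|].
    eapply Rle_trans; [apply Rmin_l|now apply H].
Qed.

(* At the points of [S] continuity is known but not differentiability, and near [- x0] only
   boundedness. *)
Section CircleMeans.
Variables (G : C -> C) (S : list C) (a b x0 : R).
Hypothesis Ha : 0 <= a.
Hypothesis Hx0 : 0 < x0.
Hypothesis Hc : forall u, a < Cmod u < b -> u <> RtoC (- x0) -> cont_at G u.
Hypothesis Hd : forall u, a < Cmod u < b -> u <> RtoC (- x0) -> ~ In u S -> cdiff G u.
Hypothesis Hb : exists d B, 0 < d /\ forall u, Cmod (u - RtoC (- x0)) < d -> Cmod (G u) <= B.

Lemma neq_x0 u : Cmod u <> x0 -> u <> RtoC (- x0).
Proof. intros H E; apply H; rewrite E, Cmod_R, Rabs_Ropp, Rabs_pos_eq by lra; reflexivity. Qed.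

Lemma circle_mean_cont x : a < x < b -> x <> x0 -> forall eps, 0 < eps -> exists d, 0 < d /\
  forall y, Rabs (y - x) < d -> Cmod (cmean G y - cmean G x) < eps.
Proof.
intros Hx Hn eps He.
set (h := Rmin (Rmin (x - a) (b - x)) (Rabs (x - x0)) / 2).
assert (Hh : 0 < h).
{ unfold h; apply Rdiv_lt_0_compat; [|lra]; repeat apply Rmin_glb_lt; try lra; apply Rabs_pos_lt; lra. }
assert (h < x - a /\ h < b - x /\ h < Rabs (x - x0)) as [K1 [K2 K3]].
{ assert (Rmin (Rmin (x - a) (b - x)) (Rabs (x - x0)) <= x - a)
    by min_le.
  assert (Rmin (Rmin (x - a) (b - x)) (Rabs (x - x0)) <= b - x)
    by min_le.
  assert (Rmin (Rmin (x - a) (b - x)) (Rabs (x - x0)) <= Rabs (x - x0)) by apply Rmin_r.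
  unfold h in *; lra. }
assert (P := two_PI_pos).
assert (HC : forall y t, x - h <= y <= x + h -> 0 <= t <= 2 * PI -> cont_at G (RtoC y * cis t)%C).
{ intros y t Hy _; assert (Em : Cmod (RtoC y * cis t) = y) by (apply Cmod_polar; lra).
  apply Hc; [lra|]; apply neq_x0; rewrite Em; intros ->; revert K3; apply Rle_not_lt, Rabs_le; lra. }
destruct (polar_unif_cont G (x - h) (x + h) 0 (2 * PI) HC (eps / 2 / (2 * PI))) as [d [Hd' H]].
{ apply Rdiv_lt_0_compat; lra. }
exists (Rmin d h); split; [now apply Rmin_glb_lt|]; intros y Hy.
assert (Hy1 := lt_min_l _ _ _ Hy); assert (Hy2 := lt_min_r _ _ _ Hy).
apply Rabs_def2 in Hy2.
assert (R1 : rcont_on (fun t => G (RtoC y * cis t)%C) 0 (2 * PI)).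
{ apply rcont_on_circle; intros t Ht; apply HC; lra. }
assert (R2 : rcont_on (fun t => G (RtoC x * cis t)%C) 0 (2 * PI)).
{ apply rcont_on_circle; intros t Ht; apply HC; lra. }
unfold cmean; rewrite <- CInt_minus by (assumption || lra).
apply Rle_lt_trans with (eps / 2 / (2 * PI) * (2 * PI - 0)).
2:{ replace (eps / 2 / (2 * PI) * (2 * PI - 0)) with (eps / 2) by (field; lra); lra. }
apply CInt_bound; [lra| |].
{ intros t Ht; apply rcont_minus; auto. }
intros t Ht; left.
apply H; try lra.
rewrite Rminus_diag, Rabs_R0; exact Hd'.
Qed.

Lemma circle_mean_arc x y : a < x -> x < y -> y < b ->
  (forall s, In s S -> ~ x <= Cmod s <= y) -> ~ x <= x0 <= y -> cmean G x = cmean G y.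
Proof.
intros H1 H2 H3 HS Hx; apply cmean_annulus; [lra|exact H2|]; intros u Hu; apply Hd.
- lra.
- apply neq_x0; intros E; lra.
- intros Hin; exact (HS u Hin Hu).
Qed.

(* The arc of angular width [2 k] around the bad point contributes little because [G] is
   bounded there; off this arc [G] is uniformly continuous. *)
Lemma circle_mean_cross eps : a < x0 < b -> 0 < eps -> exists d, 0 < d /\
  forall x y, x0 - d < x < x0 + d -> x0 - d < y < x0 + d -> x <> x0 -> y <> x0 ->
    Cmod (cmean G x - cmean G y) < eps.
Proof.
intros Hx He; destruct Hb as [e [B [He0 HB]]].
assert (HB0 : 0 <= B).
{ eapply Rle_trans; [apply Cmod_ge_0|apply (HB (RtoC (- x0)))]; rewrite Cmod_sub_self; exact He0. }
(* k <= 1 keeps the arc inside the parameter interval; k <= e / (4 x0) keeps it within e of - x0,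
   where |G| <= B; the third bound makes its contribution 4 B k at most eps / 4. *)
set (k := Rmin 1 (Rmin (e / (4 * x0)) (eps / (16 * (B + 1))))).
assert (Hk : 0 < k).
{ unfold k; repeat apply Rmin_glb_lt; [lra|apply Rdiv_lt_0_compat; lra|apply Rdiv_lt_0_compat; lra]. }
assert (k <= 1) by apply Rmin_l.
assert (Hk2 : k <= e / (4 * x0)) by min_le.
assert (Hk3 : k <= eps / (16 * (B + 1))) by min_le.
set (h := Rmin (Rmin (x0 - a) (b - x0)) e / 4).
assert (Hh : 0 < h /\ h < x0 - a /\ h < b - x0 /\ h <= e / 4).
{ assert (0 < Rmin (Rmin (x0 - a) (b - x0)) e) by (repeat apply Rmin_glb_lt; lra).
  assert (Rmin (Rmin (x0 - a) (b - x0)) e <= x0 - a)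
    by min_le.
  assert (Rmin (Rmin (x0 - a) (b - x0)) e <= b - x0)
    by min_le.
  assert (Rmin (Rmin (x0 - a) (b - x0)) e <= e) by apply Rmin_r.
  unfold h; lra. }
destruct Hh as [Hh [K1 [K2 K3]]].
assert (PI1 : 1 < PI) by (generalize PI2_1; lra).
assert (HC : forall y t, x0 - h <= y <= x0 + h -> 0 <= t <= 2 * PI -> (y = x0 -> t <> PI) ->
  cont_at G (RtoC y * cis t)%C).
{ intros y t Hy Ht Hn; assert (Em : Cmod (RtoC y * cis t) = y) by (apply Cmod_polar; lra).
  apply Hc; [lra|]; intros E.
  assert (Ey : y = x0).
  { rewrite <- Em, E, Cmod_R, Rabs_Ropp; apply Rabs_pos_eq; lra. }
  apply (Hn Ey), cos_eq_m1; [exact Ht|].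
  apply (f_equal fst) in E; unfold cis in E; simpl in E; subst y; nra. }
destruct (polar_unif_cont G (x0 - h) (x0 + h) 0 (PI - k)) with (eps / 8 / (2 * PI)) as [d1 [D1 U1]].
{ intros y t Hy Ht; apply HC; lra. }
{ apply Rdiv_lt_0_compat; lra. }
destruct (polar_unif_cont G (x0 - h) (x0 + h) (PI + k) (2 * PI)) with (eps / 8 / (2 * PI)) as [d2 [D2 U2]].
{ intros y t Hy Ht; apply HC; lra. }
{ apply Rdiv_lt_0_compat; lra. }
exists (Rmin h (Rmin (d1 / 2) (d2 / 2))); split; [repeat apply Rmin_glb_lt; lra|].
set (dd := Rmin h (Rmin (d1 / 2) (d2 / 2))).
assert (dd <= h) by apply Rmin_l.
assert (dd <= d1 / 2) by min_le.
assert (dd <= d2 / 2) by min_le.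
intros x y Rx Ry Nx Ny.
assert (C1 : rcont_on (fun t => G (RtoC x * cis t)%C) 0 (2 * PI)).
{ apply rcont_on_circle; intros t Ht; apply HC; try lra; intros; contradiction. }
assert (C2 : rcont_on (fun t => G (RtoC y * cis t)%C) 0 (2 * PI)).
{ apply rcont_on_circle; intros t Ht; apply HC; try lra; intros; contradiction. }
assert (C3 : rcont_on (fun t => G (RtoC x * cis t) - G (RtoC y * cis t))%C 0 (2 * PI)).
{ intros t Ht; apply rcont_minus; auto. }
unfold cmean; rewrite <- CInt_minus by (assumption || lra).
assert (C4 : forall u v, 0 <= u -> v <= 2 * PI -> rcont_on (fun t => G (RtoC x * cis t) - G (RtoC y * cis t))%C u v).
{ intros u v Hu Hv t Ht; apply C3; lra. }
rewrite <- (CInt_Chasles _ 0 (PI + k) (2 * PI)) by (lra || (apply C4; lra)).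
rewrite <- (CInt_Chasles _ 0 (PI - k) (PI + k)) by (lra || (apply C4; lra)).
assert (E8 : eps / 8 / (2 * PI) * (2 * PI) = eps / 8) by (field; lra).
assert (I1 : Cmod (CInt (fun t => G (RtoC x * cis t) - G (RtoC y * cis t))%C 0 (PI - k)) <= eps / 8).
{ eapply Rle_trans; [apply CInt_bound with (M := eps / 8 / (2 * PI)); [lra|apply C4; lra|]|nra].
  intros t Ht; left; apply U1; try lra; [apply Rabs_def1; lra|rewrite Rminus_diag, Rabs_R0; lra]. }
assert (I2 : Cmod (CInt (fun t => G (RtoC x * cis t) - G (RtoC y * cis t))%C (PI + k) (2 * PI)) <= eps / 8).
{ eapply Rle_trans; [apply CInt_bound with (M := eps / 8 / (2 * PI)); [lra|apply C4; lra|]|nra].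
  intros t Ht; left; apply U2; try lra; [apply Rabs_def1; lra|rewrite Rminus_diag, Rabs_R0; lra]. }
assert (HBd : forall w t, x0 - dd < w < x0 + dd -> PI - k <= t <= PI + k -> Cmod (G (RtoC w * cis t)%C) <= B).
{ intros w t Hw Ht; apply HB; replace (RtoC (- x0)) with (RtoC x0 * cis PI)%C.
  2:{ unfold cis; rewrite cos_PI, sin_PI; unfold RtoC, Cmult; simpl; f_equal; ring. }
  eapply Rle_lt_trans; [apply polar_lip|]; rewrite (Rabs_pos_eq x0) by lra.
  assert (Rabs (w - x0) <= e / 4) by (apply Rabs_le; lra).
  assert (Rabs (t - PI) <= k) by (apply Rabs_le; lra).
  assert (x0 * Rabs (t - PI) <= e / 4); [|lra].
  apply Rle_trans with (x0 * (e / (4 * x0))); [apply Rmult_le_compat_l; lra|].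
  apply Req_le; field; lra. }
assert (I3 : Cmod (CInt (fun t => G (RtoC x * cis t) - G (RtoC y * cis t))%C (PI - k) (PI + k)) <= eps / 4).
{ eapply Rle_trans; [apply CInt_bound with (M := 2 * B); [lra|apply C4; lra|]|].
  - intros t Ht; eapply Rle_trans; [apply Cmod_sub_le|].
    assert (T1 := HBd x t Rx Ht); assert (T2 := HBd y t Ry Ht); lra.
  - replace (PI + k - (PI - k)) with (2 * k) by ring.
    apply Rle_trans with (4 * (B + 1) * k); [nra|].
    apply Rle_trans with (4 * (B + 1) * (eps / (16 * (B + 1)))); [apply Rmult_le_compat_l; lra|].
    apply Req_le; field; lra. }
eapply Rle_lt_trans; [apply Cmod_triangle|].
eapply Rle_lt_trans; [apply Rplus_le_compat_r, Cmod_triangle|]; lra.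
Qed.

Lemma Ceq_eps (z w : C) : (forall eps, 0 < eps -> Cmod (z - w) < eps) -> z = w.
Proof.
intros H; destruct (excluded_middle_informative (z = w)) as [E|E]; [exact E|exfalso].
assert (Hp := proj1 (Cmod_gt_0 _) (Cminus_neq0 _ _ E)); specialize (H _ Hp); lra.
Qed.

(** For radii close to t all exceptional points lie on the circle of radius t itself, so the mean is
    constant on each side. Continuity in the radius, or [circle_mean_cross] when t = x0, identifies
    the two constants. *)
Lemma circle_mean_local t : a < t < b -> exists d v, 0 < d /\
  forall s, Rabs (s - t) < d -> s <> x0 -> cmean G s = v.
Proof.
intros Ht.
destruct (list_gap (RtoC x0 :: S) t) as [g [Hg HS]].
set (d := Rmin g (Rmin (t - a) (b - t))).
assert (Hdp : 0 < d) by (unfold d; repeat apply Rmin_glb_lt; lra).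
assert (D1 : d <= g) by apply Rmin_l.
assert (D2 : d <= t - a) by min_le.
assert (D3 : d <= b - t) by min_le.
assert (Arc : forall x y, x < y -> (t - d < x /\ y < t) \/ (t < x /\ y < t + d) -> cmean G x = cmean G y).
{ intros x y Hxy Hs; apply circle_mean_arc; try lra.
  - intros s Hin Hr; assert (N : Cmod s <> t) by (destruct Hs; lra).
    specialize (HS s (or_intror Hin) N); revert HS; apply Rlt_not_le, Rabs_def1; lra.
  - intros Hr; assert (Ex : Cmod (RtoC x0) = x0) by (rewrite Cmod_R; apply Rabs_pos_eq; lra).
    assert (N : Cmod (RtoC x0) <> t) by (rewrite Ex; destruct Hs; lra).
    specialize (HS _ (or_introl eq_refl) N); rewrite Ex in HS.
    revert HS; apply Rlt_not_le, Rabs_def1; lra. }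
assert (Close : forall eps, 0 < eps -> exists x y, t - d < x /\ x < t /\ t < y /\ y < t + d /\
  Cmod (cmean G x - cmean G y) < eps).
{ intros eps He; destruct (Req_dec t x0) as [E|E].
  - destruct (circle_mean_cross eps) as [e [He0 H]]; [lra|exact He|].
    exists (t - Rmin d e / 2), (t + Rmin d e / 2).
    assert (0 < Rmin d e) by (now apply Rmin_glb_lt).
    assert (Rmin d e <= d) by apply Rmin_l; assert (Rmin d e <= e) by apply Rmin_r.
    repeat split; try lra; apply H; lra.
  - destruct (circle_mean_cont t Ht E (eps / 2)) as [e [He0 H]]; [lra|].
    exists (t - Rmin d e / 2), (t + Rmin d e / 2).
    assert (0 < Rmin d e) by (now apply Rmin_glb_lt).
    assert (Rmin d e <= d) by apply Rmin_l; assert (Rmin d e <= e) by apply Rmin_r.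
    repeat split; try lra.
    assert (Hl := H (t - Rmin d e / 2) ltac:(apply Rabs_def1; lra)).
    assert (Hr := H (t + Rmin d e / 2) ltac:(apply Rabs_def1; lra)).
    match goal with |- Cmod (?A - ?B) < _ =>
      replace (A - B)%C with ((A - cmean G t) - (B - cmean G t))%C by ring end.
    eapply Rle_lt_trans; [apply Cmod_sub_le|]; lra. }
exists d, (cmean G (t - d / 2)); split; [exact Hdp|].
assert (L : forall s, t - d < s < t -> cmean G s = cmean G (t - d / 2)).
{ intros s Hs; destruct (Rtotal_order s (t - d / 2)) as [O|[O|O]]; [apply Arc; lra|now rewrite O|].
  symmetry; apply Arc; lra. }
assert (Rt : forall s, t < s < t + d -> cmean G s = cmean G (t + d / 2)).
{ intros s Hs; destruct (Rtotal_order s (t + d / 2)) as [O|[O|O]]; [apply Arc; lra|now rewrite O|].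
  symmetry; apply Arc; lra. }
assert (LR : cmean G (t - d / 2) = cmean G (t + d / 2)).
{ apply Ceq_eps; intros eps He; destruct (Close eps He) as [x [y [X1 [X2 [Y1 [Y2 H]]]]]].
  rewrite <- (L x), <- (Rt y) by lra; exact H. }
intros s Hs Ns; apply Rabs_def2 in Hs.
destruct (Rtotal_order s t) as [O|[O|O]]; [apply L; lra| |rewrite LR; apply Rt; lra].
subst s; apply Ceq_eps; intros eps He.
destruct (circle_mean_cont t Ht Ns eps He) as [e [He0 H]].
assert (0 < Rmin d e) by (now apply Rmin_glb_lt).
assert (Rmin d e <= d) by apply Rmin_l; assert (Rmin d e <= e) by apply Rmin_r.
rewrite <- (L (t - Rmin d e / 2)) by lra; rewrite Cmod_sub_sym; apply H, Rabs_def1; lra.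
Qed.

Lemma circle_mean_const_lt x y : a < x -> x < y -> y < b -> x <> x0 -> y <> x0 -> cmean G x = cmean G y.
Proof.
intros Hx Hxy Hy Nx Ny.
(* The mean over |u| = x0 is not controlled. It is replaced by the common value of the nearby means,
   so that [m] is locally constant on the whole interval and has derivative 0. If x0 lies outside
   the interval, [v0] is a dummy. *)
assert (exists v0, a < x0 < b -> exists e, 0 < e /\
  forall s, Rabs (s - x0) < e -> s <> x0 -> cmean G s = v0) as [v0 Hv0].
{ destruct (excluded_middle_informative (a < x0 < b)) as [A|A].
  - destruct (circle_mean_local x0 A) as [e [v [He Hv]]]; exists v; intros _; now exists e.
  - exists 0%C; tauto. }
pose (m := fun s => if Req_EM_T s x0 then v0 else cmean G s).
assert (Hm : forall s, s <> x0 -> m s = cmean G s).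
{ intros s Hs; unfold m; destruct (Req_EM_T s x0); [contradiction|reflexivity]. }
assert (Loc : forall t, x <= t <= y -> exists d v, 0 < d /\ forall s, Rabs (s - t) < d -> m s = v).
{ intros t Ht; assert (Ht' : a < t < b) by lra.
  destruct (circle_mean_local t Ht') as [d0 [v [Hd0 Hv]]].
  assert (D : 0 < Rmin d0 (Rmin (t - a) (b - t))) by (repeat apply Rmin_glb_lt; lra).
  set (d := Rmin d0 (Rmin (t - a) (b - t))) in *.
  assert (D1 : d <= d0) by apply Rmin_l.
  assert (D2 : d <= t - a) by min_le.
  assert (D3 : d <= b - t) by min_le.
  exists d, v; split; [exact D|]; intros s Hs.
  destruct (Req_dec s x0) as [E|E]; [|rewrite Hm by exact E; apply Hv; [lra|exact E]].
  assert (Hs' := Rabs_def2 _ _ Hs).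
  unfold m; destruct (Req_EM_T s x0) as [_|N]; [|contradiction].
  destruct (Hv0 ltac:(lra)) as [e [He H0]].
  set (k := Rmin e (d - Rabs (s - t))).
  assert (0 < k) by (apply Rmin_glb_lt; lra).
  assert (k <= e) by apply Rmin_l; assert (k <= d - Rabs (s - t)) by apply Rmin_r.
  rewrite <- (H0 (s + k / 2)), <- (Hv (s + k / 2)); [reflexivity| |lra| |lra].
  + replace (s + k / 2 - t) with ((s - t) + k / 2) by ring.
    eapply Rle_lt_trans; [apply Rabs_triang|]; rewrite (Rabs_pos_eq (k / 2)); lra.
  + rewrite <- E; replace (s + k / 2 - s) with (k / 2) by ring; rewrite Rabs_pos_eq; lra. }
assert (Pr : forall pr : C -> R, pr (m x) = pr (m y)).
{ intros pr; apply (eq_is_derive (V := R_NormedModule) (fun s => pr (m s))); [|exact Hxy].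
  intros t Ht; destruct (Loc t Ht) as [d [v [D H]]].
  apply (is_derive_ext_loc (fun _ => pr v)); [|apply is_derive_const].
  exists (mkposreal d D); intros s Hs; now rewrite (H s Hs). }
rewrite <- (Hm x), <- (Hm y) by assumption.
apply injective_projections; apply Pr.
Qed.

Lemma circle_mean_const x y : a < x < b -> a < y < b -> x <> x0 -> y <> x0 -> cmean G x = cmean G y.
Proof.
intros Hx Hy Nx Ny; destruct (Rtotal_order x y) as [O|[O|O]].
- apply circle_mean_const_lt; tauto.
- now rewrite O.
- symmetry; apply circle_mean_const_lt; tauto.
Qed.
End CircleMeans.

(** * Consequences of the mean value property *)

Lemma cont_shift c u : cont_at (fun y => c + y)%C u.
Proof. apply cont_plus; [apply cont_const|apply cont_id]. Qed.

(** The mean over the circle of radius x equals the mean over arbitrarily small circles, which tends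
    to 2 pi G(c). Only the centre is estimated; another point is reached by a disc around it. *)
Lemma max_modulus_disc G c x b S B : 0 < x -> x < b ->
  (forall u, Cmod (u - c) < b -> cont_at G u) ->
  (forall u, Cmod (u - c) < b -> ~ In u S -> cdiff G u) ->
  (forall u, Cmod (u - c) = x -> Cmod (G u) <= B) -> Cmod (G c) <= B.
Proof.
intros Hx Hxb Hc Hd HB.
pose (G' := fun y => G (c + y)%C).
assert (Hs : forall u, (c + u - c = u)%C) by (intros; ring).
assert (Hc' : forall u, Cmod u < b -> cont_at G' u).
{ intros u Hu; apply (cont_comp G (fun y => c + y)%C); [apply cont_shift|].
  apply Hc; rewrite Hs; exact Hu. }
assert (P := two_PI_pos).
(* There is no bad point here: - x / 2 is a dummy position at which G' is continuous, and the radii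
   used avoid x / 2. *)
assert (Hm : forall y, 0 < y < b -> y <> x / 2 -> cmean G' y = cmean G' x).
{ intros y Hy Ny; apply (circle_mean_const G' (map (fun s => s - c)%C S) 0 b (x / 2)); try lra.
  - intros u Hu _; apply Hc'; lra.
  - intros u Hu _ Hin; apply (cdiff_comp G (fun y => c + y)%C).
    + apply cdiff_plus; [apply cdiff_const|apply cdiff_id].
    + apply Hd; [rewrite Hs; lra|]; intros Hin'; apply Hin.
      rewrite <- (Hs u); exact (in_map (fun s => s - c)%C S _ Hin').
  - destruct (cont_bound G' (RtoC (- (x / 2)))) as [d [B' [D [_ H]]]].
    + apply Hc'; rewrite Cmod_R, Rabs_Ropp, Rabs_pos_eq; lra.
    + exists d, B'; tauto. }
assert (HR : forall y, 0 < y < b -> rcont_on (fun t => G' (RtoC y * cis t)%C) 0 (2 * PI)).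
{ intros y Hy; apply rcont_on_circle; intros t _; apply Hc'; rewrite Cmod_polar; lra. }
assert (HI : Cmod (cmean G' x) <= B * (2 * PI)).
{ eapply Rle_trans; [apply CInt_bound with (M := B); [lra|apply HR; lra|]|apply Req_le; ring].
  intros t _; apply HB; rewrite Hs; apply Cmod_polar; lra. }
apply le_epsilon; intros eps He.
destruct (Hc' 0%C) with eps as [d [D H]]; [rewrite Cmod_0; lra|exact He|].
assert (M : 0 < Rmin (x / 2) d) by (apply Rmin_glb_lt; lra).
assert (M1 : Rmin (x / 2) d <= x / 2) by apply Rmin_l; assert (M2 : Rmin (x / 2) d <= d) by apply Rmin_r.
set (y := Rmin (x / 2) d / 2).
assert (E : Cmod (cmean G' y - RtoC (2 * PI) * G' 0%C) <= eps * (2 * PI)).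
{ replace (RtoC (2 * PI) * G' 0%C)%C with (CInt (fun _ => G' 0%C) 0 (2 * PI)).
  2:{ rewrite CInt_const; f_equal; f_equal; ring. }
  assert (Hk : rcont_on (fun _ => G' 0%C) 0 (2 * PI)).
  { intros t _; apply rcont_const. }
  assert (Hy : rcont_on (fun t => G' (RtoC y * cis t)%C) 0 (2 * PI)) by (apply HR; unfold y; lra).
  unfold cmean; rewrite <- CInt_minus by (assumption || lra).
  eapply Rle_trans; [apply CInt_bound with (M := eps); [lra| |]|apply Req_le; ring].
  - intros t Ht; apply rcont_minus; auto.
  - intros t _; left; apply H.
    replace (RtoC y * cis t - 0)%C with (RtoC y * cis t)%C by ring.
    rewrite Cmod_polar; unfold y; lra. }
rewrite Hm in E by (unfold y; lra).
assert (E2 : 2 * PI * Cmod (G c) <= 2 * PI * (B + eps)).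
{ replace (2 * PI * Cmod (G c)) with (Cmod (RtoC (2 * PI) * G' 0%C)).
  2:{ rewrite Cmod_mult, Cmod_R, Rabs_pos_eq by lra; unfold G'; do 3 f_equal; ring. }
  generalize (Cmod_sub_ge (RtoC (2 * PI) * G' 0%C) (cmean G' x)); rewrite Cmod_sub_sym; lra. }
apply Rmult_le_reg_l in E2; lra.
Qed.

(** A Schwarz lemma from an estimate at centres only: the disc of radius d / 2 is put around x, not
    c. On its boundary |u - c| >= 3 d / 8, so the slope is at most 8 / (3 d), and |f x| <= 1 / 3
    follows. *)
Lemma schwarz_step f c d x : 0 < d ->
  (forall u, Cmod (u - c) < d -> cdiff f u /\ Cmod (f u) < 1) -> f c = 0%C ->
  Cmod (x - c) <= d / 8 -> Cmod (f x) <= 1 / 2.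
Proof.
intros Hd H Hc Hx.
assert (Hin : forall u, Cmod (u - x) < 3 * d / 4 -> Cmod (u - c) < d).
{ intros u Hu; replace (u - c)%C with ((u - x) + (x - c))%C by ring.
  eapply Rle_lt_trans; [apply Cmod_triangle|]; lra. }
assert (HG : Cmod (slope f c x) <= 8 / (3 * d)).
{ apply (max_modulus_disc _ x (d / 2) (3 * d / 4) (c :: nil)); try lra.
  - intros u Hu; destruct (excluded_middle_informative (u = c)) as [E|E].
    + rewrite E; apply slope_cont_self, H; rewrite Cmod_sub_self; exact Hd.
    + apply slope_cont; [exact E|]; apply cdiff_cont, H, Hin, Hu.
  - intros u Hu Hn; apply slope_cdiff; [intros E; apply Hn; left; now symmetry|apply H, Hin, Hu].
  - intros u Hu.
    assert (L : 3 * d / 8 <= Cmod (u - c)).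
    { generalize (Cmod_sub_ge (u - x) (c - x)).
      replace (u - x - (c - x))%C with (u - c)%C by ring; rewrite (Cmod_sub_sym c x); lra. }
    assert (Hu' : Cmod (u - c) < d) by (apply Hin; lra).
    assert (E := slope_spec f c u); rewrite Hc in E.
    apply (f_equal Cmod) in E; rewrite Cmod_mult in E.
    replace (f u - 0)%C with (f u) in E by ring.
    assert (F1 := proj2 (H u Hu')).
    apply Rmult_le_reg_r with (Cmod (u - c)); [lra|]; rewrite <- E.
    apply Rle_trans with (8 / (3 * d) * (3 * d / 8)).
    + replace (8 / (3 * d) * (3 * d / 8)) with 1 by (field; lra); lra.
    + apply Rmult_le_compat_l; [|exact L]; apply Rlt_le, Rdiv_lt_0_compat; lra. }
assert (E := slope_spec f c x); rewrite Hc in E.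
apply (f_equal Cmod) in E; rewrite Cmod_mult in E.
replace (f x - 0)%C with (f x) in E by ring; rewrite E.
apply Rle_trans with (8 / (3 * d) * (d / 8)).
- apply Rmult_le_compat; try apply Cmod_ge_0; assumption.
- replace (8 / (3 * d) * (d / 8)) with (1 / 3) by (field; lra); lra.
Qed.

(** * Moebius maps of the disc, chains of discs and inverse functions *)

Lemma Cmod_sqr z : Cmod z * Cmod z = fst z * fst z + snd z * snd z.
Proof.
unfold Cmod; rewrite sqrt_sqrt; [simpl; ring|].
apply Rplus_le_le_0_compat; apply pow2_ge_0.
Qed.

Definition mob (a w : C) : C := ((w - a) / (1 - Cconj a * w))%C.

Lemma mob_identity a w :
  Cmod (1 - Cconj a * w) * Cmod (1 - Cconj a * w) - Cmod (w - a) * Cmod (w - a)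
  = (1 - Cmod a * Cmod a) * (1 - Cmod w * Cmod w).
Proof.
rewrite !Cmod_sqr; destruct a, w; simpl; ring.
Qed.

Lemma mob_rhs_pos p q : 0 <= p < 1 -> 0 <= q < 1 -> 0 < (1 - p * p) * (1 - q * q).
Proof. intros Hp Hq; apply Rmult_lt_0_compat; nra. Qed.

Lemma mob_den a w : Cmod a < 1 -> Cmod w < 1 -> (1 - Cconj a * w)%C <> 0%C.
Proof.
intros Ha Hw E; assert (H := mob_identity a w); rewrite E, Cmod_0 in H.
generalize (mob_rhs_pos _ _ (conj (Cmod_ge_0 a) Ha) (conj (Cmod_ge_0 w) Hw)); nra.
Qed.

Lemma mob_lt1 a w : Cmod a < 1 -> Cmod w < 1 -> Cmod (mob a w) < 1.
Proof.
intros Ha Hw; assert (H := mob_identity a w); assert (D := mob_den a w Ha Hw).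
unfold mob; rewrite Cmod_div by exact D.
assert (Hp := proj1 (Cmod_gt_0 _) D).
apply Rmult_lt_reg_r with (Cmod (1 - Cconj a * w)); [exact Hp|].
unfold Rdiv; rewrite Rmult_assoc, Rinv_l, Rmult_1_r, Rmult_1_l by lra.
generalize (mob_rhs_pos _ _ (conj (Cmod_ge_0 a) Ha) (conj (Cmod_ge_0 w) Hw)) (Cmod_ge_0 (w - a)); nra.
Qed.

Lemma mob_cdiff f a u : cdiff f u -> Cmod a < 1 -> Cmod (f u) < 1 -> cdiff (fun y => mob a (f y)) u.
Proof.
intros Hf Ha Hu; unfold mob; apply cdiff_div.
- apply cdiff_minus; [exact Hf|apply cdiff_const].
- apply cdiff_minus; [apply cdiff_const|]; apply cdiff_mult; [apply cdiff_const|exact Hf].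
- now apply mob_den.
Qed.

Lemma mob_self a : mob a a = 0%C.
Proof. unfold mob, Cdiv; ring. Qed.

(** With p = |a| and n = |1 - conj(a) w| >= 1 - p, [mob_identity] gives (3 / 4) n^2 <= (1 - p^2) (1
    - |w|^2). Dividing by 1 - p and using 1 + p <= 2 yields the constant 3 / 8. *)
Lemma mob_away a w : Cmod a < 1 -> Cmod w < 1 -> Cmod (mob a w) <= 1 / 2 ->
  Cmod w * Cmod w <= 1 - 3 / 8 * (1 - Cmod a).
Proof.
intros Ha Hw H; assert (I := mob_identity a w); assert (D := mob_den a w Ha Hw).
unfold mob in H; rewrite Cmod_div in H by exact D.
assert (Hp := proj1 (Cmod_gt_0 _) D).
assert (H' : Cmod (w - a) <= 1 / 2 * Cmod (1 - Cconj a * w)).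
{ apply Rmult_le_reg_r with (/ Cmod (1 - Cconj a * w)); [now apply Rinv_0_lt_compat|].
  rewrite Rmult_assoc, Rinv_r, Rmult_1_r by lra; exact H. }
assert (Kn : 1 - Cmod a <= Cmod (1 - Cconj a * w)).
{ generalize (Cmod_sub_ge 1 (Cconj a * w)); rewrite Cmod_1, Cmod_mult, Cmod_conj.
  generalize (Cmod_ge_0 a) (Cmod_ge_0 w); nra. }
assert (K2 := Cmod_ge_0 (w - a)); assert (K3 := Cmod_ge_0 a).
set (n := Cmod (1 - Cconj a * w)) in *; set (m := Cmod (w - a)) in *.
set (p := Cmod a) in *; set (q := Cmod w) in *.
assert (M1 : m * m <= 1 / 4 * (n * n)) by nra.
assert (M2 : (1 - p) * (1 - p) <= n * n) by nra.
assert (M4 : 3 / 4 * (1 - p) <= (1 + p) * (1 - q * q)).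
{ apply Rmult_le_reg_l with (1 - p); [lra|]; lra. }
nra.
Qed.

Definition hol (A : C -> Prop) (f : C -> C) : Prop := forall u, A u -> cdiff f u.

Lemma hol_iff A f : holomorphic_on A f <-> hol A f.
Proof. split; intros H u Hu; apply ex_derive_cdiff, H, Hu. Qed.

(** Each step moves the value of f by at most 1 / 2 in the pseudohyperbolic distance, so by
    [mob_away] a bound below 1 survives every step. It does not depend on f, which makes the
    Caratheodory distance finite. *)
Lemma chain_bound (A : C -> Prop) (y : nat -> C) (n : nat) (d : R) : 0 < d ->
  (forall i, (i <= n)%nat -> forall u, Cmod (u - y i) < d -> A u) ->
  (forall i, (i < n)%nat -> Cmod (y (S i) - y i) <= d / 8) ->
  exists l, 0 <= l < 1 /\ forall f, hol A f -> maps_to A unit_disc f -> f (y O) = 0%C ->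
    Cmod (f (y n)) <= l.
Proof.
intros Hd HA Hy; induction n as [|n IH].
- exists 0; split; [lra|]; intros f _ _ ->; rewrite Cmod_0; lra.
- destruct IH as [l [Hl IH]]; [intros i Hi; apply HA; lia|intros i Hi; apply Hy; lia|].
  exists (sqrt (1 - 3 / 8 * (1 - l))); split; [split; [apply sqrt_pos|]|].
  { apply Rlt_le_trans with (sqrt 1); [apply sqrt_lt_1; lra|rewrite sqrt_1; lra]. }
  intros f Hf Hm H0; specialize (IH f Hf Hm H0).
  assert (HAn : forall u, Cmod (u - y n) < d -> A u) by (apply HA; lia).
  assert (Hn : A (y n)) by (apply HAn; rewrite Cmod_sub_self; exact Hd).
  assert (Hn' : A (y (S n))) by (apply HAn; generalize (Hy n (Nat.lt_succ_diag_r n)); lra).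
  assert (S := mob_away (f (y n)) (f (y (S n))) (Hm _ Hn) (Hm _ Hn')).
  assert (Cmod (mob (f (y n)) (f (y (Datatypes.S n)))) <= 1 / 2).
  { apply (schwarz_step (fun u => mob (f (y n)) (f u)) (y n) d); [exact Hd| |apply mob_self|apply Hy; lia].
    intros u Hu; assert (Au := HAn u Hu); split.
    - apply mob_cdiff; [now apply Hf|now apply Hm|now apply Hm].
    - apply mob_lt1; now apply Hm. }
  rewrite <- (sqrt_square (Cmod (f (y (Datatypes.S n))))) by apply Cmod_ge_0.
  apply sqrt_le_1_alt; eapply Rle_trans; [apply S; assumption|]; lra.
Qed.

Lemma polar_exists u x : Cmod u = x -> exists t, 0 <= t <= 2 * PI /\ u = (RtoC x * cis t)%C.
Proof.
intros Hx; assert (P := PI_RGT_0); assert (Q := Cmod_sqr u); rewrite Hx in Q.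
destruct (Req_dec x 0) as [E|E].
{ exists 0; split; [lra|]; rewrite E in *; apply Cmod_eq_0 in Hx; rewrite Hx; ring. }
destruct u as [p q]; cbn [fst snd] in Q.
assert (Hp : p = x * (p / x)) by (field; exact E); set (c := p / x) in *.
assert (Hq : q = x * (q / x)) by (field; exact E); set (s := q / x) in *.
rewrite Hp, Hq in Q.
assert (Ecs : 1 = c * c + s * s).
{ apply Rmult_eq_reg_l with (x * x); [lra|nra]. }
assert (Hc : -1 <= c <= 1) by nra.
assert (Ha := acos_bound c).
assert (Es : sin (acos c) = Rabs s).
{ rewrite sin_acos by exact Hc; rewrite <- sqrt_Rsqr_abs; f_equal; unfold Rsqr; lra. }
destruct (Rle_lt_dec 0 s) as [S|S].
- exists (acos c); split; [lra|]; unfold cis; rewrite cos_acos, Es, Rabs_pos_eq by assumption.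
  rewrite Hp, Hq; unfold RtoC, Cmult; simpl; f_equal; ring.
- exists (2 * PI - acos c); split; [lra|]; unfold cis.
  rewrite cos_minus, sin_minus, cos_2PI, sin_2PI, cos_acos, Es, Rabs_left by assumption.
  rewrite Hp, Hq; unfold RtoC, Cmult; simpl; f_equal; ring.
Qed.

Lemma circle_min (f : C -> C) (c : C) (x : R) : 0 <= x ->
  (forall u, Cmod (u - c) = x -> cont_at f u /\ f u <> 0%C) ->
  exists m, 0 < m /\ forall u, Cmod (u - c) = x -> m <= Cmod (f u).
Proof.
intros Hx H.
pose (k := fun t => Cmod (f (c + RtoC x * cis t)%C)).
assert (Hk : forall t, Cmod (c + RtoC x * cis t - c) = x).
{ intros t; replace (c + RtoC x * cis t - c)%C with (RtoC x * cis t)%C by ring; now apply Cmod_polar. }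
destruct (continuity_ab_min k 0 (2 * PI)) as [t0 [H1 H2]].
- generalize two_PI_pos; lra.
- intros t _; apply continuity_pt_filterlim.
  apply (rcont_Cmod (fun t => f (c + RtoC x * cis t)%C)).
  apply (rcont_comp f (fun t => c + RtoC x * cis t)%C); [|apply H, Hk].
  apply (rcont_comp (fun y => c + y)%C (fun t => RtoC x * cis t)%C); [apply rcont_circle|apply cont_shift].
- exists (k t0); split; [apply Cmod_gt_0, H, Hk|].
  intros u Hu; assert (exists t, 0 <= t <= 2 * PI /\ u = (c + RtoC x * cis t)%C) as [t [Ht ->]].
  + destruct (polar_exists (u - c) x) as [t [Ht E]]; [exact Hu|].
    exists t; split; [exact Ht|]; rewrite <- E; ring.
  + now apply H1.
Qed.

(** If a point u outside the disc had f u too close to f a, then 1 / (f v - f u) would be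
    holomorphic in v on the disc, by injectivity, and larger at the centre than on the circle of
    radius e / 2. *)
Lemma inverse_continuous (A : C -> Prop) (f : C -> C) (a : C) (e : R) : 0 < e ->
  hol A f -> injective_on A f -> (forall u, Cmod (u - a) < e -> A u) ->
  exists h, 0 < h /\ forall u, A u -> Cmod (f u - f a) < h -> Cmod (u - a) < e.
Proof.
intros He Hf Hi HA.
assert (Aa : A a) by (apply HA; rewrite Cmod_sub_self; exact He).
destruct (circle_min (fun u => f u - f a)%C a (e / 2)) as [m [Hm H]]; [lra| |].
{ intros u Hu; assert (Au : A u) by (apply HA; lra); split.
  - apply cdiff_cont, cdiff_minus; [now apply Hf|apply cdiff_const].
  - apply Cminus_neq0; intros E; apply Hi in E; try assumption.
    rewrite E, Cmod_sub_self in Hu; lra. }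
exists (m / 2); split; [lra|]; intros u Au Hu.
destruct (Rlt_le_dec (Cmod (u - a)) e) as [L|L]; [exact L|exfalso].
assert (Hne : forall v, Cmod (v - a) < e -> (f v - f u)%C <> 0%C).
{ intros v Hv; apply Cminus_neq0; intros E; apply Hi in E; [|now apply HA|exact Au].
  rewrite E in Hv; lra. }
assert (Hd : forall v, Cmod (v - a) < e -> cdiff (fun v => / (f v - f u))%C v).
{ intros v Hv; apply cdiff_inv; [|now apply Hne].
  apply cdiff_minus; [apply Hf, HA, Hv|apply cdiff_const]. }
assert (Hb : Cmod (/ (f a - f u)) <= 2 / m).
{ apply (max_modulus_disc (fun v => / (f v - f u))%C a (e / 2) e nil); try lra.
  - intros v Hv; now apply cdiff_cont, Hd.
  - intros v Hv _; now apply Hd.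
  - intros v Hv; rewrite Cmod_inv by (apply Hne; lra).
    specialize (H v Hv).
    assert (m / 2 <= Cmod (f v - f u)).
    { generalize (Cmod_sub_ge (f v - f a) (f u - f a)).
      replace (f v - f a - (f u - f a))%C with (f v - f u)%C by ring; lra. }
    replace (2 / m) with (/ (m / 2)) by (field; lra).
    apply Rinv_le_contravar; lra. }
rewrite Cmod_inv in Hb by (apply Hne; rewrite Cmod_sub_self; exact He).
revert Hb; apply Rlt_not_le; replace (2 / m) with (/ (m / 2)) by (field; lra).
rewrite Cmod_sub_sym in Hu.
assert (0 < Cmod (f a - f u)) by (apply Cmod_gt_0, Hne; rewrite Cmod_sub_self; exact He).
apply Rinv_lt_contravar; [apply Rmult_lt_0_compat; lra|exact Hu].
Qed.

(** * The kernel on the annulus *)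

(* [theta] truncates the infinite product of the Jacobi theta function to [N] factors on each side.
   The symmetry under inversion stays exact, the one under [x -> q / x] holds up to factors that
   tend to 1 with [q ^ N]; working with this error avoids infinite products. *)
Fixpoint qprod (q : R) (N : nat) (x : C) : C :=
  match N with
  | O => 1
  | S n => qprod q n x * (1 - RtoC (q ^ S n) * x)
  end.

(** [theta] without the factor that vanishes at 1. With it the zero at - s and the pole at z of the
    kernel can be split off as explicit linear factors. *)
Definition phi (q : R) (N : nat) (x : C) : C := (qprod q N x * qprod q N (/ x))%C.

Definition theta (q : R) (N : nat) (x : C) : C := ((1 - x) * phi q N x)%C.

Lemma one_minus_neq0 (x : C) : Cmod x < 1 -> (1 - x)%C <> 0%C.
Proof. intros H; apply Cminus_neq0; intros <-; rewrite Cmod_1 in H; lra. Qed.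

Lemma Cmod_neq0 (x : C) : 0 < Cmod x -> x <> 0%C.
Proof. apply Cmod_gt_0. Qed.

Lemma pow_le_self q n : 0 <= q <= 1 -> q ^ S n <= q.
Proof.
intros Hq; rewrite <- (Rmult_1_r q) at 2; simpl; apply Rmult_le_compat_l; [lra|].
rewrite <- (pow1 n); apply pow_incr; lra.
Qed.

Lemma qprod_neq0 (q : R) (N : nat) (x : C) : 0 < q < 1 -> q * Cmod x < 1 -> qprod q N x <> 0%C.
Proof.
intros Hq Hx; induction N as [|n IH]; cbn [qprod]; [apply C1_nz|].
apply Cmult_neq_0; [exact IH|]; apply one_minus_neq0.
rewrite Cmod_mult, Cmod_R, Rabs_pos_eq by (apply pow_le; lra).
eapply Rle_lt_trans; [|exact Hx]; apply Rmult_le_compat_r; [apply Cmod_ge_0|].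
apply pow_le_self; lra.
Qed.

Lemma qprod_cdiff (q : R) (N : nat) (x : C) : cdiff (qprod q N) x.
Proof.
induction N as [|n IH]; cbn [qprod]; [apply cdiff_const|].
apply cdiff_mult; [exact IH|]; apply cdiff_minus; [apply cdiff_const|].
apply cdiff_mult; [apply cdiff_const|apply cdiff_id].
Qed.

Lemma qprod_conj (q : R) (N : nat) (x : C) : Cconj (qprod q N x) = qprod q N (Cconj x).
Proof.
induction N as [|n IH]; [unfold Cconj; simpl; unfold RtoC; f_equal; ring|].
change (Cconj (qprod q n x * (1 - RtoC (q ^ S n) * x)) = (qprod q n (Cconj x) * (1 - RtoC (q ^ S n) * Cconj x)))%C.
rewrite Cmult_conj, Cminus_conj, Cmult_conj, IH.
replace (Cconj 1) with (RtoC 1) by (unfold Cconj, RtoC; simpl; f_equal; ring).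
replace (Cconj (RtoC (q ^ S n))) with (RtoC (q ^ S n)) by (unfold Cconj, RtoC; simpl; f_equal; ring).
reflexivity.
Qed.

Lemma qprod_shift (q : R) (N : nat) (x : C) :
  (qprod q N x * (1 - RtoC (q ^ S N) * x) = (1 - RtoC q * x) * qprod q N (RtoC q * x))%C.
Proof.
induction N as [|n IH]; [simpl; rewrite Rmult_1_r; ring|].
change (qprod q (S n) x) with (qprod q n x * (1 - RtoC (q ^ S n) * x))%C.
change (qprod q (S n) (RtoC q * x)%C) with (qprod q n (RtoC q * x) * (1 - RtoC (q ^ S n) * (RtoC q * x)))%C.
rewrite IH; replace (RtoC (q ^ S (S n))) with (RtoC (q ^ S n) * RtoC q)%C; [ring|].
rewrite <- RtoC_mult; f_equal; simpl; ring.
Qed.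

Lemma phi_neq0 (q : R) (N : nat) (x : C) : 0 < q < 1 -> q < Cmod x -> q * Cmod x < 1 -> phi q N x <> 0%C.
Proof.
intros Hq H1 H2; assert (x <> 0%C) by (apply Cmod_neq0; lra).
apply Cmult_neq_0; apply qprod_neq0; try assumption.
rewrite Cmod_inv by assumption.
apply Rmult_lt_reg_r with (Cmod x); [lra|]; rewrite Rmult_assoc, Rinv_l; lra.
Qed.

Lemma theta_neq0 (q : R) (N : nat) (x : C) : 0 < q < 1 -> q < Cmod x -> q * Cmod x < 1 -> Cmod x <> 1 -> theta q N x <> 0%C.
Proof.
intros Hq H1 H2 H3; apply Cmult_neq_0; [|now apply phi_neq0].
apply Cminus_neq0; intros <-; apply H3, Cmod_1.
Qed.

Lemma phi_cdiff (q : R) (N : nat) (x : C) : x <> 0%C -> cdiff (phi q N) x.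
Proof.
intros Hx; apply cdiff_mult; [apply qprod_cdiff|].
apply (cdiff_comp (qprod q N) Cinv); [|apply qprod_cdiff].
apply (cdiff_inv (fun y => y)); [apply cdiff_id|exact Hx].
Qed.

Lemma theta_cdiff (q : R) (N : nat) (x : C) : x <> 0%C -> cdiff (theta q N) x.
Proof.
intros Hx; apply cdiff_mult; [|now apply phi_cdiff].
apply cdiff_minus; [apply cdiff_const|apply cdiff_id].
Qed.

Lemma Cinv_inv (x : C) : x <> 0%C -> (/ / x)%C = x.
Proof. intros H; field; exact H. Qed.

Lemma theta_inv (q : R) (N : nat) (x : C) : x <> 0%C -> (theta q N (/ x) = - theta q N x / x)%C.
Proof. intros H; unfold theta, phi; rewrite Cinv_inv by exact H; field; exact H. Qed.

Lemma theta_conj (q : R) (N : nat) (x : C) : x <> 0%C -> Cconj (theta q N x) = theta q N (Cconj x).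
Proof.
intros H; unfold theta, phi; rewrite 2!Cmult_conj, 2!qprod_conj, Cminus_conj, Cinv_conj by exact H.
do 2 f_equal; unfold Cconj, RtoC; simpl; f_equal; ring.
Qed.

(** Replacing x by q / x shifts the product in x by one place in one direction and the product in 1
    / x in the other. Truncation leaves one end factor on each side, close to 1 when q^N is
    small. *)
Lemma theta_reflect (q : R) (N : nat) (x : C) : q <> 0 -> x <> 0%C ->
  (theta q N (RtoC q / x) * (1 - RtoC (q ^ N) * x) = theta q N x * (1 - RtoC (q ^ S N) / x))%C.
Proof.
intros Hq Hx; assert (Hq' : RtoC q <> 0%C) by (intros E; apply Hq, RtoC_inj, E).
unfold theta, phi.
assert (E1 := qprod_shift q N (/ x)); assert (E2 := qprod_shift q N (x / RtoC q)%C).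
replace (RtoC q * (x / RtoC q))%C with x in E2 by (field; exact Hq').
replace (RtoC (q ^ S N) * (x / RtoC q))%C with (RtoC (q ^ N) * x)%C in E2
  by (simpl; rewrite RtoC_mult; field; exact Hq').
replace (/ (RtoC q / x))%C with (x / RtoC q)%C by (field; tauto).
replace (RtoC q / x)%C with (RtoC q * / x)%C by reflexivity.
replace (RtoC (q ^ S N) / x)%C with (RtoC (q ^ S N) * / x)%C by reflexivity.
transitivity (((1 - RtoC q * / x) * qprod q N (RtoC q * / x)) * (qprod q N (x / RtoC q) * (1 - RtoC (q ^ N) * x)))%C;
  [ring|rewrite <- E1, E2; ring].
Qed.

(** * Integrals against nearly positive functions *)

Lemma CInt_RtoC f a b : CInt (fun t => RtoC (f t)) a b = RtoC (RInt f a b).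
Proof.
unfold CInt, RtoC; simpl; f_equal.
rewrite RInt_const; unfold scal; simpl; unfold mult; simpl; ring.
Qed.

(* If [v1] is nearly negative and [v2] nearly positive, no cancellation can occur between them,
   so a multiplier [k] of both is controlled by the bound on [u1] and [u2]. *)
Lemma multiplier_bound (u1 u2 v1 v2 : R -> C) (k : C) (B e a b : R) :
  a < b -> 0 <= B -> 0 <= e ->
  rcont_on u1 a b -> rcont_on u2 a b -> rcont_on v1 a b -> rcont_on v2 a b ->
  (forall t, a <= t <= b -> v1 t <> 0%C) ->
  (forall t, a <= t <= b -> Cmod (v1 t + RtoC (Cmod (v1 t))) <= e * Cmod (v1 t)) ->
  (forall t, a <= t <= b -> Cmod (v2 t - RtoC (Cmod (v2 t))) <= e * Cmod (v2 t)) ->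
  (forall t, a <= t <= b -> Cmod (u1 t) <= B * Cmod (v1 t)) ->
  (forall t, a <= t <= b -> Cmod (u2 t) <= B * Cmod (v2 t)) ->
  CInt (fun t => u1 t - k * v1 t)%C a b = CInt (fun t => u2 t - k * v2 t)%C a b ->
  Cmod k * (1 - e) <= B.
Proof.
intros Hab HB He Cu1 Cu2 Cv1 Cv2 Nv1 S1 S2 B1 B2 E.
assert (Hab' : a <= b) by lra.
assert (Ck1 : rcont_on (fun t => k * v1 t)%C a b) by (intros t Ht; apply rcont_scal, Cv1, Ht).
assert (Ck2 : rcont_on (fun t => k * v2 t)%C a b) by (intros t Ht; apply rcont_scal, Cv2, Ht).
rewrite 2!CInt_minus, 2!CInt_scal in E by assumption.
assert (Xm : forall v, rcont_on v a b -> forall t, a <= t <= b -> continuous (fun t => Cmod (v t)) t).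
{ intros v Hv t Ht; apply rcont_Cmod, Hv, Ht. }
assert (Xi : forall v, rcont_on v a b -> ex_RInt (fun t => Cmod (v t)) a b).
{ intros v Hv; apply (ex_RInt_continuous (V := R_CompleteNormedModule)).
  intros t; rewrite Rmin_left, Rmax_right by exact Hab'; now apply Xm. }
set (m1 := RInt (fun t => Cmod (v1 t)) a b); set (m2 := RInt (fun t => Cmod (v2 t)) a b).
assert (M1 : 0 < m1).
{ apply RInt_gt_0; [exact Hab| |intros t Ht; now apply Xm].
  intros t Ht; apply Cmod_gt_0, Nv1; lra. }
assert (M2 : 0 <= m2).
{ apply RInt_ge_0; [exact Hab'|now apply Xi|]; intros; apply Cmod_ge_0. }
assert (Sc : forall c v, rcont_on v a b -> ex_RInt (fun t => c * Cmod (v t)) a b /\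
  RInt (fun t => c * Cmod (v t)) a b = c * RInt (fun t => Cmod (v t)) a b).
{ intros c v Hv; split.
  - apply (ex_RInt_scal (V := R_NormedModule)); now apply Xi.
  - apply (RInt_scal (V := R_CompleteNormedModule)); now apply Xi. }
assert (I1 : Cmod (CInt u1 a b) <= B * m1).
{ destruct (Sc B v1 Cv1) as [X Y]; unfold m1; rewrite <- Y; now apply CInt_le. }
assert (I2 : Cmod (CInt u2 a b) <= B * m2).
{ destruct (Sc B v2 Cv2) as [X Y]; unfold m2; rewrite <- Y; now apply CInt_le. }
assert (Cm : forall v, rcont_on v a b -> rcont_on (fun t => RtoC (Cmod (v t))) a b).
{ intros v Hv t Ht; apply (rcont_pair (fun t => Cmod (v t)) (fun _ => 0)); [now apply Xm|apply continuous_const]. }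
assert (I3 : Cmod (CInt v1 a b + RtoC m1) <= e * m1).
{ destruct (Sc e v1 Cv1) as [X Y]; unfold m1; rewrite <- CInt_RtoC, <- Y, <- CInt_plus; auto.
  apply CInt_le; auto; intros t Ht; apply rcont_plus; [now apply Cv1|now apply Cm]. }
assert (I4 : Cmod (CInt v2 a b - RtoC m2) <= e * m2).
{ destruct (Sc e v2 Cv2) as [X Y]; unfold m2; rewrite <- CInt_RtoC, <- Y, <- CInt_minus; auto.
  apply CInt_le; auto; intros t Ht; apply rcont_minus; [now apply Cv2|now apply Cm]. }
set (J1 := CInt v1 a b) in *; set (J2 := CInt v2 a b) in *.
set (L1 := CInt u1 a b) in *; set (L2 := CInt u2 a b) in *.
(* J1 is close to - m1 and J2 to m2, so their moduli add up in J1 - J2. The equality of the two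
   integrals reads k (J1 - J2) = L1 - L2. *)
assert (F1 : (1 - e) * (m1 + m2) <= Cmod (J1 - J2)).
{ assert (H := Cmod_sub_ge (RtoC (m1 + m2)) (J1 + RtoC m1 - (J2 - RtoC m2))).
  replace (RtoC (m1 + m2) - (J1 + RtoC m1 - (J2 - RtoC m2)))%C with (- (J1 - J2))%C in H
    by (rewrite RtoC_plus; ring).
  rewrite Cmod_opp, Cmod_R, Rabs_pos_eq in H by lra.
  assert (H' := Cmod_sub_le (J1 + RtoC m1) (J2 - RtoC m2)); lra. }
assert (F2 : Cmod k * Cmod (J1 - J2) <= B * (m1 + m2)).
{ rewrite <- Cmod_mult; replace (k * (J1 - J2))%C with (L1 - L2)%C.
  - eapply Rle_trans; [apply Cmod_sub_le|]; lra.
  - replace L1 with (L1 - k * J1 + k * J1)%C by ring; rewrite E; ring. }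
apply Rmult_le_reg_r with (m1 + m2); [lra|].
assert (Hk := Cmod_ge_0 k).
eapply Rle_trans; [|exact F2]; rewrite Rmult_assoc; now apply Rmult_le_compat_l.
Qed.

(** Converts a relative error of a nonnegative quantity into a distance from the positive ray. The
    factor 1 - e stands for the lower bound of Cmod d and makes the claim trivial for e >= 1. *)
Lemma nearly_positive (n : R) (d : C) (e : R) : 0 <= n -> 0 <= e -> Cmod (d - 1) <= e ->
  Cmod (RtoC n * d - RtoC (Cmod (RtoC n * d))) * (1 - e) <= 2 * e * Cmod (RtoC n * d).
Proof.
intros Hn He Hd; rewrite Cmod_mult, (Cmod_R n), (Rabs_pos_eq n) by exact Hn.
rewrite RtoC_mult; replace (RtoC n * d - RtoC n * RtoC (Cmod d))%C with (RtoC n * (d - RtoC (Cmod d)))%C by ring.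
rewrite Cmod_mult, Cmod_R, Rabs_pos_eq by exact Hn.
assert (H1 := Cmod_sub_ge 1 d); assert (H2 := Cmod_sub_ge d 1); rewrite Cmod_1 in H1, H2.
rewrite Cmod_sub_sym in H1.
assert (H3 : Cmod (d - RtoC (Cmod d)) <= 2 * e).
{ replace (d - RtoC (Cmod d))%C with ((d - 1) + RtoC (1 - Cmod d))%C by (rewrite RtoC_minus; ring).
  eapply Rle_trans; [apply Cmod_triangle|]; rewrite Cmod_R.
  assert (Rabs (1 - Cmod d) <= e) by (apply Rabs_le; lra); lra. }
assert (H4 := Cmod_ge_0 (d - RtoC (Cmod d))); assert (H5 := Cmod_ge_0 d).
destruct (Rle_lt_dec 1 e) as [L|L].
- apply Rle_trans with 0; [|repeat apply Rmult_le_pos; lra].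
  assert (0 <= n * Cmod (d - RtoC (Cmod d))) by (now apply Rmult_le_pos); nra.
- rewrite Rmult_assoc; replace (2 * e * (n * Cmod d)) with (n * (2 * e * Cmod d)) by ring.
  apply Rmult_le_compat_l; [exact Hn|]; apply Rmult_le_compat; lra.
Qed.

Lemma ratio_near_1 (a b c d : C) (m : R) : m <= 1 / 40 ->
  Cmod a <= m -> Cmod b <= m -> Cmod c <= m -> Cmod d <= m ->
  Cmod (((1 - a) * (1 - b)) / ((1 - c) * (1 - d)) - 1) <= 5 * m.
Proof.
intros Hm Ha Hb Hc Hd.
assert (Hc' : (1 - c)%C <> 0%C) by (apply one_minus_neq0; lra).
assert (Hd' : (1 - d)%C <> 0%C) by (apply one_minus_neq0; lra).
assert (H := Cmult_neq_0 _ _ Hc' Hd').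
replace (((1 - a) * (1 - b)) / ((1 - c) * (1 - d)) - 1)%C
  with ((a * b - a - b - (c * d - c - d)) / ((1 - c) * (1 - d)))%C by (field; tauto).
rewrite Cmod_div, Cmod_mult by exact H.
assert (1 - m <= Cmod (1 - c)) by (generalize (Cmod_sub_ge 1 c); rewrite Cmod_1; lra).
assert (1 - m <= Cmod (1 - d)) by (generalize (Cmod_sub_ge 1 d); rewrite Cmod_1; lra).
assert (Hn : forall x y, Cmod x <= m -> Cmod y <= m -> Cmod (x * y - x - y) <= m * m + 2 * m).
{ intros x y Hx Hy; eapply Rle_trans; [apply Cmod_sub_le|].
  assert (Cmod (x * y - x) <= m * m + m); [|lra].
  eapply Rle_trans; [apply Cmod_sub_le|]; rewrite Cmod_mult.
  apply Rplus_le_compat; [apply Rmult_le_compat; auto using Cmod_ge_0|exact Hx]. }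
assert (N1 := Hn a b Ha Hb); assert (N2 := Hn c d Hc Hd).
assert (Hm0 := Cmod_ge_0 a).
assert (D : 9 / 10 <= Cmod (1 - c) * Cmod (1 - d)) by nra.
apply Rmult_le_reg_r with (Cmod (1 - c) * Cmod (1 - d)); [lra|].
unfold Rdiv; rewrite Rmult_assoc, Rinv_l, Rmult_1_r by lra.
eapply Rle_trans; [apply Cmod_sub_le|]; nra.
Qed.

(** * Reflection of [theta] in the boundary circles *)

Lemma RtoC_neq0 (x : R) : x <> 0 -> RtoC x <> 0%C.
Proof. intros H E; apply H, RtoC_inj, E. Qed.

Lemma Cconj_R (x : R) : Cconj (RtoC x) = RtoC x.
Proof. unfold Cconj, RtoC; simpl; f_equal; ring. Qed.

Lemma Cconj_unit (u : C) : Cmod u = 1 -> Cconj u = (/ u)%C.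
Proof.
intros H; assert (u <> 0%C) by (apply Cmod_neq0; lra).
assert (E := Cmod2_conj u); rewrite H in E.
replace (Cconj u) with (u * Cconj u / u)%C by (field; assumption).
rewrite <- E; replace (1 ^ 2) with 1 by ring; field; assumption.
Qed.

(** On |u| = 1 the conjugate of u is 1 / u, so the inversion symmetry of [theta] becomes a
    reflection. It pairs the factors of the kernel into squared moduli. *)
Lemma theta_unit_circle (q : R) (N : nat) (c : R) (u : C) : c <> 0 -> Cmod u = 1 ->
  (theta q N (RtoC c * u) = - (RtoC c * u) * Cconj (theta q N (RtoC (/ c) * u)))%C.
Proof.
intros Hc Hu; assert (Hu0 : u <> 0%C) by (apply Cmod_neq0; lra).
assert (Hc0 := RtoC_neq0 c Hc).
assert (Hi0 := RtoC_neq0 (/ c) (Rinv_neq_0_compat c Hc)).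
rewrite theta_conj by now apply Cmult_neq_0.
rewrite Cmult_conj, Cconj_R, Cconj_unit, RtoC_inv by assumption.
replace (/ RtoC c * / u)%C with (/ (RtoC c * u))%C by (field; tauto).
rewrite theta_inv by now apply Cmult_neq_0.
field; tauto.
Qed.

(** On |u| = x with x^2 = q the point u equals q / conj(u), so [theta_reflect] takes the place of
    the inversion, and the last quotient is its truncation error. For N = 0 the denominator of this
    quotient may vanish. *)
Lemma theta_inner_circle (q : R) (N : nat) (c x : R) (u : C) : 0 < q < 1 -> c <> 0 -> 0 < x -> x * x = q ->
  Cmod u = x -> q * Cmod (RtoC c * u) < 1 ->
  (theta q N (RtoC (/ c) * u) = Cconj (theta q N (RtoC c * u)) *
    ((1 - RtoC (q ^ S N) / Cconj (RtoC c * u)) / (1 - RtoC (q ^ N) * Cconj (RtoC c * u))))%C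
  \/ N = O.
Proof.
intros Hq Hc Hx Hxq Hu Hcu; destruct N as [|n]; [now right|left].
assert (Hu0 : u <> 0%C) by (apply Cmod_neq0; lra).
assert (Hc0 := RtoC_neq0 c Hc).
assert (Hcu0 := Cmult_neq_0 _ _ Hc0 Hu0).
assert (Hy0 : Cconj (RtoC c * u) <> 0%C).
{ apply Cmod_neq0; rewrite Cmod_conj; now apply Cmod_gt_0. }
rewrite theta_conj by exact Hcu0.
assert (R := theta_reflect q (S n) (Cconj (RtoC c * u)) ltac:(lra) Hy0).
assert (D : (1 - RtoC (q ^ S n) * Cconj (RtoC c * u))%C <> 0%C).
{ apply one_minus_neq0; rewrite Cmod_mult, Cmod_conj, Cmod_R, Rabs_pos_eq by (apply pow_le; lra).
  eapply Rle_lt_trans; [|exact Hcu]; apply Rmult_le_compat_r; [apply Cmod_ge_0|apply pow_le_self; lra]. }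
replace (RtoC (/ c) * u)%C with (RtoC q / Cconj (RtoC c * u))%C.
- set (y := Cconj (RtoC c * u)) in *.
  set (k := RtoC (q ^ S n)) in *; set (k' := RtoC (q ^ S (S n))) in *.
  transitivity (theta q (S n) (RtoC q / y) * (1 - k * y) / (1 - k * y))%C; [field; exact D|].
  rewrite R; field; tauto.
- rewrite Cmult_conj, Cconj_R, RtoC_inv by exact Hc.
  assert (E := Cmod2_conj u); rewrite Hu in E; replace (x ^ 2) with q in E by (simpl; lra).
  assert (Cconj u <> 0%C) by (apply Cmod_neq0; rewrite Cmod_conj; lra).
  rewrite E; field; tauto.
Qed.

(* On the annulus [s^2 < |u| < 1], [kern] times [du / u] is nearly a real measure on the boundary,
   negative on the outer circle and positive on the inner one, with a pole at [z] and a zero at [- s]. *)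
Definition kern (s z : R) (N : nat) (u : C) : C :=
  (theta (s ^ 4) N (RtoC (- / s) * u) * theta (s ^ 4) N (RtoC (- s) * u) /
   (theta (s ^ 4) N (RtoC (/ z) * u) * theta (s ^ 4) N (RtoC z * u)))%C.

Section Kernel.
Variables (s z : R) (N : nat).
Hypothesis Hs : 0 < s < 1.
Hypothesis Hz : s * s < z < 1.
Let q := s ^ 4.
Let m := q ^ N.

Lemma q_bounds : 0 < q < 1 /\ q = (s * s) * (s * s) /\ q < s * s * s /\ s * s * s < s * s /\ s * s < s.
Proof.
assert (0 < s * s < s) by nra; assert (0 < s * s * s < s * s) by nra.
assert (E : q = s * (s * s * s)) by (unfold q; ring).
assert (0 < q < s * s * s) by (rewrite E; nra); repeat split; lra || assumption.
Qed.

Lemma theta_scaled_neq0 (c : R) (u : C) : 0 < Cmod u ->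
  q < Rabs c * Cmod u -> q * (Rabs c * Cmod u) < 1 -> Rabs c * Cmod u <> 1 ->
  theta q N (RtoC c * u)%C <> 0%C.
Proof.
intros Hu H1 H2 H3; apply theta_neq0; [apply q_bounds|..]; rewrite Cmod_mult, Cmod_R; assumption.
Qed.

Lemma abs_consts : Rabs (- / s) = / s /\ Rabs (- s) = s /\ Rabs (/ z) = / z /\ Rabs z = z.
Proof.
assert (0 < z) by nra; assert (0 < / s) by (apply Rinv_0_lt_compat; lra).
assert (0 < / z) by (apply Rinv_0_lt_compat; lra).
rewrite 2!Rabs_Ropp, !Rabs_pos_eq by lra; tauto.
Qed.

Lemma kern_factors_neq0 (u : C) : Cmod u = 1 \/ Cmod u = s * s ->
  theta q N (RtoC (- / s) * u)%C <> 0%C /\ theta q N (RtoC (- s) * u)%C <> 0%C /\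
  theta q N (RtoC (/ z) * u)%C <> 0%C /\ theta q N (RtoC z * u)%C <> 0%C.
Proof.
intros Hu; destruct q_bounds as [Q1 [Q2 [Q3 [Q4 Q5]]]]; destruct abs_consts as [A1 [A2 [A3 A4]]].
assert (Iz : 1 < / z) by (apply inv_gt1; lra).
assert (Es : / s * (s * s) = s) by (field; lra).
assert (Iz2 : / z < / (s * s)) by (apply Rinv_lt_contravar; nra).
assert (Qz : q * / z < s * s).
{ apply Rlt_le_trans with (q * / (s * s)); [apply Rmult_lt_compat_l; lra|].
  rewrite Q2; right; field; lra. }
assert (Ez : / z * (s * s) < 1).
{ apply Rmult_lt_reg_r with z; [lra|]; replace (/ z * (s * s) * z) with (s * s) by (field; lra); lra. }
assert (Q7 : 0 < z * (s * s) < 1) by nra.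
repeat split; apply theta_scaled_neq0; rewrite ?A1, ?A2, ?A3, ?A4;
  destruct Hu as [-> | ->]; rewrite ?Rmult_1_r, ?Es; try nra.
Qed.

(** [theta_unit_circle] pairs - / s with - s and / z with z exactly. The factors s u and - z u left
    over have quotient - s / z, which gives the negative sign. *)
Lemma kern_outer (u : C) : Cmod u = 1 ->
  kern s z N u <> 0%C /\ (kern s z N u + RtoC (Cmod (kern s z N u)) = 0)%C.
Proof.
intros Hu; destruct (kern_factors_neq0 u (or_introl Hu)) as [T1 [T2 [T3 T4]]].
assert (Z0 : 0 < z) by nra.
assert (Hu0 : u <> 0%C) by (apply Cmod_neq0; lra).
split.
{ unfold kern; apply Cmult_neq_0; [now apply Cmult_neq_0|].
  apply Cmod_neq0; rewrite Cmod_inv by now apply Cmult_neq_0.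
  apply Rinv_0_lt_compat, Cmod_gt_0; now apply Cmult_neq_0. }
set (n := (s / z) * (Cmod (theta q N (RtoC (- / s) * u)%C) ^ 2 / Cmod (theta q N (RtoC (/ z) * u)%C) ^ 2)).
assert (P1 := proj1 (Cmod_gt_0 _) T1); assert (P3 := proj1 (Cmod_gt_0 _) T3).
assert (E : kern s z N u = RtoC (- n)).
{ unfold kern; fold q.
  rewrite (theta_unit_circle q N (- s) u) by (assumption || lra).
  rewrite (theta_unit_circle q N z u) by (assumption || lra).
  replace (/ - s) with (- / s) by (field; lra).
  set (T := theta q N (RtoC (- / s) * u)%C) in *; set (V := theta q N (RtoC (/ z) * u)%C) in *.
  unfold n; rewrite (RtoC_opp (_ * _)), RtoC_mult, 2!RtoC_div, 2!Cmod2_conj, RtoC_opp by (try apply pow_nonzero; lra).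
  assert (Cconj V <> 0%C) by (apply Cmod_neq0; rewrite Cmod_conj; lra).
  assert (Hz0 := RtoC_neq0 z ltac:(lra)).
  field; tauto. }
assert (Hn : 0 <= n).
{ unfold n; apply Rmult_le_pos; apply Rlt_le, Rdiv_lt_0_compat; try lra; apply pow_lt; assumption. }
rewrite E, Cmod_R, Rabs_Ropp, Rabs_pos_eq, RtoC_opp by exact Hn; ring.
Qed.

(** The pairing by u = q / conj(u) leaves no sign, so the kernel is a positive number times a
    truncation factor. That factor is within 5 m of 1, and 10 m / (1 - 5 m) <= 12 m for m <= 1 /
    40. *)
Lemma kern_inner (u : C) : m <= 1 / 40 -> Cmod u = s * s ->
  Cmod (kern s z N u - RtoC (Cmod (kern s z N u))) <= 12 * m * Cmod (kern s z N u).
Proof.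
intros Hm Hu; destruct (kern_factors_neq0 u (or_intror Hu)) as [T1 [T2 [T3 T4]]].
destruct q_bounds as [Q1 [Q2 [Q3 [Q4 Q5]]]]; destruct abs_consts as [A1 [A2 [A3 A4]]].
assert (N0 : N <> O) by (intros E; revert Hm; unfold m; rewrite E; simpl; lra).
assert (Hm0 : 0 < m) by (apply pow_lt; lra).
assert (Y1 : Cmod (RtoC (- / s) * u) = s).
{ rewrite Cmod_mult, Cmod_R, A1, Hu; field; lra. }
assert (Y2 : Cmod (RtoC (/ z) * u) = s * s / z).
{ rewrite Cmod_mult, Cmod_R, A3, Hu; field; lra. }
assert (Y3 : s * s < s * s / z < 1).
{ split; apply Rmult_lt_reg_r with z; try lra; replace (s * s / z * z) with (s * s) by (field; lra); nra. }
destruct (theta_inner_circle q N (- / s) (s * s) u) as [E1|E1]; try lra; try contradiction; try nra.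
{ apply Rlt_not_eq; assert (0 < / s) by (apply Rinv_0_lt_compat; lra); lra. }
destruct (theta_inner_circle q N (/ z) (s * s) u) as [E2|E2]; try lra; try contradiction; try nra.
replace (/ - / s) with (- s) in E1 by (field; lra); rewrite Rinv_inv in E2.
set (y1 := Cconj (RtoC (- / s) * u)) in *; set (y2 := Cconj (RtoC (/ z) * u)) in *.
assert (X1 : Cmod y1 = s) by (unfold y1; rewrite Cmod_conj; exact Y1).
assert (X2 : Cmod y2 = s * s / z) by (unfold y2; rewrite Cmod_conj; exact Y2).
assert (NY1 : y1 <> 0%C) by (apply Cmod_neq0; lra).
assert (NY2 : y2 <> 0%C) by (apply Cmod_neq0; nra).
set (a := (RtoC (q ^ S N) / y1)%C) in *; set (b := (RtoC (q ^ N) * y1)%C) in *.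
set (c := (RtoC (q ^ S N) / y2)%C) in *; set (d := (RtoC (q ^ N) * y2)%C) in *.
assert (Qn : q ^ S N = q * m) by reflexivity.
assert (Ha : Cmod a <= m).
{ unfold a; rewrite Cmod_div, Cmod_R, X1, Qn, Rabs_pos_eq by (assumption || nra).
  apply Rmult_le_reg_r with s; [lra|]; unfold Rdiv; rewrite Rmult_assoc, Rinv_l by lra; nra. }
assert (Hb : Cmod b <= m).
{ unfold b; rewrite Cmod_mult, Cmod_R, X1; fold m; rewrite Rabs_pos_eq by lra; nra. }
assert (Hd : Cmod d <= m).
{ unfold d; rewrite Cmod_mult, Cmod_R, X2; fold m; rewrite Rabs_pos_eq by lra; nra. }
assert (Hc : Cmod c <= m).
{ unfold c; rewrite Cmod_div, Cmod_R, X2, Qn, Rabs_pos_eq by (assumption || nra).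
  apply Rmult_le_reg_r with (s * s / z); [nra|]; unfold Rdiv at 1; rewrite Rmult_assoc, Rinv_l by nra; nra. }
set (n := Cmod (theta q N (RtoC (- / s) * u)%C) ^ 2 / Cmod (theta q N (RtoC (/ z) * u)%C) ^ 2).
assert (P1 := proj1 (Cmod_gt_0 _) T1); assert (P3 := proj1 (Cmod_gt_0 _) T3).
assert (NB : (1 - b)%C <> 0%C) by (apply one_minus_neq0; lra).
assert (NC : (1 - c)%C <> 0%C) by (apply one_minus_neq0; lra).
assert (ND : (1 - d)%C <> 0%C) by (apply one_minus_neq0; lra).
assert (E : kern s z N u = (RtoC n * (((1 - a) * (1 - d)) / ((1 - b) * (1 - c))))%C).
{ unfold kern; fold q; rewrite E1, E2.
  set (T := theta q N (RtoC (- / s) * u)%C) in *; set (V := theta q N (RtoC (/ z) * u)%C) in *.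
  unfold n; rewrite RtoC_div, 2!Cmod2_conj by (apply pow_nonzero; lra).
  assert (Cconj V <> 0%C) by (apply Cmod_neq0; rewrite Cmod_conj; lra).
  field; tauto. }
assert (Hn : 0 <= n).
{ unfold n; apply Rlt_le, Rdiv_lt_0_compat; apply pow_lt; assumption. }
rewrite E; set (dl := (((1 - a) * (1 - d)) / ((1 - b) * (1 - c)))%C).
assert (Hdl := ratio_near_1 a d b c m Hm Ha Hd Hb Hc); fold dl in Hdl.
assert (NP := nearly_positive n dl (5 * m) Hn ltac:(lra) Hdl).
set (X := Cmod (RtoC n * dl - RtoC (Cmod (RtoC n * dl)))) in *.
assert (0 <= Cmod (RtoC n * dl)) by apply Cmod_ge_0.
set (Y := Cmod (RtoC n * dl)) in *.
assert (0 <= m * Y) by nra; nra.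
Qed.
End Kernel.

(** * The duality estimate *)

Lemma cdiff_scale (c : R) (u : C) : cdiff (fun y => RtoC c * y)%C u.
Proof. apply cdiff_mult; [apply cdiff_const|apply cdiff_id]. Qed.

Lemma theta_scale_cdiff (q : R) (N : nat) (c : R) (u : C) : c <> 0 -> u <> 0%C ->
  cdiff (fun y => theta q N (RtoC c * y)%C) u.
Proof.
intros Hc Hu; apply (cdiff_comp (theta q N) (fun y => RtoC c * y)%C); [apply cdiff_scale|].
apply theta_cdiff, Cmult_neq_0; [now apply RtoC_neq0|exact Hu].
Qed.

Lemma phi_scale_cdiff (q : R) (N : nat) (c : R) (u : C) : c <> 0 -> u <> 0%C ->
  cdiff (fun y => phi q N (RtoC c * y)%C) u.
Proof.
intros Hc Hu; apply (cdiff_comp (phi q N) (fun y => RtoC c * y)%C); [apply cdiff_scale|].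
apply phi_cdiff, Cmult_neq_0; [now apply RtoC_neq0|exact Hu].
Qed.

(* [P / (1 + u / s)] may have a pole at [- s], since the kernel vanishes there. The point [- x0] is
   the puncture, where [P] is only known to be bounded. *)
Section KernelMaxPrinciple.
Variables (s z : R) (N : nat) (P : C -> C) (S : list C) (x0 a b B : R).
Hypothesis Hs : 0 < s < 1.
Hypothesis Hz : s * s < z < 1.
Hypothesis Hx0 : s * s < x0 < 1.
Hypothesis Hab : 0 <= a < s * s /\ 1 < b.
Hypothesis HN : (s ^ 4) ^ N <= 1 / 40.
Hypothesis HB : 0 <= B.
Hypothesis Pc : forall u, a < Cmod u < b -> u <> RtoC (- x0) -> cont_at P u.
Hypothesis Pd : forall u, a < Cmod u < b -> u <> RtoC (- x0) -> ~ In u S -> cdiff P u.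
Hypothesis Pz : cdiff P (RtoC z).
Hypothesis Pb : exists d B', 0 < d /\ forall u, Cmod (u - RtoC (- x0)) < d -> Cmod (P u) <= B'.
Hypothesis PB : forall u, Cmod u = 1 \/ Cmod u = s * s -> Cmod (P u) <= B * Cmod (1 + RtoC (/ s) * u).
Let q := s ^ 4.

(** On the boundary circles [kern] is (1 + u / s) W / (u - z). Hence the slope of [U] times [W] is
    the kernel times P / (1 + u / s) - k, written without the pole at z and without the division by
    1 + u / s. *)
Let k : C := (P (RtoC z) / (1 + RtoC (/ s) * RtoC z))%C.
Let U : C -> C := fun u => (P u - k * (1 + RtoC (/ s) * u))%C.
Let W : C -> C := fun u => (- RtoC z * (phi q N (RtoC (- / s) * u) * theta q N (RtoC (- s) * u)) /
   (phi q N (RtoC (/ z) * u) * theta q N (RtoC z * u)))%C.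
Let G : C -> C := fun u => (slope U (RtoC z) u * W u)%C.
(** The zeros of the denominator of [W] nearest to the closed annulus are q / z and 1 / z; between
    these radii [W] is holomorphic. *)
Let a' := Rmax a (q / z).
Let b' := Rmin b (/ z).

Lemma kern_consts : 0 < z /\ 0 < q < 1 /\ q < s * s /\ 1 < / z /\ 1 < / s /\ q / z < s * s /\
  0 <= a' /\ a' < s * s /\ 1 < b'.
Proof.
destruct (q_bounds s Hs) as [Q1 [Q2 [Q3 [Q4 Q5]]]]; fold q in Q1, Q2, Q3.
assert (Iz : 1 < / z) by (apply inv_gt1; lra).
assert (Is : 1 < / s) by (apply inv_gt1; lra).
assert (Qz : q / z < s * s).
{ apply Rmult_lt_reg_r with z; [lra|]; unfold Rdiv; rewrite Rmult_assoc, Rinv_l by lra; nra. }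
assert (A1 : a' < s * s) by (apply Rmax_lub_lt; lra).
assert (A2 : a <= a') by apply Rmax_l.
assert (A3 : 1 < b') by (apply Rmin_glb_lt; lra).
repeat split; try lra; assumption.
Qed.

Lemma pole_factor_neq0 : (1 + RtoC (/ s) * RtoC z)%C <> 0%C.
Proof.
destruct kern_consts as [Z0 [_ [_ [_ [Is _]]]]].
rewrite <- RtoC_mult, <- RtoC_plus; apply RtoC_neq0; nra.
Qed.

Lemma kern_W_cdiff u : a' < Cmod u < b' -> cdiff W u.
Proof.
intros Hu; destruct kern_consts as [Z0 [Q1 [Q2 [Iz [Is [Qz [A0 [A1 B1]]]]]]]].
destruct (abs_consts s z Hs Hz) as [_ [_ [E3 E4]]].
assert (A2 : q / z <= a') by apply Rmax_r; assert (B2 : b' <= / z) by apply Rmin_r.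
assert (Hu0 : u <> 0%C) by (apply Cmod_neq0; lra).
assert (Iz2 : q * / z < z).
{ apply Rlt_trans with (s * s); [exact Qz|lra]. }
assert (L1 : q < / z * Cmod u).
{ apply Rlt_le_trans with (/ z * (q / z)); [|apply Rmult_le_compat_l; lra].
  unfold Rdiv; assert (0 < q * / z) by (apply Rmult_lt_0_compat; lra).
  assert (q * 1 < q * / z) by (apply Rmult_lt_compat_l; lra); nra. }
assert (L2 : q * (/ z * Cmod u) < 1).
{ apply Rle_lt_trans with (q * (/ z * / z)).
  - apply Rmult_le_compat_l; [lra|]; apply Rmult_le_compat_l; lra.
  - replace (q * (/ z * / z)) with (q * / z * / z) by ring.
    apply Rlt_le_trans with (z * / z); [apply Rmult_lt_compat_r; lra|rewrite Rinv_r; lra]. }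
assert (L3 : q < z * Cmod u).
{ apply Rle_lt_trans with (z * (q / z)); [right; field; lra|apply Rmult_lt_compat_l; lra]. }
assert (L4 : z * Cmod u < 1).
{ apply Rlt_le_trans with (z * / z); [apply Rmult_lt_compat_l; lra|rewrite Rinv_r; lra]. }
apply cdiff_div.
- apply cdiff_mult; [apply cdiff_const|].
  apply cdiff_mult; [apply phi_scale_cdiff|apply theta_scale_cdiff]; lra || assumption.
- apply cdiff_mult; [apply phi_scale_cdiff|apply theta_scale_cdiff]; lra || assumption.
- apply Cmult_neq_0.
  + apply phi_neq0; [lra|rewrite Cmod_mult, Cmod_R, E3; lra..].
  + apply theta_neq0; [lra|rewrite Cmod_mult, Cmod_R, E4..]; nra.
Qed.

Lemma kern_U_cdiff u : cdiff P u -> cdiff U u.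
Proof.
intros H; apply cdiff_minus; [exact H|].
apply cdiff_mult; [apply cdiff_const|]; apply cdiff_plus; [apply cdiff_const|apply cdiff_scale].
Qed.

Lemma kern_U_cont u : cont_at P u -> cont_at U u.
Proof.
intros H; apply (cont_plus P (fun u => - (k * (1 + RtoC (/ s) * u)))%C); [exact H|].
apply cdiff_cont, cdiff_opp, cdiff_mult; [apply cdiff_const|].
apply cdiff_plus; [apply cdiff_const|apply cdiff_scale].
Qed.

Lemma kern_U_z : U (RtoC z) = 0%C.
Proof. unfold U, k; field; apply pole_factor_neq0. Qed.

Lemma kern_means : cmean G 1 = cmean G (s * s).
Proof.
destruct kern_consts as [Z0 [Q1 [Q2 [Iz [Is [Qz [A0 [A1 B1]]]]]]]].
assert (Aa : a <= a') by apply Rmax_l; assert (Bb : b' <= b) by apply Rmin_l.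
apply (circle_mean_const G (RtoC z :: S) a' b' x0); try lra.
- intros u Hu Nu; apply cont_mult; [|now apply cdiff_cont, kern_W_cdiff].
  destruct (excluded_middle_informative (u = RtoC z)) as [E|E].
  + rewrite E; apply slope_cont_self, kern_U_cdiff, Pz.
  + apply slope_cont; [exact E|apply kern_U_cont, Pc; [lra|exact Nu]].
- intros u Hu Nu Hin; apply cdiff_mult; [|now apply kern_W_cdiff].
  apply slope_cdiff; [intros E; apply Hin; left; now symmetry|].
  apply kern_U_cdiff, Pd; [lra|exact Nu|intros F; apply Hin; now right].
- destruct Pb as [d [B' [Hd HP]]].
  assert (X : a' < Cmod (RtoC (- x0)) < b').
  { rewrite Cmod_R, Rabs_Ropp, Rabs_pos_eq by nra; lra. }
  destruct (cont_bound W (RtoC (- x0))) as [d1 [B1' [D1 [B1p H1]]]]; [now apply cdiff_cont, kern_W_cdiff|].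
  destruct (cont_bound (fun u => k * (1 + RtoC (/ s) * u))%C (RtoC (- x0))) as [d2 [B2 [D2 [B2p H2]]]].
  { apply cdiff_cont, cdiff_mult; [apply cdiff_const|].
    apply cdiff_plus; [apply cdiff_const|apply cdiff_scale]. }
  set (dd := Rmin x0 (Rmin d (Rmin d1 d2))).
  assert (D : 0 < dd) by (unfold dd; repeat apply Rmin_glb_lt; try assumption; nra).
  assert (M0 : dd <= x0) by apply Rmin_l.
  assert (M1 : dd <= d) by min_le.
  assert (M2 : dd <= d1) by min_le.
  assert (M3 : dd <= d2) by min_le.
  exists dd, ((B' + B2) / z * B1'); split; [exact D|]; intros u Hu.
  (* Since dd <= x0, |u - z| >= x0 + z - dd >= z, which bounds the slope next to the puncture. *)
  assert (Huz : z <= Cmod (u - RtoC z)).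
  { generalize (Cmod_sub_ge (RtoC (- x0 - z)) (- (u - RtoC (- x0)))).
    replace (RtoC (- x0 - z) - - (u - RtoC (- x0)))%C with (u - RtoC z)%C by (rewrite RtoC_minus; ring).
    rewrite Cmod_opp, Cmod_R, Rabs_left by nra; lra. }
  unfold G; rewrite Cmod_mult.
  apply Rmult_le_compat; try apply Cmod_ge_0; [|apply H1; lra].
  assert (E := slope_spec U (RtoC z) u); rewrite kern_U_z in E.
  apply (f_equal Cmod) in E; rewrite Cmod_mult in E.
  apply Rmult_le_reg_r with z; [exact Z0|].
  replace ((B' + B2) / z * z) with (B' + B2) by (field; lra).
  apply Rle_trans with (Cmod (slope U (RtoC z) u) * Cmod (u - RtoC z)).
  { apply Rmult_le_compat_l; [apply Cmod_ge_0|exact Huz]. }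
  rewrite <- E; replace (U u - 0)%C with (U u) by ring; unfold U.
  eapply Rle_trans; [apply Cmod_sub_le|]; apply Rplus_le_compat; [apply HP; lra|apply H2; lra].
Qed.

Lemma kern_G_circle u : Cmod u = 1 \/ Cmod u = s * s ->
  (1 + RtoC (/ s) * u)%C <> 0%C /\
  G u = (P u * (kern s z N u / (1 + RtoC (/ s) * u)) - k * kern s z N u)%C.
Proof.
intros Hu; destruct kern_consts as [Z0 [Q1 [Q2 [Iz [Is [Qz [A0 [A1 B1]]]]]]]].
destruct (kern_factors_neq0 s z N Hs Hz u Hu) as [T1 [T2 [T3 T4]]].
assert (D1 : (1 + RtoC (/ s) * u)%C <> 0%C).
{ intros E; assert (E' : (RtoC (/ s) * u = -(1))%C).
  { replace (RtoC (/ s) * u)%C with (1 + RtoC (/ s) * u - 1)%C by ring; rewrite E; ring. }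
  apply (f_equal Cmod) in E'; rewrite Cmod_mult, Cmod_R, Cmod_opp, Cmod_1, Rabs_pos_eq in E' by lra.
  destruct Hu as [Hu|Hu]; rewrite Hu in E'; [lra|].
  replace (/ s * (s * s)) with s in E' by (field; lra); lra. }
split; [exact D1|].
assert (Nz : u <> RtoC z).
{ intros E; rewrite E, Cmod_R, Rabs_pos_eq in Hu by lra; lra. }
assert (D2 := Cminus_neq0 _ _ Nz).
assert (Hz0 := RtoC_neq0 z ltac:(lra)).
unfold G; replace (slope U (RtoC z) u) with (U u / (u - RtoC z))%C.
2:{ assert (E := slope_spec U (RtoC z) u); rewrite kern_U_z in E.
  replace (U u) with (U u - 0)%C by ring; rewrite E; field; exact D2. }
unfold U, W, kern; fold q; fold q in T1, T2, T3, T4; unfold theta in *.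
replace (RtoC (- / s) * u)%C with (- (RtoC (/ s) * u))%C in * by (rewrite RtoC_opp; ring).
set (p1 := phi q N (- (RtoC (/ s) * u))%C) in *; set (t2 := phi q N (RtoC (- s) * u)%C) in *.
set (p3 := phi q N (RtoC (/ z) * u)%C) in *; set (p4 := phi q N (RtoC z * u)%C) in *.
assert (p3 <> 0%C) by (intros E; apply T3; rewrite E; ring).
assert (p4 <> 0%C) by (intros E; apply T4; rewrite E; ring).
assert (D4 : (1 - RtoC z * u)%C <> 0%C) by (intros E; apply T4; rewrite E; ring).
rewrite (RtoC_inv s), (RtoC_inv z) by lra; rewrite (RtoC_inv s) in D1 by lra.
assert (Hs0 := RtoC_neq0 s ltac:(lra)).
assert (D5 : (RtoC z - u)%C <> 0%C) by (apply Cminus_neq0; congruence).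
assert (D6 : (RtoC s + u)%C <> 0%C).
{ intros E; apply D1; transitivity ((RtoC s + u) / RtoC s)%C; [field; exact Hs0|rewrite E; field; exact Hs0]. }
field; repeat split; assumption.
Qed.

Lemma kernel_max_principle : Cmod (P (RtoC z)) * (1 - 12 * q ^ N) <= B * (1 + z / s).
Proof.
destruct kern_consts as [Z0 [Q1 [Q2 [Iz [Is [Qz [A0 [A1 B1]]]]]]]].
assert (Hm : 0 < q ^ N) by (apply pow_lt; lra).
pose (v := fun x t => kern s z N (RtoC x * cis t)%C).
pose (w := fun x t => (P (RtoC x * cis t) * (kern s z N (RtoC x * cis t) / (1 + RtoC (/ s) * (RtoC x * cis t))))%C).
assert (Circ : forall x t, x = 1 \/ x = s * s -> Cmod (RtoC x * cis t) = 1 \/ Cmod (RtoC x * cis t) = s * s).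
{ intros x t Hx; rewrite Cmod_polar by lra; exact Hx. }
assert (Kd : forall u, Cmod u = 1 \/ Cmod u = s * s -> cdiff (kern s z N) u).
{ intros u Hu; assert (Hu0 : u <> 0%C) by (apply Cmod_neq0; lra).
  destruct (kern_factors_neq0 s z N Hs Hz u Hu) as [T1 [T2 [T3 T4]]].
  apply cdiff_div; [| |now apply Cmult_neq_0]; apply cdiff_mult; apply theta_scale_cdiff; lra || assumption. }
assert (Cv : forall x, x = 1 \/ x = s * s -> rcont_on (v x) 0 (2 * PI)).
{ intros x Hx; apply rcont_on_circle; intros t _; apply cdiff_cont, Kd; auto. }
assert (Cw : forall x, x = 1 \/ x = s * s -> rcont_on (w x) 0 (2 * PI)).
{ intros x Hx; apply (rcont_on_circle (fun u => P u * (kern s z N u / (1 + RtoC (/ s) * u)))%C).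
  intros t _; assert (Hu := Circ x t Hx); apply cont_mult.
  - apply Pc; [lra|]; intros E; rewrite E, Cmod_R, Rabs_Ropp, Rabs_pos_eq in Hu by lra; lra.
  - apply cdiff_cont, cdiff_div; [now apply Kd| |now apply kern_G_circle].
    apply cdiff_plus; [apply cdiff_const|apply cdiff_scale]. }
assert (Bw : forall x t, x = 1 \/ x = s * s -> Cmod (w x t) <= B * Cmod (v x t)).
{ intros x t Hx; unfold w, v; assert (Hu := Circ x t Hx); set (u := (RtoC x * cis t)%C) in *.
  destruct (kern_G_circle u Hu) as [D1 _]; assert (H1 := PB u Hu).
  assert (D2 := proj1 (Cmod_gt_0 _) D1).
  rewrite Cmod_mult, Cmod_div by exact D1.
  replace (B * Cmod (kern s z N u)) with
    (B * Cmod (1 + RtoC (/ s) * u) * (Cmod (kern s z N u) / Cmod (1 + RtoC (/ s) * u))) by (field; lra).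
  apply Rmult_le_compat_r; [|exact H1].
  apply Rmult_le_pos; [apply Cmod_ge_0|left; now apply Rinv_0_lt_compat]. }
assert (Gm : forall x, x = 1 \/ x = s * s -> cmean G x = CInt (fun t => w x t - k * v x t)%C 0 (2 * PI)).
{ intros x Hx; apply CInt_ext; [generalize two_PI_pos; lra|]; intros t _; unfold w, v.
  now apply kern_G_circle, Circ. }
assert (M := multiplier_bound (w 1) (w (s * s)) (v 1) (v (s * s)) k B (12 * q ^ N) 0 (2 * PI)).
assert (H : Cmod k * (1 - 12 * q ^ N) <= B).
{ apply M; auto; try lra; try apply two_PI_pos.
  - intros t _; apply kern_outer; [assumption..|]; rewrite Cmod_polar; lra.
  - intros t _; unfold v; rewrite (proj2 (kern_outer s z N Hs Hz (RtoC 1 * cis t) ltac:(rewrite Cmod_polar; lra))).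
    rewrite Cmod_0; apply Rmult_le_pos; [lra|apply Cmod_ge_0].
  - intros t _; apply kern_inner; [assumption..|]; rewrite Cmod_polar; lra.
  - rewrite <- 2!Gm by auto; apply kern_means. }
assert (Ek : Cmod (P (RtoC z)) = Cmod k * (1 + z / s)).
{ unfold k; rewrite Cmod_div by apply pole_factor_neq0.
  assert (0 < / s * z) by (apply Rmult_lt_0_compat; lra).
  rewrite <- RtoC_mult, <- RtoC_plus, Cmod_R, Rabs_pos_eq by lra; field; split; [lra|].
  apply Rgt_not_eq; unfold Rgt; lra. }
rewrite Ek; replace (Cmod k * (1 + z / s) * (1 - 12 * q ^ N)) with (Cmod k * (1 - 12 * q ^ N) * (1 + z / s)) by ring.
apply Rmult_le_compat_r; [|exact H].
assert (0 < z / s) by (apply Rdiv_lt_0_compat; lra); lra.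
Qed.
End KernelMaxPrinciple.

(** * Extremal functions *)

(* [gfun] has constant modulus on the outer circle, nearly constant modulus on the inner one, and a
   simple zero at [- s]; [gred] is [gfun] without this zero. The function [f0] is, up to the
   truncation, the quotient map of the annulus by [u -> s^2 / u], a two-sheeted cover of the disc. *)
Definition gred (s : R) (N : nat) (u : C) : C :=
  (phi (s ^ 4) N (RtoC (- / s) * u) / theta (s ^ 4) N (RtoC (- s) * u))%C.

Definition gfun (s : R) (N : nat) (u : C) : C := ((1 + RtoC (/ s) * u) * gred s N u)%C.

Definition f0 (s : R) (N : nat) (u : C) : C := (RtoC (s * s) / u * (gfun s N u * gfun s N u))%C.

Section Comparison.
Variables (s : R) (N : nat).
Hypothesis Hs : 0 < s < 1.
Let q := s ^ 4.
Let m := q ^ N.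
Hypothesis Hm : m <= 1 / 400.

(** The zeros of the denominator of [gred] nearest to the annulus are - 1 / s and - s^3, the
    reflections of - s in the two boundary circles; they determine this region. *)
Lemma gred_factors u : s * s * s < Cmod u < / s ->
  u <> 0%C /\ phi q N (RtoC (- / s) * u)%C <> 0%C /\ theta q N (RtoC (- s) * u)%C <> 0%C.
Proof.
intros Hu; destruct (q_bounds s Hs) as [Q1 [Q2 [Q3 [Q4 Q5]]]]; fold q in Q1, Q2, Q3.
assert (Ess : / s * s = 1) by (field; lra).
assert (Eq : q = s * s * s * s) by (unfold q; ring).
assert (Hu0 : u <> 0%C) by (apply Cmod_neq0; lra).
split; [exact Hu0|].
assert (L1 : s * Cmod u < 1) by nra.
split.
- apply phi_neq0; [lra|..]; rewrite Cmod_mult, Cmod_R, Rabs_Ropp, Rabs_pos_eq by lra.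
  + nra.
  + assert (/ s * Cmod u < / s * / s) by (apply Rmult_lt_compat_l; lra).
    apply Rlt_trans with (q * (/ s * / s)); [apply Rmult_lt_compat_l; lra|].
    rewrite Eq; replace (s * s * s * s * (/ s * / s)) with (s * s) by (field; lra); lra.
- apply theta_neq0; [lra|..]; rewrite Cmod_mult, Cmod_R, Rabs_Ropp, Rabs_pos_eq by lra; try nra.
Qed.

Lemma gred_cdiff u : s * s * s < Cmod u < / s -> cdiff (gred s N) u.
Proof.
intros Hu; destruct (gred_factors u Hu) as [H0 [H1 H2]].
assert (Is : 0 < / s) by (apply Rinv_0_lt_compat; lra).
apply cdiff_div; [apply phi_scale_cdiff|apply theta_scale_cdiff|]; lra || assumption.
Qed.

Lemma gred_neq0 u : s * s * s < Cmod u < / s -> gred s N u <> 0%C.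
Proof.
intros Hu; destruct (gred_factors u Hu) as [H0 [H1 H2]].
apply Cmult_neq_0; [exact H1|].
apply Cmod_neq0; rewrite Cmod_inv by exact H2; now apply Rinv_0_lt_compat, Cmod_gt_0.
Qed.

Lemma gfun_cdiff u : s * s * s < Cmod u < / s -> cdiff (gfun s N) u.
Proof.
intros Hu; apply cdiff_mult; [|now apply gred_cdiff].
apply cdiff_plus; [apply cdiff_const|apply cdiff_scale].
Qed.

Lemma gfun_theta u : gfun s N u = (theta q N (RtoC (- / s) * u) / theta q N (RtoC (- s) * u))%C.
Proof.
unfold gfun, gred, theta at 2; fold q; rewrite RtoC_opp; unfold Cdiv; ring.
Qed.

Lemma circle_in_region u : Cmod u = 1 \/ Cmod u = s * s -> s * s * s < Cmod u < / s.
Proof.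
destruct (q_bounds s Hs) as [Q1 [Q2 [Q3 [Q4 Q5]]]].
assert (Is : 1 < / s) by (apply inv_gt1; lra).
intros [-> | ->]; lra.
Qed.

Lemma gfun_outer u : Cmod u = 1 -> Cmod (gfun s N u) = / s.
Proof.
intros Hu; destruct (gred_factors u (circle_in_region u (or_introl Hu))) as [H0 [_ H2]].
rewrite gfun_theta, Cmod_div by exact H2.
assert (E := theta_unit_circle q N (- s) u ltac:(lra) Hu).
replace (/ - s) with (- / s) in E by (field; lra).
assert (P2 := proj1 (Cmod_gt_0 _) H2).
apply (f_equal Cmod) in E.
rewrite Cmod_mult, Cmod_opp, Cmod_mult, Hu, Cmod_R, Rabs_Ropp, Rabs_pos_eq, Cmod_conj in E by lra.
rewrite E in *; field; split; [lra|]; intros F; rewrite F in P2; lra.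
Qed.

Lemma gfun_inner u : Cmod u = s * s -> 1 - 3 * m <= Cmod (gfun s N u) <= 1 + 3 * m.
Proof.
intros Hu; destruct (q_bounds s Hs) as [Q1 [Q2 [Q3 [Q4 Q5]]]]; fold q in Q1, Q2, Q3.
destruct (gred_factors u (circle_in_region u (or_intror Hu))) as [H0 [H1 H2]].
assert (N0 : N <> O) by (intros E; revert Hm; unfold m; rewrite E; simpl; lra).
assert (Hm0 : 0 < m) by (apply pow_lt; lra).
assert (Is : 0 < / s) by (apply Rinv_0_lt_compat; lra).
assert (Y1 : Cmod (RtoC (- / s) * u) = s).
{ rewrite Cmod_mult, Cmod_R, Rabs_Ropp, Rabs_pos_eq, Hu by lra; field; lra. }
destruct (theta_inner_circle q N (- / s) (s * s) u) as [E|E]; try lra; try contradiction; try nra.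
replace (/ - / s) with (- s) in E by (field; lra).
assert (X1 : Cmod (Cconj (RtoC (- / s) * u)) = s) by (rewrite Cmod_conj; exact Y1).
set (y := Cconj (RtoC (- / s) * u)) in *.
assert (NY : y <> 0%C) by (apply Cmod_neq0; lra).
set (a := (RtoC (q ^ S N) / y)%C) in *; set (b := (RtoC (q ^ N) * y)%C) in *.
assert (Qn : q ^ S N = q * m) by reflexivity.
assert (Ha : Cmod a <= m).
{ unfold a; rewrite Cmod_div, Cmod_R, X1, Qn, Rabs_pos_eq by (assumption || nra).
  apply Rmult_le_reg_r with s; [lra|]; unfold Rdiv; rewrite Rmult_assoc, Rinv_l by lra; nra. }
assert (Hb : Cmod b <= m).
{ unfold b; rewrite Cmod_mult, Cmod_R, X1; fold m; rewrite Rabs_pos_eq by lra; nra. }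
assert (NB : (1 - b)%C <> 0%C) by (apply one_minus_neq0; lra).
assert (NA : (1 - a)%C <> 0%C) by (apply one_minus_neq0; lra).
assert (T : theta q N (RtoC (- / s) * u)%C <> 0%C).
{ intros F; apply H2; rewrite E, F; unfold Cconj; simpl; replace (- 0) with 0 by ring.
  fold (RtoC 0); ring. }
rewrite gfun_theta, E, Cmod_div, Cmod_mult, Cmod_div, Cmod_conj.
2: exact NB.
2: rewrite <- E; exact H2.
assert (PT := proj1 (Cmod_gt_0 _) T).
assert (PA := proj1 (Cmod_gt_0 _) NA).
assert (PB := proj1 (Cmod_gt_0 _) NB).
set (t := Cmod (theta q N (RtoC (- / s) * u)%C)) in *.
replace (t / (t * (Cmod (1 - a) / Cmod (1 - b)))) with (Cmod (1 - b) / Cmod (1 - a)) by (field; lra).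
assert (A1 := Cmod_sub_ge 1 a); assert (A2 := Cmod_sub_le 1 a).
assert (B1 := Cmod_sub_ge 1 b); assert (B2 := Cmod_sub_le 1 b).
rewrite Cmod_1 in *.
split; apply Rmult_le_reg_r with (Cmod (1 - a)); try lra;
  unfold Rdiv; rewrite Rmult_assoc, Rinv_l by lra; nra.
Qed.

Section AtPoint.
Variable z : R.
Hypothesis Hz : s * s < z < 1.

Lemma region_z : s * s * s < Cmod (RtoC z) < / s /\ 0 < z.
Proof.
destruct (q_bounds s Hs) as [Q1 [Q2 [Q3 [Q4 Q5]]]].
assert (Is : 1 < / s) by (apply inv_gt1; lra).
rewrite Cmod_R, Rabs_pos_eq by lra; lra.
Qed.

Lemma m_pos : 0 < m.
Proof. apply pow_lt; destruct (q_bounds s Hs) as [Q1 _]; exact (proj1 Q1). Qed.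

(** The puncture is placed at the dummy position - s, where P is differentiable, and the list of
    exceptional points is empty. *)
Lemma kernel_max_principle_smooth P B : 0 <= B ->
  (forall u, s * s * s < Cmod u < / s -> cdiff P u) ->
  (forall u, Cmod u = 1 \/ Cmod u = s * s -> Cmod (P u) <= B * Cmod (1 + RtoC (/ s) * u)) ->
  Cmod (P (RtoC z)) * (1 - 12 * m) <= B * (1 + z / s).
Proof.
intros HB HP HPB; destruct (q_bounds s Hs) as [Q1 [Q2 [Q3 [Q4 Q5]]]]; destruct region_z as [R1 R2].
assert (Is : 1 < / s) by (apply inv_gt1; lra).
apply (kernel_max_principle s z N P nil s (s * s * s) (/ s) B Hs Hz); try lra.
- unfold m, q in Hm; lra.
- intros u Hu _; now apply cdiff_cont, HP.
- intros u Hu _ _; now apply HP.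
- now apply HP.
- destruct (cont_bound P (RtoC (- s))) as [d [B' [D [_ H]]]].
  + apply cdiff_cont, HP; rewrite Cmod_R, Rabs_Ropp, Rabs_pos_eq by lra; lra.
  + exists d, B'; tauto.
- exact HPB.
Qed.

Lemma cdiff_rot (f : C -> C) (w u : C) : cdiff f (w * u)%C -> cdiff (fun y => f (w * y)%C) u.
Proof.
intros H; apply (cdiff_comp f (fun y => w * y)%C); [|exact H].
apply cdiff_mult; [apply cdiff_const|apply cdiff_id].
Qed.

Lemma gfun_z_pos : Cmod (gfun s N (RtoC z)) = (1 + z / s) * Cmod (gred s N (RtoC z)).
Proof.
destruct region_z as [R1 R2]; unfold gfun; rewrite Cmod_mult; f_equal.
rewrite <- RtoC_mult, <- RtoC_plus, Cmod_R, Rabs_pos_eq; [field; lra|].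
assert (0 < / s * z) by (apply Rmult_lt_0_compat; [apply Rinv_0_lt_compat; lra|exact R2]); lra.
Qed.

(** Duality for P = gfun(w u) / gred(u): P / (1 + u / s) has boundary modulus near 1, since |gfun|
    is nearly the same at w u and u. The outer circle is exact; the inner one costs the factor (1 +
    3 m) / (1 - 3 m). *)
Lemma gfun_rot w : Cmod w = 1 ->
  Cmod (gfun s N (w * RtoC z)%C) * ((1 - 12 * m) * (1 - 3 * m)) <= (1 + 3 * m) * Cmod (gfun s N (RtoC z)).
Proof.
intros Hw; assert (M0 := m_pos); destruct region_z as [R1 R2].
assert (Hwu : forall u, Cmod (w * u) = Cmod u) by (intros u; rewrite Cmod_mult, Hw; ring).
assert (K := kernel_max_principle_smooth (fun u => gfun s N (w * u) / gred s N u)%C ((1 + 3 * m) / (1 - 3 * m))).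
assert (B1 : 1 <= (1 + 3 * m) / (1 - 3 * m)).
{ apply Rmult_le_reg_r with (1 - 3 * m); [lra|]; unfold Rdiv; rewrite Rmult_assoc, Rinv_l; lra. }
assert (H : Cmod (gfun s N (w * RtoC z) / gred s N (RtoC z))%C * (1 - 12 * m) <= (1 + 3 * m) / (1 - 3 * m) * (1 + z / s)).
{ apply K; [lra| |].
  - intros u Hu; apply cdiff_div; [apply cdiff_rot, gfun_cdiff; now rewrite Hwu|now apply gred_cdiff|now apply gred_neq0].
  - intros u Hu; assert (Gn := gred_neq0 u (circle_in_region u Hu)).
    assert (G1 := proj1 (Cmod_gt_0 _) Gn).
    rewrite Cmod_div by exact Gn.
    apply Rmult_le_reg_r with (Cmod (gred s N u)); [exact G1|].
    unfold Rdiv at 1; rewrite Rmult_assoc, Rinv_l, Rmult_1_r by lra.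
    rewrite Rmult_assoc, <- Cmod_mult; fold (gfun s N u).
    destruct Hu as [Hu|Hu].
    + rewrite 2!gfun_outer by (rewrite ?Hwu; exact Hu).
      assert (0 < / s) by (apply Rinv_0_lt_compat; lra); nra.
    + assert (I1 := gfun_inner (w * u)%C ltac:(rewrite Hwu; exact Hu)); assert (I2 := gfun_inner u Hu).
      apply Rle_trans with ((1 + 3 * m) / (1 - 3 * m) * (1 - 3 * m)).
      * unfold Rdiv; rewrite Rmult_assoc, Rinv_l; lra.
      * apply Rmult_le_compat_l; lra. }
assert (Gn := gred_neq0 _ R1); assert (G1 := proj1 (Cmod_gt_0 _) Gn).
rewrite Cmod_div in H by exact Gn; rewrite gfun_z_pos.
set (X := Cmod (gfun s N (w * RtoC z)%C)) in *; set (Y := Cmod (gred s N (RtoC z))) in *.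
apply Rmult_le_compat_r with (r := Y * (1 - 3 * m)) in H; [|nra].
replace (X / Y * (1 - 12 * m) * (Y * (1 - 3 * m))) with (X * ((1 - 12 * m) * (1 - 3 * m))) in H by (field; lra).
replace ((1 + 3 * m) / (1 - 3 * m) * (1 + z / s) * (Y * (1 - 3 * m)))
  with ((1 + 3 * m) * ((1 + z / s) * Y)) in H by (field; lra).
exact H.
Qed.

Lemma f0_cdiff u : s * s * s < Cmod u < / s -> cdiff (f0 s N) u.
Proof.
intros Hu; assert (Hu0 := proj1 (gred_factors u Hu)).
apply cdiff_mult; [|apply cdiff_mult; now apply gfun_cdiff].
apply cdiff_div; [apply cdiff_const|apply cdiff_id|exact Hu0].
Qed.

Lemma f0_circle u : Cmod u = 1 \/ Cmod u = s * s -> Cmod (f0 s N u) <= (1 + 3 * m) * (1 + 3 * m).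
Proof.
intros Hu; assert (M0 := m_pos); assert (Hu0 := proj1 (gred_factors u (circle_in_region u Hu))).
unfold f0; rewrite Cmod_mult, Cmod_div, Cmod_mult, Cmod_R, Rabs_pos_eq by (assumption || nra).
destruct Hu as [Hu|Hu]; rewrite Hu.
- rewrite gfun_outer by exact Hu; replace (s * s / 1 * (/ s * / s)) with 1 by (field; lra); nra.
- replace (s * s / (s * s)) with 1 by (field; nra); rewrite Rmult_1_l.
  assert (I := gfun_inner u Hu); apply Rmult_le_compat; lra.
Qed.

(** For P divisible by 1 + u / s the kernel estimate is the ordinary maximum principle of the
    annulus at a positive point; the rotation by w brings an arbitrary point there. *)
Lemma f0_rot_bound w : Cmod w = 1 -> Cmod (f0 s N (w * RtoC z)%C) * (1 - 12 * m) <= (1 + 3 * m) * (1 + 3 * m).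
Proof.
intros Hw; assert (M0 := m_pos); destruct region_z as [R1 R2].
assert (Hwu : forall u, Cmod (w * u) = Cmod u) by (intros u; rewrite Cmod_mult, Hw; ring).
assert (K := kernel_max_principle_smooth (fun u => f0 s N (w * u) * (1 + RtoC (/ s) * u))%C ((1 + 3 * m) * (1 + 3 * m))).
assert (L : 0 < 1 + z / s) by (assert (0 < z / s) by (apply Rdiv_lt_0_compat; lra); lra).
apply Rmult_le_reg_r with (1 + z / s); [exact L|].
replace (1 + z / s) with (Cmod (1 + RtoC (/ s) * RtoC z)) at 1.
2:{ rewrite <- RtoC_mult, <- RtoC_plus, Cmod_R; replace (1 + / s * z) with (1 + z / s) by (field; lra).
  apply Rabs_pos_eq; lra. }
rewrite Rmult_assoc, (Rmult_comm (1 - 12 * m)), <- Rmult_assoc, <- Cmod_mult.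
apply K; [nra| |].
- intros u Hu; apply cdiff_mult; [apply cdiff_rot, f0_cdiff; now rewrite Hwu|].
  apply cdiff_plus; [apply cdiff_const|apply cdiff_scale].
- intros u Hu; rewrite Cmod_mult; apply Rmult_le_compat_r; [apply Cmod_ge_0|].
  apply f0_circle; now rewrite Hwu.
Qed.
End AtPoint.

Lemma f0_bound v : s * s < Cmod v < 1 -> Cmod (f0 s N v) <= 1 + 40 * m.
Proof.
intros Hv; assert (M0 := m_pos).
assert (Hv0 : 0 < Cmod v) by nra.
assert (Hn := RtoC_neq0 (Cmod v) ltac:(lra)).
assert (H := f0_rot_bound (Cmod v) Hv (v / RtoC (Cmod v))%C).
replace (v / RtoC (Cmod v) * RtoC (Cmod v))%C with v in H by (field; exact Hn).
rewrite Cmod_div, Cmod_R, Rabs_pos_eq in H by (assumption || lra).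
specialize (H ltac:(field; lra)).
apply Rmult_le_reg_r with (1 - 12 * m); [lra|]; nra.
Qed.
End Comparison.

(* The comparison function is [s^2 / u] times two rotated copies of [gfun], with zeros [w] and
   [- s]; the second zero is harmless because it is also a zero of the kernel. *)
Lemma zero_on_circle_bound (s z x0 a b : R) (N : nat) (f : C -> C) (w : C) :
  0 < s < 1 -> s * s < z < 1 -> s * s < x0 < 1 -> (s ^ 4) ^ N <= 1 / 400 ->
  0 <= a < s * s -> 1 < b ->
  (forall u, a < Cmod u < b -> u <> RtoC (- x0) -> cdiff f u /\ Cmod (f u) <= 1) ->
  Cmod w = s -> w <> RtoC z -> w <> RtoC (- x0) -> f w = 0%C ->
  Cmod (f (RtoC z)) * (1 - 33 * (s ^ 4) ^ N) <= (1 + 3 * (s ^ 4) ^ N) * Cmod (f0 s N (RtoC z)).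
Proof.
intros Hs Hz Hx0 Hm Ha Hb Hf Hw Nwz Nwx Hfw.
destruct (q_bounds s Hs) as [Q1 [Q2 [Q3 [Q4 Q5]]]].
set (m := (s ^ 4) ^ N) in *.
assert (M0 : 0 < m) by (apply pow_lt; lra).
assert (Is : 1 < / s) by (apply inv_gt1; lra).
destruct (region_z s Hs z Hz) as [R1 R2].
assert (Hw0 : w <> 0%C) by (apply Cmod_neq0; lra).
(* The rotation that carries w to - s, so that the second copy of [gfun] vanishes at w. *)
set (e := (- RtoC s / w)%C).
assert (He : Cmod e = 1).
{ unfold e; rewrite Cmod_div, Cmod_opp, Cmod_R, Rabs_pos_eq, Hw by (assumption || lra); field; lra. }
assert (Heu : forall u, Cmod (e * u) = Cmod u) by (intros u; rewrite Cmod_mult, He; ring).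
(* With h the comparison function, [V] is (u - w) (1 + u / s) / h after cancelling both zeros of h.
   Thus [slope f w] times [V] is f (1 + u / s) / h, without a pole at w or - s. *)
pose (V := fun u => (- w / RtoC (s * s) * (u / (gred s N u * gred s N (e * u))))%C).
assert (Hss := RtoC_neq0 (s * s) ltac:(nra)).
assert (Vd : forall u, s * s * s < Cmod u < / s -> cdiff V u).
{ intros u Hu; apply cdiff_mult; [apply cdiff_const|]; apply cdiff_div; [apply cdiff_id| |].
  - apply cdiff_mult; [now apply gred_cdiff|]; apply cdiff_rot, gred_cdiff; [exact Hs|now rewrite Heu].
  - apply Cmult_neq_0; apply gred_neq0; rewrite ?Heu; assumption. }
pose (P := fun u => (slope f w u * V u)%C).
assert (EP : forall u, s * s * s < Cmod u < / s -> u <> w ->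
  (P u * (RtoC (s * s) / u * (gfun s N u * gfun s N (e * u))) = f u * (1 + RtoC (/ s) * u))%C).
{ intros u Hu Nu; assert (Hu0 := proj1 (gred_factors s N Hs u Hu)).
  assert (E := slope_spec f w u); rewrite Hfw in E.
  replace (f u) with (slope f w u * (u - w))%C by (rewrite <- E; ring).
  assert (G1 := gred_neq0 s N Hs u Hu).
  assert (G2 : gred s N (e * u)%C <> 0%C) by (apply gred_neq0; rewrite ?Heu; assumption).
  unfold P, V, gfun; set (g1 := gred s N u) in *; set (g2 := gred s N (e * u)%C) in *.
  replace (1 + RtoC (/ s) * (e * u))%C with (- (u - w) / w)%C.
  2:{ unfold e; rewrite RtoC_inv by lra; field; split; [exact Hw0|apply RtoC_neq0; lra]. }
  field; tauto. }
set (a' := Rmax a (s * s * s)); set (b' := Rmin b (/ s)).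
assert (A1 : a <= a') by apply Rmax_l; assert (A2 : s * s * s <= a') by apply Rmax_r.
assert (A3 : a' < s * s) by (apply Rmax_lub_lt; lra).
assert (B1 : b' <= b) by apply Rmin_l; assert (B2 : b' <= / s) by apply Rmin_r.
assert (B3 : 1 < b') by (apply Rmin_glb_lt; lra).
assert (Rx : a' < Cmod (RtoC (- x0)) < b').
{ rewrite Cmod_R, Rabs_Ropp, Rabs_pos_eq by lra; lra. }
assert (Sc : forall u, a' < Cmod u < b' -> u <> RtoC (- x0) -> cont_at (slope f w) u).
{ intros u Hu Nu; destruct (excluded_middle_informative (u = w)) as [E|E].
  - rewrite E; apply slope_cont_self, Hf; [lra|exact Nwx].
  - apply slope_cont; [exact E|]; apply cdiff_cont, Hf; [lra|exact Nu]. }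
assert (Hp : forall u, Cmod u = 1 \/ Cmod u = s * s -> u <> w /\ u <> RtoC (- x0)).
{ intros u Hu; split; intros E; rewrite E in Hu; [lra|].
  rewrite Cmod_R, Rabs_Ropp, Rabs_pos_eq in Hu by lra; lra. }
assert (K : Cmod (P (RtoC z)) * (1 - 12 * m) <= / ((1 - 3 * m) * (1 - 3 * m)) * (1 + z / s)).
{ apply (kernel_max_principle s z N P (w :: nil) x0 a' b'); fold m; try lra.
  - apply Rlt_le, Rinv_0_lt_compat; nra.
  - intros u Hu Nu; apply cont_mult; [now apply Sc|apply cdiff_cont, Vd; lra].
  - intros u Hu Nu Nin; apply cdiff_mult; [|apply Vd; lra].
    apply slope_cdiff; [intros E; apply Nin; left; now symmetry|apply Hf; [lra|exact Nu]].
  - apply cdiff_mult; [|now apply Vd]; apply slope_cdiff; [congruence|]; apply Hf.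
    + rewrite Cmod_R, Rabs_pos_eq by lra; lra.
    + intros E; apply RtoC_inj in E; lra.
  - destruct (cont_bound V (RtoC (- x0))) as [d1 [B1' [D1 [Bp H1]]]]; [apply cdiff_cont, Vd; lra|].
    assert (Dw : 0 < Cmod (RtoC (- x0) - w)) by (apply Cmod_gt_0, Cminus_neq0; congruence).
    set (dw := Cmod (RtoC (- x0) - w)) in *.
    set (X := Cmod (RtoC (- x0))) in *.
    (* The value of f at the puncture is arbitrary, but the bound has to hold on a full
       neighbourhood. *)
    set (M := Rmax 1 (Cmod (f (RtoC (- x0))))).
    assert (HM : 1 <= M) by apply Rmax_l.
    set (d := Rmin (Rmin d1 (dw / 2)) (Rmin (X - a') (b' - X))).
    assert (D : 0 < d) by (unfold d; repeat apply Rmin_glb_lt; lra).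
    assert (E1 : d <= d1) by min_le.
    assert (E2 : d <= dw / 2) by min_le.
    assert (E3 : d <= X - a') by min_le.
    assert (E4 : d <= b' - X) by min_le.
    exists d, (2 * M / dw * B1'); split; [exact D|]; intros u Hu.
    assert (T1 := Cmod_sub_ge u (RtoC (- x0))); assert (T2 := Cmod_sub_ge (RtoC (- x0)) u).
    rewrite (Cmod_sub_sym _ u) in T2; fold X in T1, T2.
    assert (Fu : Cmod (f u) <= M).
    { destruct (excluded_middle_informative (u = RtoC (- x0))) as [E|E]; [rewrite E; apply Rmax_r|].
      apply Rle_trans with 1; [apply Hf; [lra|exact E]|exact HM]. }
    assert (Uw : dw / 2 <= Cmod (u - w)).
    { generalize (Cmod_sub_ge (RtoC (- x0) - w) (RtoC (- x0) - u)).
      replace (RtoC (- x0) - w - (RtoC (- x0) - u))%C with (u - w)%C by ring.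
      rewrite (Cmod_sub_sym _ u); fold dw; lra. }
    unfold P; rewrite Cmod_mult; apply Rmult_le_compat; try apply Cmod_ge_0; [|apply H1; lra].
    assert (E := slope_spec f w u); rewrite Hfw in E; apply (f_equal Cmod) in E.
    rewrite Cmod_mult in E; replace (f u - 0)%C with (f u) in E by ring.
    apply Rmult_le_reg_r with (dw / 2); [lra|].
    replace (2 * M / dw * (dw / 2)) with M by (field; lra).
    eapply Rle_trans; [|exact Fu]; rewrite E; apply Rmult_le_compat_l; [apply Cmod_ge_0|exact Uw].
  - intros u Hu; destruct (Hp u Hu) as [Nu Nx]; assert (Ru := circle_in_region s Hs u Hu).
    assert (E := EP u Ru Nu); apply (f_equal Cmod) in E; rewrite !Cmod_mult in E.
    assert (Hu0 := proj1 (gred_factors s N Hs u Ru)).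
    rewrite Cmod_div, Cmod_R, Rabs_pos_eq in E by (assumption || nra).
    assert (Fu : Cmod (f u) <= 1) by (apply Hf; [destruct Hu; lra|exact Nx]).
    set (h := s * s / Cmod u * (Cmod (gfun s N u) * Cmod (gfun s N (e * u)%C))) in *.
    assert (Hh : (1 - 3 * m) * (1 - 3 * m) <= h).
    { unfold h; destruct Hu as [Hu|Hu]; rewrite Hu.
      - rewrite 2!gfun_outer by (rewrite ?Heu; assumption).
        replace (s * s / 1 * (/ s * / s)) with 1 by (field; lra); nra.
      - replace (s * s / (s * s)) with 1 by (field; nra); rewrite Rmult_1_l.
        assert (I1 := gfun_inner s N Hs Hm u Hu).
        assert (I2 := gfun_inner s N Hs Hm (e * u)%C ltac:(rewrite Heu; exact Hu)).
        fold m in I1, I2; apply Rmult_le_compat; lra. }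
    assert (L0 := Cmod_ge_0 (1 + RtoC (/ s) * u)); assert (P0 := Cmod_ge_0 (P u)).
    set (L := Cmod (1 + RtoC (/ s) * u)) in *.
    assert (MM : 0 < (1 - 3 * m) * (1 - 3 * m)) by nra.
    apply Rmult_le_reg_l with ((1 - 3 * m) * (1 - 3 * m)); [exact MM|].
    rewrite <- Rmult_assoc, Rinv_r, Rmult_1_l by lra.
    apply Rle_trans with (h * Cmod (P u)); [now apply Rmult_le_compat_r|].
    rewrite Rmult_comm, E; nra. }
assert (E := EP (RtoC z) R1 ltac:(congruence)); apply (f_equal Cmod) in E; rewrite !Cmod_mult in E.
assert (L : Cmod (1 + RtoC (/ s) * RtoC z) = 1 + z / s).
{ assert (0 < z / s) by (apply Rdiv_lt_0_compat; lra).
  rewrite <- RtoC_mult, <- RtoC_plus, Cmod_R; replace (1 + / s * z) with (1 + z / s) by (field; lra).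
  apply Rabs_pos_eq; lra. }
rewrite L in E; unfold f0; rewrite !Cmod_mult.
assert (Rt := gfun_rot s N Hs Hm z Hz e He); fold m in Rt.
set (F := Cmod (f (RtoC z))) in *; set (c := Cmod (RtoC (s * s) / RtoC z)) in *.
set (g := Cmod (gfun s N (RtoC z))) in *; set (g' := Cmod (gfun s N (e * RtoC z)%C)) in *.
set (p := Cmod (P (RtoC z))) in *.
assert (Lz : 0 < 1 + z / s) by (assert (0 < z / s) by (apply Rdiv_lt_0_compat; lra); lra).
assert (F0 : 0 <= F) by apply Cmod_ge_0; assert (c0 : 0 <= c) by apply Cmod_ge_0.
assert (g0 : 0 <= g) by apply Cmod_ge_0; assert (g0' : 0 <= g') by apply Cmod_ge_0.
assert (MM : 0 < (1 - 3 * m) * (1 - 3 * m)) by nra.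
assert (S1 : F * ((1 - 12 * m) * ((1 - 3 * m) * (1 - 3 * m))) <= c * (g * g')).
{ apply Rmult_le_reg_r with (1 + z / s); [exact Lz|].
  replace (F * ((1 - 12 * m) * ((1 - 3 * m) * (1 - 3 * m))) * (1 + z / s))
    with (F * (1 + z / s) * ((1 - 12 * m) * ((1 - 3 * m) * (1 - 3 * m)))) by ring.
  rewrite <- E.
  replace (p * (c * (g * g')) * ((1 - 12 * m) * ((1 - 3 * m) * (1 - 3 * m))))
    with (c * (g * g') * (p * (1 - 12 * m) * ((1 - 3 * m) * (1 - 3 * m)))) by ring.
  apply Rmult_le_compat_l; [repeat apply Rmult_le_pos; assumption|].
  apply Rle_trans with (/ ((1 - 3 * m) * (1 - 3 * m)) * (1 + z / s) * ((1 - 3 * m) * (1 - 3 * m))).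
  - apply Rmult_le_compat_r; lra.
  - right; field; lra. }
assert (S2 : F * ((1 - 12 * m) * ((1 - 3 * m) * (1 - 3 * m)) * ((1 - 12 * m) * (1 - 3 * m))) <= (1 + 3 * m) * (c * (g * g))).
{ apply Rle_trans with (c * (g * g') * ((1 - 12 * m) * (1 - 3 * m))).
  - rewrite <- Rmult_assoc; apply Rmult_le_compat_r; [nra|exact S1].
  - replace (c * (g * g') * ((1 - 12 * m) * (1 - 3 * m))) with (c * g * (g' * ((1 - 12 * m) * (1 - 3 * m)))) by ring.
    replace ((1 + 3 * m) * (c * (g * g))) with (c * g * ((1 + 3 * m) * g)) by ring.
    apply Rmult_le_compat_l; [now apply Rmult_le_pos|exact Rt]. }
eapply Rle_trans; [|exact S2]; apply Rmult_le_compat_l; [exact F0|].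
(* Five losses combine into 33: a factor 1 - 12 m from each of the two kernel estimates and three
   factors 1 - 3 m. *)
assert (K1 : 1 - 6 * m <= (1 - 3 * m) * (1 - 3 * m)) by nra.
assert (K2 : 1 - 18 * m <= (1 - 12 * m) * ((1 - 3 * m) * (1 - 3 * m))) by nra.
apply Rle_trans with ((1 - 18 * m) * (1 - 15 * m)); [nra|apply Rmult_le_compat; lra].
Qed.

(** * Passage to the open annulus by rescaling *)

Lemma rcont_RtoC (f : R -> R) t : continuous f t -> rcont (fun s => RtoC (f s)) t.
Proof. intros H; apply (rcont_pair f (fun _ => 0)); [exact H|apply continuous_const]. Qed.

Lemma continuous_pow_comp (f : R -> R) n t : continuous f t -> continuous (fun s => f s ^ n) t.
Proof.
intros H; induction n as [|n IH]; [apply continuous_const|].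
apply (continuous_mult (K := R_AbsRing) f (fun s => f s ^ n)); assumption.
Qed.

Lemma rcont_qprod (q : R -> R) N (x : R -> C) t : continuous q t -> rcont x t -> rcont (fun s => qprod (q s) N (x s)) t.
Proof.
intros Hq Hx; induction N as [|n IH]; [exact (rcont_const (RtoC 1) t)|].
apply (rcont_mult (fun s => qprod (q s) n (x s)) (fun s => 1 - RtoC (q s ^ S n) * x s)%C); [exact IH|].
apply rcont_minus; [apply rcont_const|].
apply rcont_mult; [|exact Hx]; now apply rcont_RtoC, continuous_pow_comp.
Qed.

Lemma rcont_theta (q : R -> R) N (x : R -> C) t : continuous q t -> rcont x t -> x t <> 0%C ->
  rcont (fun s => theta (q s) N (x s)) t.
Proof.
intros Hq Hx Nx; apply rcont_mult; [apply rcont_minus; [apply rcont_const|exact Hx]|].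
apply rcont_mult; apply rcont_qprod; try assumption; now apply rcont_inv.
Qed.

(** Continuity in the scaling factor at 1 lets the estimates on rescaled annuli pass to the limit.
    The factor enters the parameter of [theta], its arguments and the point. *)
Lemma f0_scale_cont (s z : R) (N : nat) : 0 < s < 1 -> s * s < z < 1 ->
  continuous (fun l => Cmod (f0 (s * l) N (RtoC (z * l)))) 1.
Proof.
intros Hs Hz; destruct (region_z s Hs z Hz) as [R1 R2].
destruct (gred_factors s N Hs (RtoC z) R1) as [H0 [H1 H2]].
assert (Cl : forall c : R, continuous (fun l => c * l) 1).
{ intros c; apply (continuous_mult (K := R_AbsRing) (fun _ => c) (fun l => l)); [apply continuous_const|apply continuous_id]. }
assert (Cs : forall c : R, rcont (fun l => RtoC (c * l)) 1) by (intros c; apply rcont_RtoC, Cl).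
assert (Ci : continuous (fun l => / (s * l)) 1).
{ apply continuity_pt_filterlim, continuity_pt_inv; [apply continuity_pt_filterlim, Cl|lra]. }
assert (Cth : forall c : R -> R, continuous c 1 -> c 1 * z <> 0 ->
  rcont (fun l => theta ((s * l) ^ 4) N (RtoC (c l) * RtoC (z * l))%C) 1).
{ intros c Hc Nc; apply rcont_theta; [apply continuous_pow_comp, Cl|apply rcont_mult; [now apply rcont_RtoC|apply Cs]|].
  rewrite <- RtoC_mult; apply RtoC_neq0; rewrite Rmult_1_r; exact Nc. }
assert (Ct : rcont (fun l => theta ((s * l) ^ 4) N (RtoC (- / (s * l)) * RtoC (z * l)) /
  theta ((s * l) ^ 4) N (RtoC (- (s * l)) * RtoC (z * l)))%C 1).
{ assert (Op : forall c : R -> R, continuous c 1 -> continuous (fun l => - c l) 1).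
  { intros c Hc; apply (continuous_opp (V := R_NormedModule)); exact Hc. }
  assert (Is : 0 < / (s * 1)) by (apply Rinv_0_lt_compat; lra).
  apply rcont_mult.
  - apply (Cth (fun l => - / (s * l))); [apply Op, Ci|nra].
  - apply rcont_inv; [apply (Cth (fun l => - (s * l))); [apply Op, Cl|nra]|].
    rewrite !Rmult_1_r; exact H2. }
apply rcont_Cmod.
assert (E : forall l, f0 (s * l) N (RtoC (z * l)) =
  (RtoC (s * l * (s * l)) * / RtoC (z * l) *
   (theta ((s * l) ^ 4) N (RtoC (- / (s * l)) * RtoC (z * l)) /
    theta ((s * l) ^ 4) N (RtoC (- (s * l)) * RtoC (z * l)) *
    (theta ((s * l) ^ 4) N (RtoC (- / (s * l)) * RtoC (z * l)) /
    theta ((s * l) ^ 4) N (RtoC (- (s * l)) * RtoC (z * l)))))%C).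
{ intros l; unfold f0; rewrite gfun_theta; reflexivity. }
intros e He.
assert (H : rcont (fun l => RtoC (s * l * (s * l)) * / RtoC (z * l) *
   (theta ((s * l) ^ 4) N (RtoC (- / (s * l)) * RtoC (z * l)) /
    theta ((s * l) ^ 4) N (RtoC (- (s * l)) * RtoC (z * l)) *
    (theta ((s * l) ^ 4) N (RtoC (- / (s * l)) * RtoC (z * l)) /
    theta ((s * l) ^ 4) N (RtoC (- (s * l)) * RtoC (z * l)))))%C 1).
{ apply rcont_mult; [apply rcont_mult|now apply rcont_mult].
  - apply rcont_RtoC, (continuous_mult (K := R_AbsRing)); apply Cl.
  - apply rcont_inv; [apply Cs|]; rewrite Rmult_1_r; exact H0. }
destruct (H e He) as [d [D Hd]]; exists d; split; [exact D|]; intros l Hl.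
rewrite 2!E; now apply Hd.
Qed.

Lemma continuous_lt_near (f : R -> R) (t c : R) : continuous f t -> f t < c ->
  exists d, 0 < d /\ forall l, Rabs (l - t) < d -> f l < c.
Proof.
intros Hf H; destruct (proj2 (continuous_eps f t) Hf (c - f t)) as [d [D Hd]]; [lra|].
exists d; split; [exact D|]; intros l Hl; specialize (Hd l Hl); apply Rabs_def2 in Hd; lra.
Qed.

Lemma continuous_linear c t : continuous (fun l => c * l) t.
Proof.
apply (continuous_mult (K := R_AbsRing) (fun _ => c) (fun l => l)); [apply continuous_const|apply continuous_id].
Qed.

(* Shrinking the annulus by the factor [l > 1] makes [f] regular up to the boundary and keeps
   the critical circle in the middle of the annulus. *)
Lemma zero_on_circle_bound_open (s z x : R) (N : nat) (f : C -> C) (w : C) :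
  0 < s < 1 -> s * s < z < 1 -> s < x < 1 -> (s ^ 4) ^ N < 1 / 400 ->
  (forall u, s * s < Cmod u < 1 -> u <> RtoC (- x) -> cdiff f u /\ Cmod (f u) <= 1) ->
  Cmod w = s -> f w = 0%C ->
  Cmod (f (RtoC z)) * (1 - 33 * (s ^ 4) ^ N) <= (1 + 3 * (s ^ 4) ^ N) * Cmod (f0 s N (RtoC z)).
Proof.
intros Hs Hz Hx Hm Hf Hw Hfw.
assert (Hmp : 0 < (s ^ 4) ^ N) by (apply pow_lt, pow_lt; lra).
(* The point z may itself be the zero w on the critical circle; the left side is then 0. *)
destruct (excluded_middle_informative (w = RtoC z)) as [E|Nwz].
{ rewrite <- E, Hfw, Cmod_0, Rmult_0_l; apply Rmult_le_pos; [lra|apply Cmod_ge_0]. }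
assert (Cl := continuous_linear).
set (m := fun l => ((s * l) ^ 4) ^ N).
assert (Cm : continuous m 1) by (apply continuous_pow_comp, continuous_pow_comp, Cl).
pose (H := fun l => Cmod (f (RtoC z)) * (1 - 33 * m l) - (1 + 3 * m l) * Cmod (f0 (s * l) N (RtoC (z * l)))).
assert (CH : continuous H 1).
{ apply (continuous_minus (fun l => Cmod (f (RtoC z)) * (1 - 33 * m l))
    (fun l => (1 + 3 * m l) * Cmod (f0 (s * l) N (RtoC (z * l))))).
  - apply (continuous_mult (K := R_AbsRing) (fun _ => Cmod (f (RtoC z))) (fun l => 1 - 33 * m l)); [apply continuous_const|].
    apply (continuous_minus (fun _ => 1) (fun l => 33 * m l)); [apply continuous_const|].
    apply (continuous_mult (K := R_AbsRing) (fun _ => 33) m); [apply continuous_const|exact Cm].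
  - apply (continuous_mult (K := R_AbsRing) (fun l => 1 + 3 * m l)); [|now apply f0_scale_cont].
    apply (continuous_plus (fun _ => 1) (fun l => 3 * m l)); [apply continuous_const|].
    apply (continuous_mult (K := R_AbsRing) (fun _ => 3) m); [apply continuous_const|exact Cm]. }
destruct (continuous_lt_near (fun l => s * l) 1 1 (Cl s 1)) as [d1 [D1 H1]]; [lra|].
destruct (continuous_lt_near (fun l => z * l) 1 1 (Cl z 1)) as [d2 [D2 H2]]; [lra|].
destruct (continuous_lt_near (fun l => x * l) 1 1 (Cl x 1)) as [d3 [D3 H3]]; [lra|].
destruct (continuous_lt_near (fun l => (s * s) * l) 1 z (Cl (s * s) 1)) as [d4 [D4 H4]]; [lra|].
destruct (continuous_lt_near m 1 (1 / 400) Cm) as [d5 [D5 H5]]; [unfold m; rewrite Rmult_1_r; exact Hm|].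
set (d := Rmin (Rmin d1 d2) (Rmin (Rmin d3 d4) d5)).
assert (D : 0 < d) by (unfold d; repeat (apply Rmin_glb_lt; try assumption)).
assert (E1 : d <= d1) by min_le; assert (E2 : d <= d2) by min_le; assert (E3 : d <= d3) by min_le.
assert (E4 : d <= d4) by min_le; assert (E5 : d <= d5) by min_le.
assert (HH : forall l, 1 < l < 1 + d -> H l <= 0).
{ intros l Hl; assert (Al : Rabs (l - 1) < d) by (apply Rabs_def1; lra).
  specialize (H1 l ltac:(lra)); specialize (H2 l ltac:(lra)); specialize (H3 l ltac:(lra)).
  specialize (H4 l ltac:(lra)); specialize (H5 l ltac:(lra)).
  assert (Hl0 := RtoC_neq0 l ltac:(lra)).
  assert (s2 : 0 < s * s < s) by nra.
  (* Scaling by l carries the open annulus to s^2 l < |u| < l, which contains the closed annulus (s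
     l)^2 <= |u| <= 1 with critical radius s l. *)
  assert (B := zero_on_circle_bound (s * l) (z * l) (x * l) (s * s * l) l N
    (fun u => f (RtoC (/ l) * u))%C (RtoC l * w)%C).
  assert (Ez : (RtoC (/ l) * RtoC (z * l))%C = RtoC z).
  { rewrite <- RtoC_mult; f_equal; field; lra. }
  assert (Ew : (RtoC (/ l) * (RtoC l * w))%C = w).
  { rewrite RtoC_inv by lra; field; exact Hl0. }
  assert (Hlw : forall v : R, (RtoC l * w)%C = RtoC (v * l) -> w = RtoC v).
  { intros v Ev; rewrite <- Ew, Ev, <- RtoC_mult; f_equal; field; lra. }
  unfold H; cut (Cmod (f (RtoC z)) * (1 - 33 * m l) <= (1 + 3 * m l) * Cmod (f0 (s * l) N (RtoC (z * l)))); [lra|].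
  cbv beta in B; rewrite Ez in B; apply B.
  - split; [nra|exact H1].
  - split; [|exact H2].
    replace (s * l * (s * l)) with (s * s * l * l) by ring; apply Rmult_lt_compat_r; lra.
  - split; [|exact H3].
    apply Rlt_trans with (s * l); [|apply Rmult_lt_compat_r; lra].
    rewrite <- (Rmult_1_r (s * l)) at 3; apply Rmult_lt_compat_l; [nra|exact H1].
  - left; exact H5.
  - assert (0 < s * s * l) by (apply Rmult_lt_0_compat; lra).
    replace (s * l * (s * l)) with (s * s * l * l) by ring; nra.
  - lra.
  - intros u Hu Nu.
    assert (Il : 0 < / l) by (apply Rinv_0_lt_compat; lra).
    assert (Eu : Cmod (RtoC (/ l) * u) = / l * Cmod u) by (rewrite Cmod_mult, Cmod_R, Rabs_pos_eq; lra).
    assert (Ru : s * s < Cmod (RtoC (/ l) * u) < 1).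
    { rewrite Eu; split.
      - apply Rle_lt_trans with (/ l * (s * s * l)); [right; field; lra|apply Rmult_lt_compat_l; lra].
      - apply Rlt_le_trans with (/ l * l); [apply Rmult_lt_compat_l; lra|rewrite Rinv_l; lra]. }
    assert (Nu' : (RtoC (/ l) * u)%C <> RtoC (- x)).
    { intros F; apply Nu; replace u with (RtoC l * (RtoC (/ l) * u))%C by (rewrite RtoC_inv by lra; field; exact Hl0).
      rewrite F, <- RtoC_mult; f_equal; ring. }
    destruct (Hf _ Ru Nu') as [F1 F2]; split; [|exact F2].
    now apply (cdiff_rot f (RtoC (/ l)) u).
  - rewrite Cmod_mult, Cmod_R, Rabs_pos_eq, Hw by lra; ring.
  - intros F; apply Nwz, (Hlw z F).
  - intros F; replace (- (x * l)) with ((- x) * l) in F by ring; apply Hlw in F.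
    rewrite F, Cmod_R, Rabs_Ropp, Rabs_pos_eq in Hw by lra; lra.
  - rewrite Ew; exact Hfw. }
assert (H1' : H 1 <= 0).
{ destruct (Rle_lt_dec (H 1) 0) as [L|L]; [exact L|exfalso].
  destruct (proj2 (continuous_eps H 1) CH (H 1) L) as [e [He Hd]].
  assert (M0 : 0 < Rmin d e) by (now apply Rmin_glb_lt).
  assert (Rmin d e <= d) by apply Rmin_l; assert (Rmin d e <= e) by apply Rmin_r.
  specialize (Hd (1 + Rmin d e / 2) ltac:(apply Rabs_def1; lra)); apply Rabs_def2 in Hd.
  specialize (HH (1 + Rmin d e / 2) ltac:(lra)); lra. }
unfold H, m in H1'; rewrite !Rmult_1_r in H1'; lra.
Qed.

(** * Values on the real axis *)

Fixpoint qprodR (q : R) (N : nat) (y : R) : R :=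
  match N with
  | O => 1
  | S n => qprodR q n y * (1 - q ^ S n * y)
  end.

Lemma qprod_R q N y : qprod q N (RtoC y) = RtoC (qprodR q N y).
Proof.
induction N as [|n IH]; [reflexivity|].
change (qprod q n (RtoC y) * (1 - RtoC (q ^ S n) * RtoC y) = RtoC (qprodR q n y * (1 - q ^ S n * y)))%C.
rewrite IH, RtoC_mult, RtoC_minus, RtoC_mult; reflexivity.
Qed.

Definition thetaR (q : R) (N : nat) (y : R) : R := (1 - y) * (qprodR q N y * qprodR q N (/ y)).

Lemma theta_R q N y : y <> 0 -> theta q N (RtoC y) = RtoC (thetaR q N y).
Proof.
intros Hy; unfold theta, phi, thetaR; rewrite <- RtoC_inv, 2!qprod_R by exact Hy.
rewrite 2!RtoC_mult, RtoC_minus; reflexivity.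
Qed.

Lemma qprodR_factor q n y : 0 < q < 1 -> 0 <= y -> q * y < 1 -> 0 <= q ^ S n * y <= q * y.
Proof.
intros Hq Hy Hqy; assert (P := pow_le_self q n ltac:(lra)).
assert (0 < q ^ S n) by (apply pow_lt; lra).
split; [nra|apply Rmult_le_compat_r; lra].
Qed.

Lemma qprodR_le1 q N y : 0 < q < 1 -> 0 <= y -> q * y < 1 -> 0 < qprodR q N y <= 1.
Proof.
intros Hq Hy Hqy; induction N as [|n IH]; [simpl; lra|].
change (qprodR q (S n) y) with (qprodR q n y * (1 - q ^ S n * y)).
assert (F := qprodR_factor q n y Hq Hy Hqy); nra.
Qed.

Lemma one_minus_ge_exp u v : 0 <= u <= v -> v < 1 -> exp (- (u / (1 - v))) <= 1 - u.
Proof.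
intros Hu Hv.
assert (E := exp_ineq1_le (u / (1 - v))).
assert (F : / (1 - u) <= 1 + u / (1 - v)).
{ apply Rle_trans with (1 + u / (1 - u)); [right; field; lra|].
  apply Rplus_le_compat_l, Rmult_le_compat_l; [lra|apply Rinv_le_contravar; lra]. }
rewrite exp_Ropp, <- (Rinv_inv (1 - u)); apply Rinv_le_contravar; [apply Rinv_0_lt_compat; lra|lra].
Qed.

(** With K = y / (1 - q y) the n-th factor is at least exp (- q^n K), and the exponents form a
    geometric series. The bound has to be uniform because N is chosen only after it. *)
Lemma qprodR_lower q y : 0 < q < 1 -> 0 <= y -> q * y < 1 -> exists c, 0 < c /\ forall N, c <= qprodR q N y.
Proof.
intros Hq Hy Hqy; set (K := y / (1 - q * y)).
assert (HK : 0 <= K) by (apply Rmult_le_pos; [exact Hy|left; apply Rinv_0_lt_compat; lra]).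
assert (H : forall N, exp (- (K * (q * (1 - q ^ N) / (1 - q)))) <= qprodR q N y).
{ intros N; induction N as [|n IH].
  - simpl; replace (- (K * (q * (1 - 1) / (1 - q)))) with 0 by (field; lra); rewrite exp_0; lra.
  - change (qprodR q (S n) y) with (qprodR q n y * (1 - q ^ S n * y)).
    replace (- (K * (q * (1 - q ^ S n) / (1 - q)))) with
      (- (K * (q * (1 - q ^ n) / (1 - q))) + - (q ^ S n * y / (1 - q * y))).
    2:{ unfold K; simpl; field; lra. }
    rewrite exp_plus; apply Rmult_le_compat; try (left; apply exp_pos); [exact IH|].
    apply one_minus_ge_exp; [|exact Hqy]; now apply qprodR_factor. }
exists (exp (- (K * (q / (1 - q))))); split; [apply exp_pos|]; intros N.
eapply Rle_trans; [|apply H]; apply exp_mono, Ropp_le_contravar, Rmult_le_compat_l; [exact HK|].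
apply Rmult_le_compat_r; [left; apply Rinv_0_lt_compat; lra|].
assert (0 < q ^ N) by (apply pow_lt; lra); nra.
Qed.

Definition gr (s : R) (N : nat) (v : R) : R := thetaR (s ^ 4) N (- / s * v) / thetaR (s ^ 4) N (- s * v).

(** On the real axis [f0] is s^2 / v times a square, hence cannot have the sign opposite to v. This
    is the source of the sign at p. *)
Lemma f0_R s N v : 0 < s < 1 -> s * s < Rabs v < 1 ->
  f0 s N (RtoC v) = RtoC (s * s / v * (gr s N v * gr s N v)).
Proof.
intros Hs Hv; assert (Hv0 : v <> 0) by (intros E; rewrite E, Rabs_R0 in Hv; nra).
assert (Hr : s * s * s < Cmod (RtoC v) < / s).
{ assert (Is : 1 < / s) by (apply inv_gt1; lra); rewrite Cmod_R.
  assert (0 < s * s) by nra; nra. }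
destruct (gred_factors s N Hs _ Hr) as [_ [_ D]].
assert (Hs1 : - / s * v <> 0).
{ apply Rmult_integral_contrapositive_currified; [|exact Hv0].
  assert (0 < / s) by (apply Rinv_0_lt_compat; lra); lra. }
assert (Hs2 : - s * v <> 0) by (apply Rmult_integral_contrapositive_currified; [lra|exact Hv0]).
unfold f0; rewrite gfun_theta, <- 2!RtoC_mult, 2!theta_R by assumption.
rewrite <- RtoC_mult, theta_R in D by assumption.
assert (D' : thetaR (s ^ 4) N (- s * v) <> 0) by (intros E; apply D; now rewrite E).
unfold gr; rewrite (RtoC_mult (s * s / v)), (RtoC_mult (_ / _) (_ / _)), 2!RtoC_div by assumption.
reflexivity.
Qed.

(** The factor y - 1 with y = x / s is positive because - x lies outside the critical circle, away
    from the zero - s. The other numerator factors are bounded below by [qprodR_lower], and the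
    denominator is at most 1. *)
Lemma gr_lower s x : 0 < s < 1 -> s < x < 1 -> exists c, 0 < c /\ forall N, c <= Rabs (gr s N (- x)).
Proof.
intros Hs Hx; destruct (q_bounds s Hs) as [Q1 [Q2 [Q3 [Q4 Q5]]]]; set (q := s ^ 4) in *.
assert (Is : 1 < / s) by (apply inv_gt1; lra).
set (y := / s * x); set (y' := s * x).
assert (Hy : 1 < y).
{ unfold y; apply Rle_lt_trans with (/ s * s); [rewrite Rinv_l; lra|apply Rmult_lt_compat_l; lra]. }
assert (Hqy : q * y < 1).
{ unfold y, q; replace (s ^ 4 * (/ s * x)) with (s * s * s * x) by (field; lra); nra. }
assert (Hy' : 0 < y' < 1) by (unfold y'; nra).
assert (Hiy : 0 < / y < 1).
{ split; [apply Rinv_0_lt_compat; lra|rewrite <- Rinv_1; apply Rinv_lt_contravar; lra]. }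
assert (Hqiy' : q * / y' < 1).
{ unfold y'; apply Rmult_lt_reg_r with (s * x); [nra|]; rewrite Rmult_assoc, Rinv_l by nra.
  assert (s * s < s * x) by nra; lra. }
destruct (qprodR_lower q y) as [c1 [C1 L1]]; [lra..|].
destruct (qprodR_lower q (/ y)) as [c2 [C2 L2]]; [lra|lra|nra|].
assert (Hiy' : 0 < / y') by (apply Rinv_0_lt_compat; lra).
exists ((y - 1) * (c1 * c2)); split; [repeat apply Rmult_lt_0_compat; lra|]; intros N.
unfold gr; fold q; replace (- / s * - x) with y by (unfold y; ring); replace (- s * - x) with y' by (unfold y'; ring).
assert (D1 := qprodR_le1 q N y' Q1 ltac:(lra) ltac:(nra)); assert (D2 := qprodR_le1 q N (/ y') Q1 ltac:(lra) Hqiy').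
assert (T' : 0 < thetaR q N y' <= 1).
{ unfold thetaR; assert (0 < qprodR q N y' * qprodR q N (/ y') <= 1) by nra; nra. }
assert (T : (y - 1) * (c1 * c2) <= Rabs (thetaR q N y)).
{ unfold thetaR; rewrite Rabs_mult, (Rabs_left (1 - y)) by lra.
  specialize (L1 N); specialize (L2 N); rewrite Rabs_pos_eq by nra.
  replace (- (1 - y)) with (y - 1) by ring; apply Rmult_le_compat_l; [lra|apply Rmult_le_compat; lra]. }
unfold Rdiv; rewrite Rabs_mult, (Rabs_pos_eq (/ _)) by (left; apply Rinv_0_lt_compat; lra).
eapply Rle_trans; [exact T|].
rewrite <- (Rmult_1_r (Rabs (thetaR q N y))) at 1; apply Rmult_le_compat_l; [apply Rabs_pos|].
rewrite <- Rinv_1; apply Rinv_le_contravar; lra.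
Qed.

Lemma mob_R_neg a b : 0 <= a < 1 -> 0 <= b < 1 ->
  Cmod (mob (RtoC a) (RtoC (- b))) = (a + b) / (1 + a * b).
Proof.
intros Ha Hb; unfold mob; rewrite Cconj_R, <- RtoC_mult, <- 2!RtoC_minus.
rewrite <- RtoC_div by nra.
rewrite Cmod_R; replace ((- b - a) / (1 - a * - b)) with (- ((a + b) / (1 + a * b))) by (field; nra).
rewrite Rabs_Ropp, Rabs_pos_eq; [reflexivity|].
apply Rmult_le_pos; [lra|left; apply Rinv_0_lt_compat; nra].
Qed.

Lemma mob_0 a : Cmod (mob a 0) = Cmod a.
Proof.
unfold mob; replace ((0 - a) / (1 - Cconj a * 0))%C with (- a)%C by (field; intros E; apply C1_nz; rewrite <- E; ring).
apply Cmod_opp.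
Qed.

(* If there were no gap, a Moebius image of a multiple of [f0] would exceed [sg] at [-x]. *)
Lemma critical_circle_gap (s z x sg : R) (A : C -> Prop) : 0 < s < 1 -> s * s < z < 1 -> s < x < 1 ->
  (forall u, A u <-> s * s < Cmod u < 1) -> sg < 1 ->
  (forall f, hol A f -> maps_to A unit_disc f -> f (RtoC z) = 0%C -> Cmod (f (RtoC (- x))) <= sg) ->
  exists l, 0 <= l < sg /\ forall f w,
    (forall u, A u -> u <> RtoC (- x) -> cdiff f u /\ Cmod (f u) < 1) -> f (RtoC z) = 0%C ->
    Cmod w = s -> Cmod (f w) <= l.
Proof.
intros Hs Hz Hx HA Hsg Hsup; destruct (q_bounds s Hs) as [Q1 [Q2 [Q3 [Q4 Q5]]]].
destruct (gr_lower s x Hs Hx) as [c [Hc Lc]].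
set (be := s * s / x * (c * c)).
assert (Hbe : 0 < be) by (apply Rmult_lt_0_compat; [apply Rdiv_lt_0_compat|]; nra).
assert (Az : A (RtoC z)) by (apply HA; rewrite Cmod_R, Rabs_pos_eq; lra).
assert (Ax : A (RtoC (- x))) by (apply HA; rewrite Cmod_R, Rabs_Ropp, Rabs_pos_eq; lra).
assert (Hsg0 : 0 <= sg).
{ assert (H := Hsup (fun _ => 0%C)); cbv beta in H; rewrite Cmod_0 in H; apply H; auto.
  - intros u _; apply cdiff_const.
  - intros u _; unfold unit_disc; rewrite Cmod_0; lra. }
(* [be] bounds b0 below for every N, and b >= be / 2, so t is a guaranteed gap. N is fixed only now:
   the truncation errors add up to at most 76 m, below t / 2 when m < t / 200. *)
set (t := be * (1 - sg * sg) / 2).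
assert (Ht : 0 < t) by (unfold t; apply Rdiv_lt_0_compat; [apply Rmult_lt_0_compat|]; nra).
destruct (pow_lt_1_zero (s ^ 4) ltac:(rewrite Rabs_pos_eq; lra) (Rmin (1 / 800) (t / 200))) as [N HN].
{ apply Rmin_glb_lt; lra. }
specialize (HN N (Nat.le_refl N)); rewrite Rabs_pos_eq in HN by (apply pow_le; lra).
assert (M1 := lt_min_l _ _ _ HN); assert (M2 := lt_min_r _ _ _ HN).
set (m := (s ^ 4) ^ N) in *; assert (M0 : 0 < m) by (apply pow_lt; lra).
set (a0 := s * s / z * (gr s N z * gr s N z)); set (b0 := s * s / x * (gr s N (- x) * gr s N (- x))).
assert (Ea : f0 s N (RtoC z) = RtoC a0) by (apply f0_R; [exact Hs|rewrite Rabs_pos_eq; lra]).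
assert (Eb : f0 s N (RtoC (- x)) = RtoC (- b0)).
{ rewrite f0_R; [|exact Hs|rewrite Rabs_Ropp, Rabs_pos_eq; lra]; f_equal; unfold b0; field; lra. }
assert (a00 : 0 <= a0).
{ unfold a0; apply Rmult_le_pos; [apply Rlt_le, Rdiv_lt_0_compat; nra|nra]. }
assert (b00 : be <= b0).
{ unfold be, b0; apply Rmult_le_compat_l; [apply Rlt_le, Rdiv_lt_0_compat; nra|].
  specialize (Lc N); rewrite <- (Rabs_pos_eq (gr s N (- x) * gr s N (- x))) by nra.
  rewrite Rabs_mult; apply Rmult_le_compat; lra. }
(* Since |f0| <= 1 + 40 m, this factor brings [f0] strictly inside the disc. *)
set (k := 1 - 40 * m).
assert (Hf0 : forall u, A u -> Cmod (RtoC k * f0 s N u) < 1).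
{ intros u Hu; rewrite HA in Hu; rewrite Cmod_mult, Cmod_R, Rabs_pos_eq by (unfold k; lra).
  assert (B := f0_bound s N Hs ltac:(fold m; lra) u Hu); fold m in B; unfold k; nra. }
assert (Ha1 : 0 <= k * a0 < 1).
{ split; [apply Rmult_le_pos; unfold k; lra|].
  assert (H := Hf0 _ Az); rewrite Ea, <- RtoC_mult, Cmod_R in H; eapply Rle_lt_trans; [apply Rle_abs|exact H]. }
assert (Hb1 : 0 <= k * b0 < 1).
{ split; [apply Rmult_le_pos; unfold k; lra|].
  assert (H := Hf0 _ Ax); rewrite Eb, <- RtoC_mult, Cmod_R in H; eapply Rle_lt_trans; [apply Rle_abs|].
  rewrite <- Rabs_Ropp; replace (- (k * b0)) with (k * - b0) by ring; exact H. }
set (a := k * a0) in *; set (b := k * b0) in *.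
assert (Hka : (RtoC k * f0 s N (RtoC z))%C = RtoC a) by (rewrite Ea, <- RtoC_mult; reflexivity).
assert (Hkb : (RtoC k * f0 s N (RtoC (- x)))%C = RtoC (- b)).
{ rewrite Eb, <- RtoC_mult; f_equal; unfold b; ring. }
assert (S1 : (a + b) / (1 + a * b) <= sg).
{ rewrite <- mob_R_neg, <- Hkb, <- Hka by assumption.
  apply (Hsup (fun u => mob (RtoC k * f0 s N (RtoC z)) (RtoC k * f0 s N u))%C).
  - intros u Hu; apply (mob_cdiff (fun u => RtoC k * f0 s N u)%C); [|now apply Hf0|now apply Hf0].
    apply cdiff_mult; [apply cdiff_const|apply f0_cdiff; [exact Hs|]].
    assert (Is : 1 < / s) by (apply inv_gt1; lra).
    rewrite HA in Hu; lra.
  - intros u Hu; apply mob_lt1; now apply Hf0.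
  - apply mob_self. }
assert (S2 : a + b <= sg * (1 + a * b)).
{ apply Rmult_le_reg_r with (/ (1 + a * b)); [apply Rinv_0_lt_compat; nra|].
  rewrite Rmult_assoc, Rinv_r, Rmult_1_r by nra; exact S1. }
(* [S2] says a <= (sg - b) / (1 - sg b), which equals sg - b (1 - sg^2) / (1 - sg b), and 0 < 1 - sg
   b <= 1. *)
assert (S3 : a <= sg - b * (1 - sg * sg)).
{ destruct (Rle_lt_dec a (sg - b * (1 - sg * sg))) as [L|L]; [exact L|exfalso].
  assert (P1 : 0 < 1 - sg * b) by nra.
  assert (P3 : 0 <= sg * (b * b) * (1 - sg * sg)).
  { apply Rmult_le_pos; [apply Rmult_le_pos; nra|nra]. }
  nra. }
assert (S4 : t <= b * (1 - sg * sg)).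
{ unfold t, b; assert (be / 2 <= k * b0) by (unfold k; nra).
  assert (0 <= 1 - sg * sg) by nra; nra. }
exists (Rmax 0 (sg - t / 2)); split; [split; [apply Rmax_l|apply Rmax_lub_lt; [|lra]]|].
{ assert (0 <= a) by lra; lra. }
intros f w Hf Hfz Hw.
assert (Aw : A w) by (apply HA; rewrite Hw; lra).
assert (Nw : w <> RtoC (- x)).
{ intros E; rewrite E, Cmod_R, Rabs_Ropp, Rabs_pos_eq in Hw by lra; lra. }
assert (Fw := proj2 (Hf w Aw Nw)).
(* The Moebius map sending f w to 0 exchanges the roles of the two points: its composite with f
   vanishes at w and has modulus |f w| at z. *)
assert (B := zero_on_circle_bound_open s z x N (fun u => mob (f w) (f u)) w Hs Hz Hx).
cbv beta in B; fold m in B; rewrite Hfz, mob_0, Ea, Cmod_R, Rabs_pos_eq in B by exact a00.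
assert (B' : Cmod (f w) * (1 - 33 * m) <= (1 + 3 * m) * a0).
{ apply B; [lra| |exact Hw|apply mob_self].
  intros u Hu Nu; rewrite <- HA in Hu; destruct (Hf u Hu Nu) as [F1 F2]; split.
  - now apply mob_cdiff.
  - left; now apply mob_lt1. }
eapply Rle_trans; [|apply Rmax_r].
set (F := Cmod (f w)) in *; assert (F0 : 0 <= F) by apply Cmod_ge_0.
assert (K1 : F * ((1 - 33 * m) * (1 - 40 * m)) <= (1 + 3 * m) * a).
{ unfold a, k; replace ((1 + 3 * m) * ((1 - 40 * m) * a0)) with ((1 + 3 * m) * a0 * (1 - 40 * m)) by ring.
  rewrite <- Rmult_assoc; apply Rmult_le_compat_r; lra. }
assert (K2 : F * (1 - 73 * m) <= (1 + 3 * m) * a).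
{ eapply Rle_trans; [|exact K1]; apply Rmult_le_compat_l; [exact F0|nra]. }
assert (K3 : a * (1 + 3 * m) <= (sg - t) * (1 + 3 * m)) by (apply Rmult_le_compat_r; lra).
assert (K4 : F * m <= m) by nra.
assert (K5 : (sg - t) * m <= m) by nra.
lra.
Qed.

(** * Topology of curves around the origin *)

Lemma continuous_on_interval (g : R -> C) : (forall t, unit_interval t -> rcont g t) ->
  continuous_on unit_interval g.
Proof.
intros H t Ht; apply (filterlim_locally (F := within unit_interval (locally t)) g); intros eps.
destruct (H t Ht eps (cond_pos eps)) as [d [D Hd]].
exists (mkposreal d D); intros s Hs _; specialize (Hd s Hs).
split; [eapply Rle_lt_trans; [apply (Rabs_fst_le (g s - g t))|exact Hd]|].
eapply Rle_lt_trans; [apply (Rabs_snd_le (g s - g t))|exact Hd].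
Qed.

Lemma continuous_on_square (h : R * R -> C) :
  (forall x, unit_square x -> forall eps, 0 < eps -> exists d, 0 < d /\ forall y, unit_square y ->
    Rabs (fst y - fst x) < d -> Rabs (snd y - snd x) < d -> Cmod (h y - h x) < eps) <->
  continuous_on unit_square h.
Proof.
split; intros H x Hx.
- apply (filterlim_locally (F := within unit_square (locally x)) h); intros eps.
  destruct (H x Hx eps (cond_pos eps)) as [d [D Hd]].
  exists (mkposreal d D); intros y [Hy1 Hy2] Sy; specialize (Hd y Sy Hy1 Hy2).
  split; [eapply Rle_lt_trans; [apply (Rabs_fst_le (h y - h x))|exact Hd]|].
  eapply Rle_lt_trans; [apply (Rabs_snd_le (h y - h x))|exact Hd].
- intros eps He.
  assert (He2 : 0 < eps / 2) by lra.
  destruct (proj1 (filterlim_locally (F := within unit_square (locally x)) h (h x)) (H x Hx) (mkposreal _ He2)) as [d Hd].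
  exists d; split; [apply cond_pos|]; intros y Sy Y1 Y2.
  destruct (Hd y (conj Y1 Y2) Sy) as [K1 K2].
  change (Rabs (fst (h y) - fst (h x)) < eps / 2) in K1; change (Rabs (snd (h y) - snd (h x)) < eps / 2) in K2.
  eapply Rle_lt_trans; [apply Cmod_le_sum|]; simpl; unfold Rminus in *; lra.
Qed.

(** Retraction of the line onto the unit interval. Composed with it, a homotopy becomes continuous
    on the whole plane and keeps its values in U. *)
Definition clamp (t : R) : R := Rmax 0 (Rmin 1 t).

Lemma clamp_unit t : unit_interval (clamp t).
Proof.
split; [apply Rmax_l|apply Rmax_lub; [lra|apply Rmin_l]].
Qed.

Lemma clamp_id t : unit_interval t -> clamp t = t.
Proof. intros [H1 H2]; unfold clamp; rewrite Rmin_right, Rmax_right by assumption; reflexivity. Qed.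

Lemma clamp_lip s t : Rabs (clamp s - clamp t) <= Rabs (s - t).
Proof.
unfold clamp; destruct (Rle_dec 1 s), (Rle_dec 1 t);
  rewrite ?(Rmin_left 1 s), ?(Rmin_left 1 t), ?(Rmin_right 1 s), ?(Rmin_right 1 t) by lra;
  destruct (Rle_dec 0 s), (Rle_dec 0 t);
  rewrite ?(Rmax_right 0 1), ?(Rmax_right 0 s), ?(Rmax_right 0 t), ?(Rmax_left 0 s), ?(Rmax_left 0 t) by lra;
  unfold Rabs; repeat destruct Rcase_abs; lra.
Qed.

(** An argument for the right half plane is enough, because it is applied to quotients of
    neighbouring points of a loop. *)
Definition arg_right (z : C) : R := atan (snd z / fst z).

Lemma arg_right_spec z : 0 < fst z -> (z = RtoC (Cmod z) * cis (arg_right z))%C.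
Proof.
intros Hz; unfold arg_right, cis; rewrite cos_atan, sin_atan; set (t := snd z / fst z).
assert (Ht : snd z = fst z * t) by (unfold t; field; lra).
assert (P : 0 < 1 + t²) by (generalize (Rle_0_sqr t); lra).
assert (E : Cmod z = fst z * sqrt (1 + t²)).
{ unfold Cmod; rewrite Ht.
  replace (fst z ^ 2 + (fst z * t) ^ 2) with ((fst z)² * (1 + t²)) by (unfold Rsqr; ring).
  rewrite sqrt_mult, sqrt_Rsqr; try lra; apply Rle_0_sqr. }
assert (Q := sqrt_lt_R0 _ P); rewrite E; unfold RtoC, Cmult; simpl.
apply injective_projections; cbn [fst snd]; [field|rewrite Ht; field]; lra.
Qed.

Lemma rcont_arg f t : rcont f t -> 0 < fst (f t) -> continuous (fun s => arg_right (f s)) t.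
Proof.
intros Hf Hp; unfold arg_right.
apply (continuous_comp (fun s => snd (f s) / fst (f s)) atan).
- apply (continuous_mult (K := R_AbsRing)); [now apply rcont_snd|].
  apply continuity_pt_filterlim, continuity_pt_inv; [apply continuity_pt_filterlim; now apply rcont_fst|lra].
- apply continuity_pt_filterlim, derivable_continuous_pt, derivable_pt_atan.
Qed.

Lemma arg_right_cis t : - PI / 2 < t < PI / 2 -> arg_right (cis t) = t.
Proof. intros H; change (atan (tan t) = t); apply atan_tan; lra. Qed.

Section Winding.
Variables (H : R -> R -> C).
Hypothesis Hc : forall t u eps, 0 < eps -> exists d, 0 < d /\
  forall t' u', Rabs (t' - t) < d -> Rabs (u' - u) < d -> Cmod (H t' u' - H t u) < eps.
Hypothesis H0 : forall t u, H t u <> 0%C.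

(** The gauge [D] is chosen so that its value is both the size of a neighbourhood and a lower bound
    for the modulus on it; compactness bounds the gauge values that matter from below. *)
Lemma modulus_lower_bound : exists m, 0 < m /\
  forall t u, 0 <= t <= 1 -> 0 <= u <= 1 -> m <= Cmod (H t u).
Proof.
assert (D : forall t u, { d : posreal | forall t' u', Rabs (t' - t) < d -> Rabs (u' - u) < d -> d <= Cmod (H t' u') }).
{ intros t u; apply constructive_indefinite_description.
  assert (P := proj1 (Cmod_gt_0 _) (H0 t u)).
  destruct (Hc t u (Cmod (H t u) / 2)) as [d [Hd Hd']]; [lra|].
  assert (M : 0 < Rmin d (Cmod (H t u) / 2)) by (apply Rmin_glb_lt; lra).
  exists (mkposreal _ M); simpl; intros t' u' Ht Hu.
  specialize (Hd' t' u' (lt_min_l _ _ _ Ht) (lt_min_l _ _ _ Hu)).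
  eapply Rle_trans; [apply Rmin_r|].
  generalize (Cmod_sub_ge (H t u) (H t' u')); rewrite Cmod_sub_sym; lra. }
destruct (compactness_value_2d 0 1 0 1 (fun t u => proj1_sig (D t u))) as [d Hd].
exists d; split; [apply cond_pos|]; intros t u Ht Hu.
destruct (Rle_lt_dec d (Cmod (H t u))) as [L|L]; [exact L|exfalso].
apply (Hd t u Ht Hu); intros [t0 [u0 [_ [_ [A1 [A2 A3]]]]]].
assert (B := proj2_sig (D t0 u0) t u A1 A2); simpl in B; lra.
Qed.

Lemma ratio_near_one : exists d, 0 < d /\ forall t t' u, 0 <= t <= 1 -> 0 <= t' <= 1 -> 0 <= u <= 1 ->
  Rabs (t' - t) < d -> 0 < fst (H t' u / H t u)%C.
Proof.
destruct modulus_lower_bound as [m [Hm HL]].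
assert (HU : forall pr : C -> R, (forall z w : C, Rabs (pr z - pr w) <= Cmod (z - w)) ->
  exists d, 0 < d /\ forall t t' u, 0 <= t <= 1 -> 0 <= t' <= 1 -> 0 <= u <= 1 -> Rabs (t' - t) < d ->
    Rabs (pr (H t' u) - pr (H t u)) < m / 2).
{ intros pr Hpr.
  destruct (uniform_continuity_2d (fun t u => pr (H t u)) 0 1 0 1) with (mkposreal (m / 2) ltac:(lra)) as [d Hd].
  - intros t u _ _ e; destruct (Hc t u e (cond_pos e)) as [d [D Hd]].
    exists (mkposreal d D); intros t' u' Ht Hu; eapply Rle_lt_trans; [apply Hpr|now apply Hd].
  - exists d; split; [apply cond_pos|]; intros t t' u Ht Ht' Hu Hd'; apply Hd; try assumption.
    rewrite Rminus_diag, Rabs_R0; apply cond_pos. }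
destruct (HU fst) as [d [D H1]]; [intros z w; apply (Rabs_fst_le (z - w))|].
destruct (HU snd) as [d' [D' H2]]; [intros z w; apply (Rabs_snd_le (z - w))|].
exists (Rmin d d'); split; [now apply Rmin_glb_lt|]; intros t t' u Ht Ht' Hu Hd.
specialize (H1 t t' u Ht Ht' Hu (lt_min_l _ _ _ Hd)).
specialize (H2 t t' u Ht Ht' Hu (lt_min_r _ _ _ Hd)).
assert (L : Cmod (H t' u - H t u) < Cmod (H t u)).
{ eapply Rlt_le_trans; [|apply HL; assumption].
  eapply Rle_lt_trans; [apply Cmod_le_sum|]; simpl; unfold Rminus in *; lra. }
assert (E : Cmod (H t' u / H t u - 1) < 1).
{ replace (H t' u / H t u - 1)%C with ((H t' u - H t u) / H t u)%C by (field; apply H0).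
  rewrite Cmod_div by apply H0; assert (P := proj1 (Cmod_gt_0 _) (H0 t u)).
  apply Rmult_lt_reg_r with (Cmod (H t u)); [exact P|].
  unfold Rdiv; rewrite Rmult_assoc, Rinv_l; lra. }
assert (F := Rabs_fst_le (H t' u / H t u - 1)%C).
assert (G : Rabs (fst (H t' u / H t u)%C - 1) < 1) by (eapply Rle_lt_trans; [exact F|exact E]).
apply Rabs_def2 in G; lra.
Qed.

(** Change of argument along the first [k] of [n] grid steps. For k = n, a closed loop and a grid
    fine enough for the variation of [H], it is 2 pi times the winding number around 0. *)
Fixpoint winding (n k : nat) (u : R) : R :=
  match k with
  | O => 0
  | S j => winding n j u + arg_right (H (INR (S j) / INR n) u / H (INR j / INR n) u)%C
  end.

Lemma grid_unit n k : (0 < n)%nat -> (k <= n)%nat -> 0 <= INR k / INR n <= 1.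
Proof.
intros Hn Hk; assert (0 < INR n) by now apply lt_0_INR.
apply le_INR in Hk; assert (0 <= INR k) by apply pos_INR.
split; [apply Rmult_le_pos; [assumption|left; now apply Rinv_0_lt_compat]|].
apply Rmult_le_reg_r with (INR n); [assumption|]; unfold Rdiv; rewrite Rmult_assoc, Rinv_l; lra.
Qed.

Lemma winding_spec n k u : (0 < n)%nat -> (k <= n)%nat ->
  (forall j, (j < n)%nat -> 0 < fst (H (INR (S j) / INR n) u / H (INR j / INR n) u)%C) ->
  (H (INR k / INR n) u * RtoC (Cmod (H 0 u)) =
   H 0 u * RtoC (Cmod (H (INR k / INR n) u)) * cis (winding n k u))%C.
Proof.
intros Hn Hk Hr; induction k as [|j IH].
- simpl INR; replace (0 / INR n) with 0 by (unfold Rdiv; ring); simpl winding.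
  unfold cis; rewrite cos_0, sin_0; fold (RtoC 1); ring.
- specialize (IH ltac:(lia)); specialize (Hr j ltac:(lia)).
  cbn [winding]; rewrite cis_plus.
  set (a := H (INR j / INR n) u) in *; set (b := H (INR (S j) / INR n) u) in *.
  assert (Na : a <> 0%C) by apply H0.
  assert (Pa := proj1 (Cmod_gt_0 _) Na).
  assert (E := arg_right_spec (b / a)%C Hr).
  set (w := cis (arg_right (b / a))) in *; rewrite Cmod_div, RtoC_div in E by (assumption || lra).
  assert (Na' := RtoC_neq0 _ (Rgt_not_eq _ _ Pa)).
  assert (Eb : (b * RtoC (Cmod a) = a * RtoC (Cmod b) * w)%C).
  { transitivity (b / a * (a * RtoC (Cmod a)))%C; [field; exact Na|].
    rewrite E; field; exact Na'. }
  transitivity (b * RtoC (Cmod a) * RtoC (Cmod (H 0 u)) / RtoC (Cmod a))%C; [field; exact Na'|].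
  rewrite Eb; transitivity (RtoC (Cmod b) * w * (a * RtoC (Cmod (H 0 u))) / RtoC (Cmod a))%C; [field; exact Na'|].
  rewrite IH; field; exact Na'.
Qed.

Lemma winding_cont n k u : (forall j, (j < k)%nat -> 0 < fst (H (INR (S j) / INR n) u / H (INR j / INR n) u)%C) ->
  continuous (winding n k) u.
Proof.
intros Hr; induction k as [|j IH]; [apply continuous_const|].
apply (continuous_plus (winding n j) (fun u => arg_right (H (INR (S j) / INR n) u / H (INR j / INR n) u)%C)).
- apply IH; intros i Hi; apply Hr; lia.
- assert (R : forall t, rcont (fun u => H t u) u).
  { intros t e He; destruct (Hc t u e He) as [d [D Hd]]; exists d; split; [exact D|]; intros s Hs.
    apply Hd; [rewrite Rminus_diag, Rabs_R0; exact D|exact Hs]. }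
  apply rcont_arg; [|apply Hr; lia].
  apply rcont_mult; [apply R|apply rcont_inv; [apply R|apply H0]].
Qed.
End Winding.

(** The total change of argument [W] depends continuously on the deformation parameter and has
    cosine 1 because every intermediate loop closes. It starts at 2 pi and ends at 0, so it would
    have to pass pi. *)
Lemma circle_not_null_homotopic (U : C -> Prop) (x : R) : 0 < x -> (forall u, U u -> u <> 0%C) ->
  ~ null_homotopic_in U (fun t => RtoC x * cis (2 * PI * t))%C.
Proof.
intros Hx HU [h [Hc [HhU [Hb [Ht Hs]]]]].
rewrite <- continuous_on_square in Hc.
pose (H := fun t u => h (clamp t, clamp u)).
assert (Sq : forall t u, unit_square (clamp t, clamp u)) by (intros t u; split; apply clamp_unit).
assert (H0 : forall t u, H t u <> 0%C) by (intros t u; apply HU, HhU, Sq).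
assert (HC : forall t u eps, 0 < eps -> exists d, 0 < d /\
  forall t' u', Rabs (t' - t) < d -> Rabs (u' - u) < d -> Cmod (H t' u' - H t u) < eps).
{ intros t u eps He; destruct (Hc _ (Sq t u) eps He) as [d [D Hd]].
  exists d; split; [exact D|]; intros t' u' A B; apply Hd; [apply Sq|..];
    (eapply Rle_lt_trans; [apply clamp_lip|assumption]). }
destruct (ratio_near_one H HC H0) as [d [D Hd]].
destruct (archimed_cor1 d D) as [n0 [Hn0 Pn0]].
(* At least 5 grid steps keep each step of the original circle below the angle pi / 2, where
   [arg_right] recovers it. *)
set (n := (n0 + 5)%nat).
assert (Hn : (0 < n)%nat) by (unfold n; lia).
assert (Pn : 0 < INR n) by now apply lt_0_INR.
assert (Hn5 : 5 <= INR n).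
{ unfold n; rewrite plus_INR; simpl (INR 5); generalize (pos_INR n0); lra. }
assert (Hnd : / INR n < d).
{ eapply Rle_lt_trans; [|exact Hn0]; apply Rinv_le_contravar; [now apply lt_0_INR|].
  unfold n; rewrite plus_INR; generalize (pos_INR 5); lra. }
assert (HR : forall u j, (j < n)%nat -> 0 < fst (H (INR (S j) / INR n)%R u / H (INR j / INR n)%R u)%C).
{ intros u j Hj; assert (Ec : forall t, H t u = H t (clamp u)).
  { intros t; unfold H; now rewrite (clamp_id (clamp u)) by apply clamp_unit. }
  rewrite 2!Ec; apply Hd; try (apply grid_unit; lia); [apply clamp_unit|].
  replace (INR (S j) / INR n - INR j / INR n) with (/ INR n) by (rewrite S_INR; field; lra).
  rewrite Rabs_pos_eq; [exact Hnd|left; now apply Rinv_0_lt_compat]. }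
pose (W := winding H n n).
assert (WC : forall u, continuous W u) by (intros u; apply winding_cont; auto).
assert (Wcos : forall u, cos (W u) = 1).
{ intros u; assert (E := winding_spec H H0 n n u Hn (Nat.le_refl n) (HR u)).
  replace (INR n / INR n) with 1 in E by (field; lra).
  assert (E1 : H 1 u = H 0 u).
  { unfold H; rewrite (clamp_id 1), (clamp_id 0) by (unfold unit_interval; lra).
    destruct (Hs (clamp u) (clamp_unit u)) as [-> ->]; reflexivity. }
  rewrite E1 in E; fold W in E.
  assert (P := proj1 (Cmod_gt_0 _) (H0 0 u)); assert (Nz := RtoC_neq0 _ (Rgt_not_eq _ _ P)).
  assert (E2 : cis (W u) = 1%C).
  { transitivity (H 0 u * RtoC (Cmod (H 0 u)) * cis (W u) / (H 0 u * RtoC (Cmod (H 0 u))))%C;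
      [field; split; [exact Nz|apply H0]|rewrite <- E; field; split; [exact Nz|apply H0]]. }
  apply (f_equal fst) in E2; exact E2. }
assert (P := PI_RGT_0).
assert (Hpn : 2 * PI * / INR n < PI / 2).
{ apply Rle_lt_trans with (2 * PI * / 5); [|lra].
  apply Rmult_le_compat_l; [lra|apply Rinv_le_contravar; lra]. }
assert (Ipn : 0 < 2 * PI * / INR n) by (apply Rmult_lt_0_compat; [lra|now apply Rinv_0_lt_compat]).
assert (W0 : W 0 = 2 * PI).
{ assert (Hk : forall k, (k <= n)%nat -> winding H n k 0 = 2 * PI * (INR k / INR n)).
  { intros k; induction k as [|j IH]; intros Hk; [simpl; field; lra|].
    cbn [winding]; rewrite IH by lia.
    assert (EH : forall i, (i <= n)%nat -> H (INR i / INR n) 0 = (RtoC x * cis (2 * PI * (INR i / INR n)))%C).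
    { intros i Hi; unfold H; assert (G := grid_unit n i Hn Hi).
      rewrite (clamp_id 0), clamp_id by (unfold unit_interval; lra); apply Hb; exact G. }
    rewrite 2!EH by lia.
    replace (2 * PI * (INR (S j) / INR n)) with (2 * PI * (INR j / INR n) + 2 * PI * / INR n)
      by (rewrite S_INR; field; lra).
    rewrite cis_plus.
    assert (Nx := RtoC_neq0 x ltac:(lra)).
    assert (Nc : cis (2 * PI * (INR j / INR n)) <> 0%C) by (apply Cmod_neq0; rewrite Cmod_cis; lra).
    match goal with |- context [arg_right ?z] => replace z with (cis (2 * PI * / INR n)) end.
    2:{ field; tauto. }
    rewrite arg_right_cis by lra; reflexivity. }
  unfold W; rewrite Hk by lia; field; lra. }
assert (W1 : W 1 = 0).
{ assert (Hk : forall k, (k <= n)%nat -> winding H n k 1 = 0).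
  { intros k; induction k as [|j IH]; intros Hk; [reflexivity|].
    cbn [winding]; rewrite IH by lia.
    assert (EH : forall i, (i <= n)%nat -> H (INR i / INR n) 1 = (RtoC x * cis (2 * PI * 0))%C).
    { intros i Hi; unfold H; assert (G := grid_unit n i Hn Hi).
      rewrite (clamp_id 1), clamp_id by (unfold unit_interval; lra); apply Ht; exact G. }
    rewrite 2!EH by lia.
    assert (Nx := RtoC_neq0 x ltac:(lra)).
    assert (Nc : cis (2 * PI * 0) <> 0%C) by (apply Cmod_neq0; rewrite Cmod_cis; lra).
    match goal with |- context [arg_right ?z] => replace z with (cis 0) end.
    2:{ unfold cis at 1; rewrite cos_0, sin_0; fold (RtoC 1); field; tauto. }
    rewrite arg_right_cis by lra; ring. }
  unfold W; now rewrite Hk by lia. }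
destruct (IVT_cor (fun u => W u - PI) 0 1) as [u [Hu Eu]].
- intros u; apply continuity_pt_minus; [apply continuity_pt_filterlim, WC|apply continuity_pt_const; now intros ? ?].
- lra.
- rewrite W0, W1; nra.
- specialize (Wcos u); replace (W u) with PI in Wcos by lra; rewrite cos_PI in Wcos; lra.
Qed.

Lemma convex_disc (a b : C) (u : R) : Cmod a < 1 -> Cmod b < 1 -> 0 <= u <= 1 ->
  Cmod (RtoC (1 - u) * a + RtoC u * b) < 1.
Proof.
intros Ha Hb Hu; eapply Rle_lt_trans; [apply Cmod_triangle|].
rewrite 2!Cmod_mult, 2!Cmod_R, 2!Rabs_pos_eq by lra.
destruct (Req_dec u 0) as [E|E]; [rewrite E; nra|].
apply Rlt_le_trans with ((1 - u) * 1 + u * 1); [|lra].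
apply Rplus_le_lt_compat; [apply Rmult_le_compat_l; lra|apply Rmult_lt_compat_l; lra].
Qed.

(* The circle would be contracted inside the image along straight segments of the disc. *)
Lemma circle_not_in_univalent_image (f : C -> C) (x : R) : 0 < x ->
  hol unit_disc f -> injective_on unit_disc f -> (forall u, unit_disc u -> f u <> 0%C) ->
  ~ (forall v, Cmod v = x -> exists u, unit_disc u /\ f u = v).
Proof.
intros Hx Hf Hi Hn Himg.
pose (g := fun t => (RtoC x * cis (2 * PI * t))%C).
assert (G : forall t, { u | unit_disc u /\ f u = g t }).
{ intros t; apply constructive_indefinite_description, Himg, Cmod_polar; lra. }
pose (y := fun t => proj1_sig (G t)).
assert (Y1 : forall t, Cmod (y t) < 1) by (intros t; exact (proj1 (proj2_sig (G t)))).
assert (Y2 : forall t, f (y t) = g t) by (intros t; exact (proj2 (proj2_sig (G t)))).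
assert (Gc : forall t, rcont g t) by (intros t; apply rcont_loop).
(* [y] is chosen point by point; by injectivity it is the lift of the circle through f, so the
   continuity of the inverse applies. *)
assert (Yc : forall t, rcont y t).
{ intros t e He; set (e' := Rmin e (1 - Cmod (y t))).
  assert (He' : 0 < e') by (apply Rmin_glb_lt; [exact He|generalize (Y1 t); lra]).
  assert (E1 : e' <= e) by apply Rmin_l; assert (E2 : e' <= 1 - Cmod (y t)) by apply Rmin_r.
  destruct (inverse_continuous unit_disc f (y t) e' He' Hf Hi) as [k [Hk HK]].
  - intros u Hu; unfold unit_disc; generalize (Cmod_sub_ge u (y t)); lra.
  - destruct (Gc t k Hk) as [d [D Hd]]; exists d; split; [exact D|]; intros s Hs.
    apply Rlt_le_trans with e'; [|exact E1]; apply HK; [apply Y1|rewrite 2!Y2; now apply Hd]. }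
apply (circle_not_null_homotopic (fun u => u <> 0%C) x Hx); [auto|].
exists (fun p => f (RtoC (1 - snd p) * y (fst p) + RtoC (snd p) * y 0)%C).
assert (In : forall p, unit_square p -> Cmod (RtoC (1 - snd p) * y (fst p) + RtoC (snd p) * y 0) < 1).
{ intros p [_ Hp]; apply convex_disc; auto. }
assert (y01 : y 1 = y 0).
{ apply Hi; [apply Y1|apply Y1|]; rewrite 2!Y2; unfold g, cis.
  rewrite Rmult_1_r, Rmult_0_r, cos_2PI, sin_2PI, cos_0, sin_0; reflexivity. }
split; [|split; [|split; [|split]]].
- apply continuous_on_square; intros p Hp eps He.
  destruct (cdiff_cont f _ (Hf _ (In p Hp)) eps He) as [d [D Hd]].
  destruct (Yc (fst p) (d / 2)) as [d' [D' Hd']]; [lra|].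
  (* The first difference is below d / 2 by continuity of [y]; the second is at most 2 times d / 4,
     as points of the disc are at distance at most 2. *)
  exists (Rmin d' (d / 4)); split; [apply Rmin_glb_lt; lra|]; intros r Hr A B; apply Hd.
  assert (A' := lt_min_l _ _ _ A); assert (B' := lt_min_r _ _ _ B).
  specialize (Hd' _ A').
  replace (RtoC (1 - snd r) * y (fst r) + RtoC (snd r) * y 0 - (RtoC (1 - snd p) * y (fst p) + RtoC (snd p) * y 0))%C
    with (RtoC (1 - snd r) * (y (fst r) - y (fst p)) + RtoC (snd r - snd p) * (y 0 - y (fst p)))%C
    by (rewrite !RtoC_minus; ring).
  eapply Rle_lt_trans; [apply Cmod_triangle|].
  rewrite 2!Cmod_mult, 2!Cmod_R, (Rabs_pos_eq (1 - snd r)) by (destruct Hr as [_ [? ?]]; lra).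
  assert (K1 : (1 - snd r) * Cmod (y (fst r) - y (fst p)) <= 1 * Cmod (y (fst r) - y (fst p))).
  { apply Rmult_le_compat_r; [apply Cmod_ge_0|destruct Hr as [_ [? ?]]; lra]. }
  assert (K2 : Cmod (y 0 - y (fst p)) <= 2).
  { eapply Rle_trans; [apply Cmod_sub_le|]; generalize (Y1 0) (Y1 (fst p)); lra. }
  assert (K3 : Rabs (snd r - snd p) * Cmod (y 0 - y (fst p)) <= Rabs (snd r - snd p) * 2).
  { apply Rmult_le_compat_l; [apply Rabs_pos|exact K2]. }
  lra.
- intros p Hp; apply Hn, In, Hp.
- intros t _; cbn [fst snd]; change (RtoC x * cis (2 * PI * t))%C with (g t); rewrite <- Y2; f_equal.
  rewrite Rminus_0_r; ring.
- intros t _; cbn [fst snd]; change (RtoC x * cis (2 * PI * 0))%C with (g 0); rewrite <- Y2; f_equal.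
  rewrite Rminus_diag; ring.
- intros u _; cbn [fst snd]; change (RtoC x * cis (2 * PI * 0))%C with (g 0); rewrite y01, <- Y2.
  split; f_equal; rewrite RtoC_minus; ring.
Qed.

(** * The invariants of the punctured annulus *)

Lemma tanh_exp x : tanh x = 1 - 2 / (exp (2 * x) + 1).
Proof.
assert (E : exp (2 * x) = exp x * exp x) by (rewrite <- exp_plus; f_equal; ring).
assert (P := exp_pos x); unfold tanh, sinh, cosh; rewrite exp_Ropp, E; field; repeat split; nra.
Qed.

Lemma tanh_le x y : x <= y -> tanh x <= tanh y.
Proof.
intros H; rewrite 2!tanh_exp; apply Rplus_le_compat_l, Ropp_le_contravar, Rmult_le_compat_l; [lra|].
assert (P := exp_pos (2 * x)); assert (E := exp_mono (2 * x) (2 * y) ltac:(lra)).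
apply Rinv_le_contravar; lra.
Qed.

Lemma tanh_lt1 x : tanh x < 1.
Proof.
rewrite tanh_exp; assert (P := exp_pos (2 * x)).
assert (0 < 2 / (exp (2 * x) + 1)) by (apply Rdiv_lt_0_compat; lra); lra.
Qed.

Lemma artanh_le a b : 0 <= a <= b -> b < 1 -> artanh a <= artanh b.
Proof.
intros H Hb; destruct (Rle_lt_dec (artanh a) (artanh b)) as [L|L]; [exact L|].
assert (E := tanh_le _ _ (Rlt_le _ _ L)); rewrite 2!tanh_artanh in E by lra.
replace b with a by lra; lra.
Qed.

Lemma carath_le G z w l : 0 <= l < 1 ->
  (forall f, hol G f -> maps_to G unit_disc f -> f z = 0%C -> Cmod (f w) <= l) ->
  Rbar_le (carath G z w) (artanh l).
Proof.
intros Hl H; apply Lub_Rbar_correct; intros t [f [Hf [Hm [Hz ->]]]]; simpl.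
rewrite hol_iff in Hf; apply artanh_le; [|lra]; split; [apply Cmod_ge_0|now apply H].
Qed.

(** The uniform bound l < 1 makes the supremum finite, so that [real] returns it and not its default
    value 0. *)
Lemma carath_value G z w l : G w -> 0 <= l < 1 ->
  (forall f, hol G f -> maps_to G unit_disc f -> f z = 0%C -> Cmod (f w) <= l) ->
  forall f, hol G f -> maps_to G unit_disc f -> f z = 0%C -> Cmod (f w) <= tanh (real (carath G z w)).
Proof.
intros Hw Hl H f Hf Hm Hz; assert (U := carath_le G z w l Hl H).
assert (Hfw := Hm w Hw); assert (P := Cmod_ge_0 (f w)); unfold unit_disc in Hfw.
assert (L : Rbar_le (artanh (Cmod (f w))) (carath G z w)).
{ apply Lub_Rbar_correct; exists f; rewrite hol_iff; auto. }
rewrite <- (tanh_artanh (Cmod (f w))) by lra.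
destruct (carath G z w) as [c| |]; simpl in *; try contradiction; now apply tanh_le.
Qed.

Lemma annulus_points_joined (r z x : R) : 0 < r -> r < z < 1 -> r < x < 1 ->
  exists l, 0 <= l < 1 /\ forall f, hol (annulus r) f -> maps_to (annulus r) unit_disc f ->
    f (RtoC z) = 0%C -> Cmod (f (RtoC (- x))) <= l.
Proof.
intros Hr Hz Hx.
(* A spiral from z to - x whose modulus moves linearly, hence stays at distance at least d from both
   boundary circles. *)
pose (y := fun t => (RtoC ((1 - t) * z + t * x) * cis (PI * t))%C).
set (d := Rmin (Rmin (z - r) (x - r)) (Rmin (1 - z) (1 - x))).
assert (D : 0 < d) by (unfold d; repeat apply Rmin_glb_lt; lra).
assert (D1 : d <= z - r) by min_le.
assert (D2 : d <= x - r) by min_le.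
assert (D3 : d <= 1 - z) by min_le.
assert (D4 : d <= 1 - x) by min_le.
assert (P := PI_RGT_0).
(* A parameter step 1 / n moves the spiral by at most (1 + 2 pi) / n, so this n meets the step size
   d / 8 of [chain_bound]. *)
destruct (archimed_cor1 (d / (8 * (1 + 2 * PI)))) as [n [Hn Pn]]; [apply Rdiv_lt_0_compat; lra|].
assert (In : 0 < INR n) by now apply lt_0_INR.
assert (Mod : forall t, 0 <= t <= 1 -> Cmod (y t) = (1 - t) * z + t * x /\ r + d <= Cmod (y t) <= 1 - d).
{ intros t Ht; assert (E : Cmod (y t) = (1 - t) * z + t * x) by (apply Cmod_polar; nra).
  rewrite E; split; [reflexivity|]; split; nra. }
destruct (chain_bound (annulus r) (fun i => y (INR i / INR n)) n d D) as [l [Hl HB]].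
- intros i Hi u Hu; destruct (Mod _ (grid_unit n i Pn Hi)) as [_ M].
  generalize (Cmod_sub_ge u (y (INR i / INR n))) (Cmod_sub_ge (y (INR i / INR n)) u).
  rewrite (Cmod_sub_sym (y _)); unfold annulus; lra.
- intros i Hi; assert (G1 := grid_unit n i Pn ltac:(lia)); assert (G2 := grid_unit n (S i) Pn Hi).
  set (a := INR i / INR n) in *; set (b := INR (S i) / INR n) in *.
  assert (E : b - a = / INR n) by (unfold a, b; rewrite S_INR; field; lra).
  assert (Hb : 0 < b - a) by (rewrite E; now apply Rinv_0_lt_compat).
  eapply Rle_trans; [apply polar_lip|].
  replace ((1 - b) * z + b * x - ((1 - a) * z + a * x)) with ((b - a) * (x - z)) by ring.
  replace (PI * b - PI * a) with (PI * (b - a)) by ring.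
  rewrite 2!Rabs_mult, (Rabs_pos_eq PI), (Rabs_pos_eq (b - a)), (Rabs_pos_eq ((1 - a) * z + a * x)) by nra.
  assert (X1 : Rabs (x - z) <= 1) by (apply Rabs_le; lra).
  assert (X2 : (1 - a) * z + a * x <= 1) by nra.
  apply Rle_trans with ((b - a) * (1 + 2 * PI)).
  + assert (0 <= Rabs (x - z)) by apply Rabs_pos.
    assert (Y1 : (b - a) * Rabs (x - z) <= (b - a) * 1) by (apply Rmult_le_compat_l; lra).
    assert (Y2 : ((1 - a) * z + a * x) * (PI * (b - a)) <= 1 * (PI * (b - a))).
    { apply Rmult_le_compat_r; [nra|exact X2]. }
    lra.
  + rewrite E; apply Rle_trans with (d / (8 * (1 + 2 * PI)) * (1 + 2 * PI)).
    * apply Rmult_le_compat_r; lra.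
    * right; field; lra.
- exists l; split; [exact Hl|]; intros f Hf Hm H0; specialize (HB f Hf Hm).
  replace (y (INR 0 / INR n)) with (RtoC z) in HB.
  2:{ unfold y; simpl INR; unfold Rdiv; rewrite Rmult_0_l, Rmult_0_r; unfold cis; rewrite cos_0, sin_0.
    fold (RtoC 1); rewrite <- RtoC_mult; f_equal; ring. }
  replace (y (INR n / INR n)) with (RtoC (- x)) in HB; [now apply HB|].
  unfold y; replace (INR n / INR n) with 1 by (field; lra); rewrite Rmult_1_r; unfold cis; rewrite cos_PI, sin_PI.
  fold (RtoC (-1)); rewrite <- RtoC_mult; f_equal; ring.
Qed.

(** The condition 0 <= l covers the empty set, for which [Lub_Rbar] is minus infinity and [real]
    returns 0. *)
Lemma real_Lub_le (E : R -> Prop) (l : R) : 0 <= l -> (forall t, E t -> t <= l) -> real (Lub_Rbar E) <= l.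
Proof.
intros Hl H; assert (U : Rbar_le (Lub_Rbar E) l) by (apply Lub_Rbar_correct; exact H).
destruct (Lub_Rbar E) as [c| |]; simpl in *; [exact U|contradiction|exact Hl].
Qed.

Theorem theorem1p6 :
  forall r p : R, 0 < r < 1 -> -1 < p < - sqrt r ->
  let D : C -> Prop := fun x => annulus r x /\ x <> RtoC p in
  forall z : R, r < z < 1 ->
    injectivity_radius D z <> tanh (real (carath (annulus r) z p)) /\
    fridman_invariant D z <> tanh (real (carath (annulus r) z p)).
Proof.
intros r p Hr Hp; assert (exists x, p = - x) as [x ->] by (exists (- p); ring).
intros D z Hz; set (s := sqrt r) in *.
assert (Ess : s * s = r) by (apply sqrt_sqrt; lra).
assert (Hs : 0 < s < 1).
{ split; [apply sqrt_lt_R0; lra|]; apply Rlt_le_trans with (sqrt 1); [apply sqrt_lt_1; lra|rewrite sqrt_1; lra]. }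
assert (Hrs : r < s) by nra.
destruct (annulus_points_joined r z x) as [l [Hl HB]]; [lra..|].
assert (Ap : annulus r (RtoC (- x))).
{ unfold annulus; rewrite Cmod_R, Rabs_Ropp, Rabs_pos_eq; lra. }
assert (V := carath_value (annulus r) (RtoC z) (RtoC (- x)) l Ap Hl HB).
set (sg := tanh (real (carath (annulus r) z (- x)%R))) in *.
destruct (critical_circle_gap s z x sg (annulus r) Hs) as [k [Hk Gap]]; try lra.
{ intros u; rewrite Ess; reflexivity. }
{ apply tanh_lt1. }
{ exact V. }
assert (sg1 : sg < 1) by apply tanh_lt1.
assert (DA : forall u, D u -> u <> 0%C).
{ intros u [Hu _] E; unfold annulus in Hu; rewrite E, Cmod_0 in Hu; lra. }
(* The competitors for the distance of D may be singular at - x, and the gap bounds exactly such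
   functions. *)
assert (Circ : forall t w, k < tanh t -> Cmod w = s -> carath_ball D z t w).
{ intros t w Ht Hw.
  assert (Dw : D w).
  { split; [unfold annulus; lra|]; intros E; rewrite E, Cmod_R, Rabs_Ropp, Rabs_pos_eq in Hw by lra; lra. }
  split; [exact Dw|]; apply Rbar_le_lt_trans with (artanh k).
  - apply carath_le; [lra|]; intros f Hf Hm H0; apply Gap; try assumption.
    intros u Au Nu; assert (Du : D u) by now split.
    split; [now apply Hf|now apply Hm].
  - simpl; destruct (Rlt_le_dec (artanh k) t) as [L|L]; [exact L|exfalso].
    apply tanh_le in L; rewrite tanh_artanh in L by lra; lra. }
(* No radius with tanh above k is admissible, so both suprema are at most k, which is smaller than
   sg. *)
split; apply Rlt_not_eq, Rle_lt_trans with k; try lra; apply real_Lub_le; try lra;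
  intros t [t0 [Ht0 [-> H]]]; (destruct (Rle_lt_dec (tanh t0) k) as [L|L]; [exact L|exfalso]).
- destruct H as [_ H].
  apply (circle_not_null_homotopic (carath_ball D z t0) s); [lra|intros u [Hu _]; now apply DA|].
  apply H.
  + split; [|intros t _; apply Circ; [exact L|apply Cmod_polar; lra]].
    apply continuous_on_interval; intros t _; apply rcont_loop.
  + unfold cis; rewrite Rmult_0_r, Rmult_1_r, cos_2PI, sin_2PI, cos_0, sin_0; reflexivity.
- destruct H as [f [Hf [Hm [Hi Himg]]]]; rewrite hol_iff in Hf.
  apply (circle_not_in_univalent_image f s); [lra|exact Hf|exact Hi|intros u Hu; apply DA, Hm, Hu|].
  intros v Hv; apply Himg, Circ; assumption.
Qed.
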